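(* Let $2\le k\le n-1$, and let $X$ be one of the simply connected $n$-dimensional model spaces $\mathbb{R}^n$, $\mathbb{H}^n$, $\mathbb{S}^n$ of constant curvature $c=0,-1,1$ respectively. Put $p=\frac nk$ if $X=\mathbb{R}^n$ or $X=\mathbb{S}^n$, and $p=\frac{n-1}{k-1}$ if $X=\mathbb{H}^n$. Then there is a constant $K>0$ depending only on $n$ and $k$ such that for every radial function $f:X\to\mathbb{C}$ in the Lorentz space $L^{p,1}(X)$, $$\left\|s_c'\left(d(o,\cdot)\right)R_kf(\cdot)\right\|_{L^\infty(\Xi_k(X))}\le K\|f\|_{L^{p,1}(X)}.$$
   Context: $\mathbb{R}^n$, $\mathbb{H}^n$ (real hyperbolic space) and $\mathbb{S}^n$ (unit sphere) carry their standard Riemannian metrics of sectional curvature $c=0,-1,1$, with Riemannian distance $d$ and Riemannian measure $\mu$. A point $o\in X$ is fixed as origin (realizing the spaces in $\mathbb{R}^{n+1}$ as $\{x_{n+1}=1\}$, the upper sheet of the hyperboloid, and the unit sphere, $o=e_{n+1}$). $\delta(X)$ is the diameter of $X$: $\infty$ for $c=0,-1$ and $\pi$ for $\mathbb{S}^n$. The function $s_c$ is $s_0(t)=t$, $s_{-1}(t)=\sinh t$, $s_1(t)=\sin t$; thus $s_c'$ is $1$, $\cosh t$, $\cos t$ respectively. $\Xi_k(X)$ is the collection of all $k$-dimensional totally-geodesic submanifolds of $X$ that are (nonempty) intersections of $X$ with $(k+1)$-dimensional linear subspaces of $\mathbb{R}^{n+1}$, equipped with its natural isometry-invariant measure. For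 $\xi\in\Xi_k(X)$, $d(o,\xi)=\inf_{x\in\xi}d(o,x)$. The $k$-plane transform of $f$ is $R_kf(\xi)=\int_\xi f(x)\,\mathrm{d}_\xi x$, where $\mathrm{d}_\xi x$ is the Riemannian measure of the metric induced on $\xi$. A (measurable) function $f:X\to\mathbb{C}$ is radial if there is a function $\tilde f:s_c\left([0,\delta(X)/4)\right)\to\mathbb{C}$ such that $f(x)=\tilde f\left(s_c\left(d(o,x)/2\right)\right)$. On the sphere only even functions ($f(-x)=f(x)$) are considered, and this identity is required for $d(o,x)<\pi/2$. $L^{p,1}(X)$ is the Lorentz space with (quasi-)norm $\|f\|_{L^{p,1}(X)}=\frac1p\int_0^\infty t^{1/p}f^*(t)\frac{\mathrm{d}t}{t}$, $f^*$ being the decreasing rearrangement of $f$ with respect to $\mu$; in particular $\|\chi_E\|_{L^{p,1}(X)}=\mu(E)^{1/p}$. *)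

(* Defs.v *)
From HB Require Import structures.
From mathcomp Require Import all_boot all_order all_algebra.
From mathcomp Require Import complex.
From mathcomp Require Import all_classical all_reals all_analysis.

Set Implicit Arguments.
Unset Strict Implicit.
Unset Printing Implicit Defensive.

Import Order.TTheory GRing.Theory Num.Theory.
Import numFieldNormedType.Exports.

Local Open Scope classical_set_scope.
Local Open Scope ring_scope.

Definition rV_display : measure_display.
Proof. exact: default_measure_display. Qed.

(* The product sigma-algebra of the coordinates, as for tuples in the library;
   on [R^n] it is the Borel sigma-algebra. *)
Section rV_measurable.
Context {R : realType} (n : nat).

Let coors : 'I_n -> 'rV[R]_n -> measurableTypeR R := fun i v => v 0 i.

Let rV_set0 : g_sigma_preimage coors set0.
Proof. exact: sigma_algebra0. Qed.

Let rV_setC A : g_sigma_preimage coors A -> g_sigma_preimage coors (~` A).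
Proof. exact: sigma_algebraC. Qed.

Let rV_bigcup (F : _^nat) : (forall i, g_sigma_preimage coors (F i)) ->
  g_sigma_preimage coors (\bigcup_i (F i)).
Proof. exact: sigma_algebra_bigcup. Qed.

HB.instance Definition _ := @isMeasurable.Build rV_display
  'rV[R]_n (g_sigma_preimage coors) rV_set0 rV_setC rV_bigcup.

End rV_measurable.

Section lebesgue_rV.
Context {R : realType}.

Lemma measurable_coord n (i : 'I_n) :
  measurable_fun [set: 'rV[R]_n] (fun v => v 0 i : measurableTypeR R).
Proof.
move=> _ Y mY; rewrite setTI; apply: sub_sigma_algebra => /=.
rewrite -bigcup_seq/=; exists i => /=; first by rewrite mem_index_enum.
by exists Y => //; rewrite setTI.
Qed.

Lemma measurable_fun_rV d (T : measurableType d) n (f : T -> 'rV[R]_n) :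
  (forall i, measurable_fun [set: T] (fun x => f x 0 i : measurableTypeR R)) ->
  measurable_fun [set: T] f.
Proof.
move=> mf _ A mA; rewrite setTI; move: A mA.
apply: smallest_sub => [|B].
  split; first by rewrite preimage_set0.
    by move=> B mB; rewrite setTD preimage_setC; exact: measurableC.
  by move=> F mF; rewrite preimage_bigcup; exact: bigcup_measurable.
rewrite -bigcup_seq => -[i _ [C mC <-]].
by rewrite setTI -comp_preimage -[X in measurable X]setTI; exact: mf.
Qed.

Definition rV_cons n (z : measurableTypeR R * 'rV[R]_n) : 'rV[R]_n.+1 :=
  row_mx ((z.1)%:M : 'rV[R]_1) z.2.

Definition rV_uncons n (v : 'rV[R]_n.+1) : measurableTypeR R * 'rV[R]_n :=
  (v 0 0, rsubmx (v : 'rV_(1 + n))).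

Lemma rV_consK n : cancel (@rV_cons n) (@rV_uncons n).
Proof.
move=> [x v]; rewrite /rV_uncons /rV_cons/= row_mxKr; congr pair.
have -> : (0 : 'I_n.+1) = lshift n (0 : 'I_1) by exact/val_inj.
by rewrite (row_mxEl (x%:M : 'rV[R]_1) v) mxE eqxx.
Qed.

Lemma measurable_rV_cons n : measurable_fun setT (@rV_cons n).
Proof.
apply: measurable_fun_rV => i.
case: (@split_ordP 1 n i) => j ->.
  rewrite (_ : (fun z => rV_cons z 0 (lshift n j)) = fst)//.
  apply/funext => -[x v].
  by rewrite /rV_cons (row_mxEl (x%:M : 'rV[R]_1) v) !ord1 mxE eqxx.
rewrite (_ : (fun z => rV_cons z 0 (rshift 1 j)) =
             (fun v : 'rV[R]_n => v 0 j : measurableTypeR R) \o snd).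
  exact: measurableT_comp (measurable_coord j) measurable_snd.
by apply/funext => -[x v]; rewrite /rV_cons (row_mxEr (x%:M : 'rV[R]_1) v).
Qed.

Lemma measurable_rV_uncons n : measurable_fun setT (@rV_uncons n).
Proof.
apply/measurable_fun_pairP; split; first exact: measurable_coord.
apply: measurable_fun_rV => i.
rewrite (_ : (fun v => ((snd \o @rV_uncons n) v) 0 i) =
             (fun v : 'rV[R]_n.+1 => v 0 (rshift 1 i) : measurableTypeR R)).
  exact: (@measurable_coord n.+1).
by apply/funext => v; rewrite mxE.
Qed.

Section step.
Variables (n : nat) (mu : {sigma_finite_measure set 'rV[R]_n -> \bar R}).

Definition lebesgue_step : set 'rV[R]_n.+1 -> \bar R :=
  pushforward (lebesgue_measure \x mu)%E (@rV_cons n).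

Let measurable_preimage_cons A : measurable A ->
  measurable (@rV_cons n @^-1` A).
Proof. by move=> mA; rewrite -[X in measurable X]setTI; exact: measurable_rV_cons. Qed.

Let lebesgue_step0 : lebesgue_step set0 = 0%E.
Proof. by rewrite /lebesgue_step /pushforward preimage_set0 measure0. Qed.

Let lebesgue_step_ge0 A : (0 <= lebesgue_step A)%E.
Proof. by rewrite /lebesgue_step /pushforward measure_ge0. Qed.

Let lebesgue_step_sigma_additive : semi_sigma_additive lebesgue_step.
Proof.
move=> F mF tF mUF; rewrite /lebesgue_step /pushforward preimage_bigcup.
apply: measure_semi_sigma_additive.
- by move=> i; exact: measurable_preimage_cons.
- apply/trivIsetP => /= i j _ _ ij; rewrite -preimage_setI.
  by move/trivIsetP : tF => /(_ _ _ _ _ ij) ->//; rewrite preimage_set0.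
- by rewrite -preimage_bigcup; exact: measurable_preimage_cons.
Qed.

HB.instance Definition _ := isMeasure.Build _ _ _ lebesgue_step
  lebesgue_step0 lebesgue_step_ge0 lebesgue_step_sigma_additive.

Let lebesgue_step_sigma_finite : sigma_finite setT lebesgue_step.
Proof.
have /sigma_finiteP[F [TF ndF Foo]] := sigma_finiteT (@lebesgue_measure R).
have /sigma_finiteP[G [TG ndG Goo]] := sigma_finiteT mu.
exists (fun i => @rV_uncons n @^-1` (F i `*` G i)).
  rewrite -preimage_bigcup (_ : \bigcup_i _ = setT) ?preimage_setT//.
  rewrite -subTset => -[x v] _.
  have [i _ Fx] : (\bigcup_i F i) x by rewrite -TF.
  have [j _ Gv] : (\bigcup_j G j) v by rewrite -TG.
  exists (maxn i j) => //; split => /=.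
    by move: Fx; exact/subsetPset/ndF/leq_maxl.
  by move: Gv; exact/subsetPset/ndG/leq_maxr.
move=> i; have [mF Fi] := Foo i; have [mG Gi] := Goo i; split.
  rewrite -[X in measurable X]setTI; apply: measurable_rV_uncons => //.
  exact: measurableX.
have consK : @rV_uncons n \o @rV_cons n = id.
  by apply/funext => z /=; rewrite rV_consK.
rewrite /lebesgue_step /pushforward -comp_preimage consK.
by rewrite product_measure1E// lte_mul_pinfty// ge0_fin_numE.
Qed.

HB.instance Definition _ := Measure_isSigmaFinite.Build _ _ _ lebesgue_step
  lebesgue_step_sigma_finite.

End step.

Fixpoint lebesgue_rV (n : nat) : {sigma_finite_measure set 'rV[R]_n -> \bar R} :=
  match n with
  | 0 => \d_(0 : 'rV[R]_0)
  | n.+1 => lebesgue_step (lebesgue_rV n)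
  end.

End lebesgue_rV.

Inductive model := Euclidean | Hyperbolic | Spherical.

Section model_spaces.
Context {R : realType}.
Implicit Types (X : model) (t : R).

Definition sinh t : R := (expR t - expR (- t)) / 2.

Definition arcosh t : R := ln (t + Num.sqrt (t ^+ 2 - 1)).

Definition s_ X t : R :=
  match X with Euclidean => t | Hyperbolic => sinh t | Spherical => sin t end.

Definition quarter_diameter X : \bar R :=
  match X with Spherical => (pi / 4)%:E | _ => +oo%E end.

Section dimension.
Variable n : nat.
Implicit Types x y : 'rV[R]_n.+1.

(* The Lorentz form for the hyperboloid, the dot product otherwise; in each
   case it restricts to the Riemannian metric on vectors tangent to the model.
   The distinguished coordinate is the last one. *)
Definition ambient_form X x y : R :=
  \sum_(i < n) x 0 (lift ord_max i) * y 0 (lift ord_max i)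
  + (if X is Hyperbolic then -1 else 1) * (x 0 ord_max * y 0 ord_max).

Definition model_space X : set 'rV[R]_n.+1 :=
  match X with
  | Euclidean => [set x | x 0 ord_max = 1]
  | Hyperbolic => [set x | ambient_form X x x = -1 /\ 0 < x 0 ord_max]
  | Spherical => [set x | ambient_form X x x = 1]
  end.

Definition origin : 'rV[R]_n.+1 := delta_mx 0 ord_max.

(* Meaningful for [x] and [y] in [model_space X] only. *)
Definition model_dist X x y : R :=
  match X with
  | Euclidean => Num.sqrt (ambient_form X (x - y) (x - y))
  | Hyperbolic => arcosh (- ambient_form X x y)
  | Spherical => acos (ambient_form X x y)
  end.

Definition dist_set X x (xi : set 'rV[R]_n.+1) : R :=
  inf [set model_dist X x y | y in xi].

Definition isometry X (g : 'rV[R]_n.+1 -> 'rV[R]_n.+1) : Prop :=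
  set_bij (model_space X) (model_space X) g /\
  forall x y, model_space X x -> model_space X y ->
    model_dist X (g x) (g y) = model_dist X x y.

Definition Xi X k : set (set 'rV[R]_n.+1) :=
  [set xi | xi !=set0 /\ exists V : {vspace 'rV[R]_n.+1},
              \dim V = k.+1 /\ xi = model_space X `&` [set` V]].

Section riemannian_measure.
Variables (X : model) (m : nat).
Implicit Types (U : set 'rV[R]_m) (phi : 'rV[R]_m -> 'rV[R]_n.+1).

(* Local C^1 parametrizations of the [m]-dimensional submanifold [M]. *)
Definition parametrization (M : set 'rV[R]_n.+1) U phi : Prop :=
  [/\ open U, phi @` U `<=` M, {in U &, injective phi},
      (forall u, U u -> differentiable phi u /\ row_free (jacobian phi u)) &
      forall i : 'I_m, {in U, continuous (fun u => 'D_(delta_mx 0 i) phi u)}].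

(* Coefficients of the induced metric in the coordinates given by [phi]. *)
Definition metric_tensor phi u : 'M[R]_m :=
  \matrix_(i, j) ambient_form X ('D_(delta_mx 0 i) phi u)
                                ('D_(delta_mx 0 j) phi u).

(* [mu] is the Riemannian measure of the metric induced on the
   [m]-dimensional submanifold [M] of [model_space X]: it is carried by [M]
   and has density [sqrt (det g)] in every parametrization.  This determines
   it on Borel sets. *)
Definition is_riemannian_measure (M : set 'rV[R]_n.+1)
    (mu : {measure set 'rV[R]_n.+1 -> \bar R}) : Prop :=
  mu (~` M) = 0%E /\
  forall U phi, parametrization M U phi ->
  forall B : set 'rV[R]_n.+1, measurable B ->
    mu (phi @` U `&` B) =
    (\int[lebesgue_rV m]_(u in U `&` phi @^-1` B)
        (Num.sqrt (\det (metric_tensor phi u)))%:E)%E.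

End riemannian_measure.

(* The Effros sigma-algebra of [Xi X k], which is generated by the conditions
   "xi meets U" for U open and is the Borel sigma-algebra of the homogeneous
   space [Xi X k].  A measurable type has to be inhabited
   whatever the parameters, hence the carrier is the type of all sets of
   points and the complement of [Xi X k] is an atom. *)
Definition hitting_sets X k : set (set (set 'rV[R]_n.+1)) :=
  [set Xi X k `&` [set xi | xi `&` U !=set0] | U in open].

Definition plane_type X k := g_sigma_algebraType (hitting_sets X k).

(* Such a measure is unique up to a positive factor. *)
Definition is_invariant_measure X k
    (nu : {measure set (plane_type X k) -> \bar R}) : Prop :=
  [/\ nu (~` Xi X k) = 0%E, nu (Xi X k) != 0%E, sigma_finite setT nu &
      forall g, isometry X g ->
      forall A : set (plane_type X k), measurable A -> A `<=` Xi X k ->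
        nu [set g @` xi | xi in A] = nu A].

Implicit Types f : 'rV[R]_n.+1 -> R[i].
Implicit Types mu : {measure set 'rV[R]_n.+1 -> \bar R}.

Definition modulus (z : R[i]) : R := ComplexField.Normc.normc z.

Definition cmeasurable (D : set 'rV[R]_n.+1) f : Prop :=
  measurable_fun D (fun x => complex.Re (f x) : measurableTypeR R) /\
  measurable_fun D (fun x => complex.Im (f x) : measurableTypeR R).

Definition cintegrable mu (D : set 'rV[R]_n.+1) f : Prop :=
  mu.-integrable D (fun x => (complex.Re (f x))%:E) /\
  mu.-integrable D (fun x => (complex.Im (f x))%:E).

Definition cintegral mu (D : set 'rV[R]_n.+1) f : R[i] :=
  Complex (\int[mu]_(x in D) complex.Re (f x))
          (\int[mu]_(x in D) complex.Im (f x)).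

(* On the whole of [model_space X], except that on the sphere the profile only
   prescribes [f] on the open upper hemisphere. *)
Definition radial X f : Prop :=
  (X = Spherical -> forall x, model_space X x -> f (- x) = f x) /\
  exists ftilde : R -> R[i], forall x, model_space X x ->
    ((model_dist X origin x / 2)%:E < quarter_diameter X)%E ->
    f x = ftilde (s_ X (model_dist X origin x / 2)).

Definition decreasing_rearrangement mu (D : set 'rV[R]_n.+1) f t : \bar R :=
  ereal_inf [set s%:E | s in
    [set s : R | 0 <= s /\ (mu (D `&` [set x | (s < modulus (f x))%R]) <= t%:E)%E]].

Definition lorentz_norm mu (D : set 'rV[R]_n.+1) (p : R) f : \bar R :=
  ((p^-1)%:E * \int[lebesgue_measure]_(t in `]0%R, +oo[%classic)
     ((t `^ p^-1)%:E * decreasing_rearrangement mu D f t * (t^-1)%:E))%E.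

Definition in_lorentz mu (D : set 'rV[R]_n.+1) (p : R) f : Prop :=
  cmeasurable D f /\ (lorentz_norm mu D p f < +oo)%E.

(* [lam xi] is the Riemannian measure of [xi]. *)
Definition kplane_transform (lam : set 'rV[R]_n.+1 ->
    {measure set 'rV[R]_n.+1 -> \bar R}) f (xi : set 'rV[R]_n.+1) : R[i] :=
  cintegral (lam xi) xi f.

(* The library integral is total.  The value +oo where the integral over [xi]
   does not exist makes a bound on this modulus include the existence of the
   transform. *)
Definition kplane_modulus (lam : set 'rV[R]_n.+1 ->
    {measure set 'rV[R]_n.+1 -> \bar R}) f (xi : set 'rV[R]_n.+1) : \bar R :=
  if `[< cintegrable (lam xi) xi f >]
  then (modulus (kplane_transform lam f xi))%:E else +oo%E.

End dimension.

Definition critical_exponent X (n k : nat) : R :=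
  if X is Hyperbolic then n.-1%:R / k.-1%:R else n%:R / k%:R.

End model_spaces.

(* Main.v *)
Require Import Defs.
From HB Require Import structures.
From mathcomp Require Import all_boot all_order all_algebra.
From mathcomp Require Import complex.
From mathcomp Require Import all_classical all_reals all_analysis.
From mathcomp Require Import measurable_realfun ess_sup_inf.
From mathcomp Require Import ring lra.
Import Order.TTheory GRing.Theory Num.Theory.
Import numFieldNormedType.Exports.
Local Open Scope classical_set_scope.
Local Open Scope ring_scope.
Set Implicit Arguments.
Unset Strict Implicit.
Unset Printing Implicit Defensive.

(**
Let [z = 2 s_c(r / 2)^2], where [r] is the distance to the origin. A totally
geodesic plane [xi] at distance [d] from the origin has polar coordinates
centered at its point closest to the origin, whose radial variable is [z] and
whose angular variable is a stereographic coordinate. In them the Riemannian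
density is [s_c(rho)^(k-2) / s_c'(d)] times a function of the angle, where
[rho <= r] is the distance inside [xi]. Hence for a radial set [E], consisting
of the points with [z] in [A],
  [s_c'(d) |xi `&` E| <= C int_A s_c(r)^(k-2) dz]  and
  [int_A s_c(r)^(n-2) dz <= C mu(E)],
and a bathtub argument (cut at [s_c(r) = a] and optimize in [a]) bounds the
first integral by the power [1/p] of the second one, because [{s_c(r) < a}] has
[z]-length [O(a^2)], or [O(a)] in the hyperbolic case. This is the theorem for
indicators. Summing over the level sets of [|f|] at the levels [2^j], [j] an
integer, gives the general case, as
[sum_j 2^j mu(|f| > 2^j)^(1/p)] is comparable to the Lorentz norm.
*)

(** * Partial derivatives of explicit maps *)

(** The Riemannian measures are given only by [sqrt (det g)] in charts, so everything rests on one
    family of explicit charts with diagonal metric, and on handling what these charts miss. The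
    center [b0] of a plane, and on the sphere also [- b0], are null points, seen by a chart centered
    elsewhere. The box of stereographic coordinates accounts for one half of each plane; the
    reflection [flip_row] gives the other half. On the spherical equator [z = 1] a radial function
    is not tied to its profile, but this is a single, negligible radial value. Spherical planes
    inside the equator have no center with [h > 0]; on them the weight vanishes.

    The exponent comes from the cut: it gives [a^(k - 2 + e)] on the plane against [a^(n - 2 + e)]
    on the space, where [e] is [2], or [1] in the hyperbolic case. Hence
    [1/p = (k - 2 + e) / (n - 2 + e)], which contains both formulas for [p]. From the comparison of
    radial masses on, [m] and [m'] stand for [k - 2] and [n - 2]. *)

Section diff_tools.
Context {R : realType}.
Implicit Types V W : normedModType R.

Lemma differentiable_comp_real V (f : V -> R) (g : R -> R) (dg : R) x :
  differentiable f x -> is_derive (f x) 1 g dg ->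
  differentiable (g \o f) x /\
  forall v, 'D_v (g \o f) x = dg * 'D_v f x.
Proof.
move=> df gP.
have dgf : differentiable g (f x) by apply/derivable1_diffP; exact: ex_derive.
split=> [|v]; first exact: differentiable_comp.
rewrite deriveE; last exact: differentiable_comp.
rewrite diff_comp//= [in RHS]deriveE// deriv1E; last exact: ex_derive.
by rewrite derive1E derive_val; exact: mulrC.
Qed.

Lemma derive_coord m n (M v : 'M[R]_(m.+1, n.+1)) i j :
  'D_v (fun N : 'M[R]_(m.+1, n.+1) => N i j : R) M = v i j.
Proof.
have := @derive_mx R 'M[R]_(m.+1, n.+1) m.+1 n.+1 id M v (@derivable_id _ _ _ _).
by rewrite derive_id => /matrixP /(_ i j); rewrite mxE => ->.
Qed.

Lemma deriveZl V W (k : V -> R) (w : W) x v : differentiable k x ->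
  'D_v (fun z => k z *: w) x = 'D_v k x *: w.
Proof.
move=> dk; rewrite deriveE; last exact: differentiableZl.
by rewrite diffZl// deriveE.
Qed.

End diff_tools.

Section has_diff.
Context {R : realType}.
Implicit Types V W : normedModType R.

(** Differentiability bundled with the value of one directional derivative: the rules below let
    [apply] build the derivative of an explicit formula as an existential variable, which
    [has_diff_eq] exchanges for a simplified form. *)
Definition has_diff V W (f : V -> W) x v d := differentiable f x /\ 'D_v f x = d.

Lemma has_diff_differentiable V W (f : V -> W) x v d :
  has_diff f x v d -> differentiable f x.
Proof. by case. Qed.

Lemma has_diff_eq V W (f : V -> W) x v d d' :
  has_diff f x v d -> d = d' -> has_diff f x v d'.
Proof. by move=> ? <-. Qed.

Lemma has_diff_cst V W (a : W) (x v : V) : has_diff (fun=> a) x v 0.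
Proof. by split; [exact: differentiable_cst|rewrite derive_cst]. Qed.

Lemma has_diffD V W (f g : V -> W) x v df dg :
  has_diff f x v df -> has_diff g x v dg ->
  has_diff (fun y => f y + g y) x v (df + dg).
Proof.
move=> [f1 <-] [g1 <-]; split; first exact: differentiableD.
by rewrite deriveD//; exact: diff_derivable.
Qed.

Lemma has_diffN V W (f : V -> W) x v df :
  has_diff f x v df -> has_diff (fun y => - f y) x v (- df).
Proof.
move=> [f1 <-]; split; first exact: differentiableN.
by rewrite deriveN//; exact: diff_derivable.
Qed.

Lemma has_diffM V (f g : V -> R) x v df dg :
  has_diff f x v df -> has_diff g x v dg ->
  has_diff (fun y => f y * g y) x v (f x * dg + g x * df).
Proof.
move=> [f1 <-] [g1 <-]; split; first exact: differentiableM.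
by rewrite deriveM//; exact: diff_derivable.
Qed.

Lemma has_diffV V (f : V -> R) x v df : f x != 0 ->
  has_diff f x v df -> has_diff (fun y => (f y)^-1) x v (- (f x) ^- 2 * df).
Proof.
move=> fx0 [f1 <-]; split; first exact: differentiableV.
by rewrite deriveV//; exact: diff_derivable.
Qed.

Lemma has_diffZl V W (f : V -> R) (w : W) x v df :
  has_diff f x v df -> has_diff (fun y => f y *: w) x v (df *: w).
Proof.
by move=> [f1 <-]; split; [exact: differentiableZl|rewrite deriveZl].
Qed.

Lemma has_diff_sum V W n (f : 'I_n -> V -> W) x v df :
  (forall i, has_diff (f i) x v (df i)) ->
  has_diff (fun y => \sum_(i < n) f i y) x v (\sum_(i < n) df i).
Proof.
move=> fP; rewrite -fct_sumE; split.
  by apply: differentiable_sum => i; case: (fP i).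
rewrite derive_sum; last by move=> i; apply: diff_derivable; case: (fP i).
by apply: eq_bigr => i _; case: (fP i).
Qed.

Lemma has_diff_coord m n (M v : 'M[R]_(m.+1, n.+1)) i j :
  has_diff (fun N : 'M[R]_(m.+1, n.+1) => N i j : R) M v (v i j).
Proof. by split; [exact: differentiable_coord|exact: derive_coord]. Qed.

Lemma has_diff_sqrt V (f : V -> R) x v df : 0 < f x ->
  has_diff f x v df ->
  has_diff (fun y => Num.sqrt (f y)) x v ((2 * Num.sqrt (f x))^-1 * df).
Proof.
move=> fx0 [f1 <-].
have [? dv] := differentiable_comp_real f1 (is_derive1_sqrt fx0).
by split => //; rewrite -dv.
Qed.

End has_diff.

Definition curvature {R : realType} (X : model) : R :=
  match X with Euclidean => 0 | Hyperbolic => -1 | Spherical => 1 end.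

(** * Stereographic and polar coordinates on a plane *)

Section polar.
Context {R : realType}.

Definition norm1 m (v : 'rV[R]_m) : R := 1 + \sum_j v 0 j ^+ 2.

(* The point of the unit sphere whose stereographic projection from the pole
   [(-1, 0, ..., 0)] is [v]. *)
Definition stereo m (v : 'rV[R]_m) : 'rV[R]_m.+1 :=
  \row_(i < m.+1) if unlift ord0 i is Some j then 2 * v 0 j / norm1 v
                  else 2 / norm1 v - 1.

(** With [D = s_c(d)^2] this is [s_c(r)^2 - s_c(d)^2], that is [(s_c'(d) s_c(rho))^2] by the right
    triangle with sides [d], [rho] and hypotenuse [r]. The two coefficients in [polar] are thus
    [s_c'(rho)] and [s_c(rho)]. *)
Definition polar_quad (c D z : R) : R := 2 * z - c * z ^+ 2 - D.

(* Polar coordinates centered at [b0] on the plane spanned by [b0] and [B]. The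
   radial variable is not the distance to [b0] but [z = 2 s_c(r / 2)^2], [r] being
   the distance to the origin: it is the same for all planes, and densities are
   then polynomial in the distances. [h] and [D] are [s_c'(d)] and [s_c(d)^2], [d]
   being the distance from the origin to [b0]. *)
Definition polar m n (c h D : R) (b0 : 'rV[R]_n) (B : 'M[R]_(m.+1, n))
    (z : R) (v : 'rV[R]_m) : 'rV[R]_n :=
  ((1 - c * z) / h) *: b0 + (Num.sqrt (polar_quad c D z) / h) *: (stereo v *m B).

Definition dstereo m (v : 'rV[R]_m) (j : 'I_m) : 'rV[R]_m.+1 :=
  \row_(i < m.+1) if unlift ord0 i is Some l
    then 2 * (l == j)%:R / norm1 v - 4 * v 0 l * v 0 j / norm1 v ^+ 2
    else - (4 * v 0 j / norm1 v ^+ 2).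

Lemma norm1_gt0 m (v : 'rV[R]_m) : 0 < norm1 v.
Proof. by rewrite ltr_wpDr// sumr_ge0// => i _; exact: sqr_ge0. Qed.

Lemma norm1_neq0 m (v : 'rV[R]_m) : norm1 v != 0.
Proof. by rewrite gt_eqF// norm1_gt0. Qed.

Lemma sum_sqr_norm1 m (v : 'rV[R]_m) : \sum_j v 0 j ^+ 2 = norm1 v - 1.
Proof. by rewrite /norm1 addrAC subrr add0r. Qed.

Lemma stereo0 m (v : 'rV[R]_m) : stereo v 0 0 = 2 / norm1 v - 1.
Proof. by rewrite mxE unlift_none. Qed.

Lemma stereoS m (v : 'rV[R]_m) i : stereo v 0 (lift ord0 i) = 2 * v 0 i / norm1 v.
Proof. by rewrite mxE liftK. Qed.

Lemma dstereo0 m (v : 'rV[R]_m) j : dstereo v j 0 0 = - (4 * v 0 j / norm1 v ^+ 2).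
Proof. by rewrite mxE unlift_none. Qed.

Lemma dstereoS m (v : 'rV[R]_m) j l : dstereo v j 0 (lift ord0 l) =
  2 * (l == j)%:R / norm1 v - 4 * v 0 l * v 0 j / norm1 v ^+ 2.
Proof. by rewrite mxE liftK. Qed.

Lemma stereo_norm m (v : 'rV[R]_m) : \sum_i stereo v 0 i ^+ 2 = 1.
Proof.
rewrite big_ord_recl stereo0; under eq_bigr do rewrite stereoS.
have -> : \sum_(i < m) (2 * v 0 i / norm1 v) ^+ 2
    = (norm1 v - 1) * (2 / norm1 v) ^+ 2.
  rewrite -sum_sqr_norm1 mulr_suml; apply: eq_bigr => i _.
  by rewrite /=; field; exact: norm1_neq0.
by field; exact: norm1_neq0.
Qed.

Lemma sum_delta m (F : 'I_m -> R) (j : 'I_m) : \sum_(i < m) (i == j)%:R * F i = F j.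
Proof.
rewrite (bigD1 j)//= eqxx mul1r big1 ?addr0// => i /negPf ->.
by rewrite mul0r.
Qed.

Lemma stereo_dstereo m (v : 'rV[R]_m) j : \sum_i stereo v 0 i * dstereo v j 0 i = 0.
Proof.
rewrite big_ord_recl stereo0 dstereo0.
under eq_bigr do rewrite stereoS dstereoS.
set N := norm1 v; have N0 : N != 0 := norm1_neq0 v.
have -> : \sum_(i < m) 2 * v 0 i / N *
     (2 * (i == j)%:R / N - 4 * v 0 i * v 0 j / N ^+ 2)
  = (\sum_(i < m) (i == j)%:R * v 0 i) * (4 / N ^+ 2)
    - (N - 1) * (8 * v 0 j / N ^+ 3).
  rewrite -sum_sqr_norm1 !mulr_suml -sumrB.
  by apply: eq_bigr => i _; field.
by rewrite sum_delta; field.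
Qed.

(** Stereographic projection is conformal with factor [2 / norm1 v], so the angular block of the
    metric will be a multiple of the identity. *)
Lemma dstereo_dot m (v : 'rV[R]_m) j l :
  \sum_i dstereo v j 0 i * dstereo v l 0 i = (j == l)%:R * (2 / norm1 v) ^+ 2.
Proof.
rewrite big_ord_recl !dstereo0.
under eq_bigr do rewrite !dstereoS.
set N := norm1 v; have N0 : N != 0 := norm1_neq0 v.
have -> : \sum_(i < m) (2 * (i == j)%:R / N - 4 * v 0 i * v 0 j / N ^+ 2) *
     (2 * (i == l)%:R / N - 4 * v 0 i * v 0 l / N ^+ 2)
  = (\sum_(i < m) (i == j)%:R * (i == l)%:R) * (4 / N ^+ 2)
    - (\sum_(i < m) (i == j)%:R * v 0 i) * (8 * v 0 l / N ^+ 3)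
    - (\sum_(i < m) (i == l)%:R * v 0 i) * (8 * v 0 j / N ^+ 3)
    + (N - 1) * (16 * v 0 j * v 0 l / N ^+ 4).
  rewrite -sum_sqr_norm1 !mulr_suml -!sumrB -big_split.
  by apply: eq_bigr => i _ /=; field.
by rewrite !sum_delta; field.
Qed.

End polar.

Section polar_diff.
Context {R : realType}.

Lemma rV_unconsE m (u : 'rV[R]_m.+1) j : (rV_uncons u).2 0 j = u 0 (lift ord0 j).
Proof. by rewrite mxE -rshift1. Qed.

Lemma has_diff_norm1 m (u v : 'rV[R]_m.+1) :
  has_diff (fun u => norm1 (rV_uncons u).2) u v
    (\sum_(j < m) 2 * u 0 (lift ord0 j) * v 0 (lift ord0 j)).
Proof.
rewrite (_ : (fun _ => _) = (fun u : 'rV[R]_m.+1 =>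
    1 + \sum_(j < m) u 0 (lift ord0 j) * u 0 (lift ord0 j))); last first.
  by apply/funext => w; congr (1 + _); apply: eq_bigr => j _; rewrite rV_unconsE expr2.
apply: has_diff_eq.
  apply: has_diffD; first exact: has_diff_cst.
  by apply: has_diff_sum => i; apply: has_diffM; exact: has_diff_coord.
by rewrite add0r; apply: eq_bigr => i _; ring.
Qed.

Lemma sum_delta_lift m (j : 'I_m) (F : 'I_m -> R) :
  \sum_(i < m) F i * (delta_mx 0 (lift ord0 j) : 'rV[R]_m.+1) 0 (lift ord0 i) = F j.
Proof.
rewrite -[RHS](sum_delta F j); apply: eq_bigr => i _.
by rewrite mxE eqxx/= (inj_eq lift_inj) mulrC.
Qed.

Lemma has_diff_norm1_0 m (u : 'rV[R]_m.+1) :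
  has_diff (fun u => norm1 (rV_uncons u).2) u (delta_mx 0 0) 0.
Proof.
apply: has_diff_eq (has_diff_norm1 _ _) _.
by rewrite big1// => i _; rewrite mxE eqxx/= mulr0.
Qed.

Lemma has_diff_norm1_lift m (u : 'rV[R]_m.+1) (j : 'I_m) :
  has_diff (fun u => norm1 (rV_uncons u).2) u (delta_mx 0 (lift ord0 j))
    (2 * u 0 (lift ord0 j)).
Proof.
apply: has_diff_eq (has_diff_norm1 _ _) _.
exact: (sum_delta_lift j (fun i => 2 * u 0 (lift ord0 i))).
Qed.

Lemma has_diff_stereo m (u v : 'rV[R]_m.+1) d i :
  has_diff (fun u => norm1 (rV_uncons u).2) u v d ->
  has_diff (fun u => stereo (rV_uncons u).2 0 i) u v
    (if unlift ord0 i is Some l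
     then 2 * v 0 (lift ord0 l) / norm1 (rV_uncons u).2
          - 2 * u 0 (lift ord0 l) * d / norm1 (rV_uncons u).2 ^+ 2
     else - (2 * d / norm1 (rV_uncons u).2 ^+ 2)).
Proof.
move=> Nd; have N0 := norm1_neq0 (rV_uncons u).2.
case: unliftP => [l ->|->].
  rewrite (_ : (fun _ => _) = (fun u : 'rV[R]_m.+1 =>
    2 * u 0 (lift ord0 l) * (norm1 (rV_uncons u).2)^-1)); last first.
    by apply/funext => w; rewrite stereoS rV_unconsE.
  apply: has_diff_eq.
    apply: has_diffM; last exact: (has_diffV (f := fun u => norm1 (rV_uncons u).2) N0 Nd).
    by apply: has_diffM; [exact: has_diff_cst|exact: has_diff_coord].
  by rewrite /=; field.
rewrite (_ : (fun _ => _) = (fun u : 'rV[R]_m.+1 =>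
  2 * (norm1 (rV_uncons u).2)^-1 + (-1))); last first.
  by apply/funext => w; rewrite stereo0.
apply: has_diff_eq.
  apply: has_diffD; last exact: has_diff_cst.
  apply: has_diffM; first exact: has_diff_cst.
  exact: (has_diffV (f := fun u => norm1 (rV_uncons u).2) N0 Nd).
by rewrite /=; field.
Qed.

Lemma has_diff_stereo_0 m (u : 'rV[R]_m.+1) i :
  has_diff (fun u => stereo (rV_uncons u).2 0 i) u (delta_mx 0 0) 0.
Proof.
apply: has_diff_eq (has_diff_stereo _ (has_diff_norm1_0 _)) _.
by case: unliftP => [l _|_]; rewrite ?mxE ?mulr0 ?mul0r ?subr0 ?oppr0 ?mulr0 ?mul0r.
Qed.

Lemma has_diff_stereo_lift m (u : 'rV[R]_m.+1) i j :
  has_diff (fun u => stereo (rV_uncons u).2 0 i) u (delta_mx 0 (lift ord0 j))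
    (dstereo (rV_uncons u).2 j 0 i).
Proof.
apply: has_diff_eq (has_diff_stereo _ (has_diff_norm1_lift _ j)) _.
case: unliftP => [l ->|->]; last by rewrite dstereo0 rV_unconsE; congr (- (_ / _)); ring.
rewrite dstereoS !rV_unconsE mxE eqxx/= (inj_eq lift_inj).
by congr (_ - _ / _); ring.
Qed.

Lemma differentiable_dstereo m (u : 'rV[R]_m.+1) i j :
  differentiable (fun u => dstereo (rV_uncons u).2 j 0 i) u.
Proof.
have N0 := norm1_neq0 (rV_uncons u).2.
have dN2 := has_diffV (f := fun u => norm1 (rV_uncons u).2) N0 (has_diff_norm1 u 0).
have dc l := has_diff_coord u 0 0 (lift ord0 l).
have [l ->|->] := unliftP ord0 i.
  rewrite (_ : (fun _ => _) = (fun u : 'rV[R]_m.+1 =>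
    2 * (l == j)%:R * (norm1 (rV_uncons u).2)^-1 -
    4 * (u 0 (lift ord0 l) * u 0 (lift ord0 j) *
     ((norm1 (rV_uncons u).2)^-1 * (norm1 (rV_uncons u).2)^-1)))); last first.
    apply/funext => w; rewrite dstereoS !rV_unconsE.
    by have := norm1_neq0 (rV_uncons w).2 => Nw; field.
  apply: (has_diff_differentiable (v := 0)).
  apply: has_diffD.
    by apply: has_diffM; [exact: has_diff_cst|exact: dN2].
  apply: has_diffN; apply: has_diffM; first exact: has_diff_cst.
  apply: has_diffM; first by apply: has_diffM; exact: dc.
  by apply: has_diffM; exact: dN2.
rewrite (_ : (fun _ => _) = (fun u : 'rV[R]_m.+1 =>
    (- 4) * (u 0 (lift ord0 j) *
     ((norm1 (rV_uncons u).2)^-1 * (norm1 (rV_uncons u).2)^-1)))); last first.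
  apply/funext => w; rewrite dstereo0 !rV_unconsE.
  by have := norm1_neq0 (rV_uncons w).2 => Nw; field.
apply: (has_diff_differentiable (v := 0)).
apply: has_diffM; first exact: has_diff_cst.
by apply: has_diffM; [exact: dc|apply: has_diffM; exact: dN2].
Qed.

Section polar_rV.
Variables (m n : nat) (c h D : R) (b0 : 'rV[R]_n.+1) (B : 'M[R]_(m.+1, n.+1)).

Definition polar_rV (u : 'rV[R]_m.+1) : 'rV[R]_n.+1 :=
  polar c h D b0 B (u 0 0) (rV_uncons u).2.

(** The bound [2] makes the box contain the closed unit ball, which [stereo] maps onto the closed
    hemisphere of nonnegative first coordinate, and keeps its volume finite. *)
Definition polar_dom : set 'rV[R]_m.+1 :=
  [set u | [/\ 0 < u 0 0, 0 < polar_quad c D (u 0 0) &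
              forall j, `|u 0 (lift ord0 j)| < 2]].

Definition dpolar (i : 'I_m.+1) (u : 'rV[R]_m.+1) : 'rV[R]_n.+1 :=
  if unlift ord0 i is Some j
  then (Num.sqrt (polar_quad c D (u 0 0)) / h) *: (dstereo (rV_uncons u).2 j *m B)
  else (- c / h) *: b0 +
     ((1 - c * u 0 0) / (h * Num.sqrt (polar_quad c D (u 0 0))))
       *: (stereo (rV_uncons u).2 *m B).

Lemma has_diff_quad (u v : 'rV[R]_m.+1) :
  has_diff (fun u : 'rV[R]_m.+1 => polar_quad c D (u 0 0)) u v
    (2 * (1 - c * u 0 0) * v 0 0).
Proof.
rewrite (_ : (fun _ => _) = (fun u : 'rV[R]_m.+1 =>
   2 * u 0 0 - c * (u 0 0 * u 0 0) - D)); last first.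
  by apply/funext => w; rewrite /polar_quad expr2.
have dc : has_diff (fun u : 'rV[R]_m.+1 => u 0 0) u v (v 0 0).
  exact: has_diff_coord.
apply: has_diff_eq.
  apply: has_diffD; last exact: has_diff_cst.
  apply: has_diffD.
    by apply: has_diffM; [exact: has_diff_cst|exact: dc].
  apply: has_diffN; apply: has_diffM; first exact: has_diff_cst.
  by apply: has_diffM; exact: dc.
by rewrite /=; ring.
Qed.

Lemma has_diff_sqrt_quad (u v : 'rV[R]_m.+1) : 0 < polar_quad c D (u 0 0) ->
  has_diff (fun u : 'rV[R]_m.+1 => Num.sqrt (polar_quad c D (u 0 0))) u v
    ((2 * Num.sqrt (polar_quad c D (u 0 0)))^-1 * (2 * (1 - c * u 0 0) * v 0 0)).
Proof.
move=> q0; apply: (has_diff_sqrt (f := fun u : 'rV[R]_m.+1 => _)) => //.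
exact: has_diff_quad.
Qed.

Lemma has_diff_polar u i : polar_dom u ->
  has_diff polar_rV u (delta_mx 0 i) (dpolar i u).
Proof.
move=> [_ q0 _].
have sq0 : Num.sqrt (polar_quad c D (u 0 0)) != 0 by rewrite gt_eqF// sqrtr_gt0.
rewrite (_ : polar_rV = (fun u : 'rV[R]_m.+1 =>
  ((1 + (- c) * u 0 0) * h^-1) *: b0 +
  \sum_j (Num.sqrt (polar_quad c D (u 0 0)) * h^-1 *
          stereo (rV_uncons u).2 0 j) *: row j B)); last first.
  apply/funext => w; rewrite /polar_rV /polar mulNr; congr (_ + _).
  by rewrite mulmx_sum_row scaler_sumr; apply: eq_bigr => j _; rewrite scalerA.
have dc v : has_diff (fun u : 'rV[R]_m.+1 => u 0 0) u v (v 0 0).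
  exact: has_diff_coord.
have dstereo_j j : has_diff (fun u => stereo (rV_uncons u).2 0 j) u (delta_mx 0 i)
    (if unlift ord0 i is Some l then dstereo (rV_uncons u).2 l 0 j else 0).
  by case: unliftP => [l ->|->]; [exact: has_diff_stereo_lift|exact: has_diff_stereo_0].
have dsq := has_diff_sqrt_quad (delta_mx 0 i) q0.
have dj j := has_diffM (has_diffM dsq (has_diff_cst h^-1 _ _)) (dstereo_j j).
apply: has_diff_eq.
  apply: has_diffD.
    apply: has_diffZl; apply: has_diffM; last exact: has_diff_cst.
    apply: has_diffD; first exact: has_diff_cst.
    by apply: has_diffM; [exact: has_diff_cst|exact: dc].
  by apply: has_diff_sum => j; apply: has_diffZl; exact: dj.
rewrite /dpolar; case: unliftP => [l ->|->].
  rewrite mxE eqxx/= !(mulr0, addr0, add0r, mul0r) scale0r add0r.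
  rewrite mulmx_sum_row scaler_sumr; apply: eq_bigr => j _.
  by rewrite scalerA; congr (_ *: _); rewrite !(mulr0, addr0).
rewrite !mxE !eqxx/= mulmx_sum_row scaler_sumr.
congr (_ *: _ + _).
  by rewrite !(mulr0, mulr1, addr0, add0r); rewrite mulrC.
apply: eq_bigr => j _; rewrite scalerA; congr (_ *: _).
rewrite /= !invfM; set hi := h^-1; set s := Num.sqrt _ in sq0 *.
by field.
Qed.

(** [parametrization] asks for continuous partial derivatives. They are given by the explicit
    [dpolar], whose continuity follows from its differentiability. *)
Lemma differentiable_dpolar u i : polar_dom u -> differentiable (dpolar i) u.
Proof.
move=> [_ q0 _].
have sq0 : Num.sqrt (polar_quad c D (u 0 0)) != 0 by rewrite gt_eqF// sqrtr_gt0.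
have dc v : has_diff (fun u : 'rV[R]_m.+1 => u 0 0) u v (v 0 0).
  exact: has_diff_coord.
have dsq := has_diff_sqrt_quad 0 q0.
have [j ij|ij] := unliftP ord0 i.
  rewrite (_ : dpolar i = (fun u : 'rV[R]_m.+1 =>
    \sum_l (Num.sqrt (polar_quad c D (u 0 0)) * h^-1 *
          dstereo (rV_uncons u).2 j 0 l) *: row l B)); last first.
    apply/funext => w; rewrite /dpolar ij liftK.
    by rewrite mulmx_sum_row scaler_sumr; apply: eq_bigr => l _; rewrite scalerA.
  apply: (has_diff_differentiable (v := 0)).
  have ddstereo l : has_diff (fun u => dstereo (rV_uncons u).2 j 0 l) u 0
      ('D_0 (fun u => dstereo (rV_uncons u).2 j 0 l) u).
    by split => //; exact: differentiable_dstereo.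
  apply: has_diff_sum => l; apply: has_diffZl; apply: has_diffM.
    by apply: has_diffM; [exact: dsq|exact: has_diff_cst].
  exact: ddstereo.
rewrite (_ : dpolar i = (fun u : 'rV[R]_m.+1 => (- c / h) *: b0 +
    \sum_l (((1 + (- c) * u 0 0) * h^-1) *
          (Num.sqrt (polar_quad c D (u 0 0)))^-1  *
          stereo (rV_uncons u).2 0 l) *: row l B)); last first.
  apply/funext => w; rewrite /dpolar ij unlift_none; congr (_ + _).
  rewrite mulmx_sum_row scaler_sumr; apply: eq_bigr => l _; rewrite scalerA.
  by rewrite invfM mulNr !mulrA.
apply: (has_diff_differentiable (v := 0)).
apply: has_diffD; first exact: has_diff_cst.
apply: has_diff_sum => l; apply: has_diffZl; apply: has_diffM.
  apply: has_diffM; last exact: (has_diffV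
    (f := fun u : 'rV[R]_m.+1 => Num.sqrt (polar_quad c D (u 0 0))) sq0 dsq).
  apply: has_diffM; last exact: has_diff_cst.
  apply: has_diffD; first exact: has_diff_cst.
  by apply: has_diffM; [exact: has_diff_cst|exact: dc].
exact: has_diff_stereo (has_diff_norm1 u 0).
Qed.

End polar_rV.
End polar_diff.

(** * The Riemannian measure in polar coordinates *)

Section ambient_form.
Context {R : realType} (X : model) (n : nat).
Implicit Types x y : 'rV[R]_n.+1.
Local Notation F := (ambient_form X).

Lemma ambient_formC x y : F x y = F y x.
Proof.
rewrite /ambient_form; congr (_ + _ * _); last exact: mulrC.
by apply: eq_bigr => i _; exact: mulrC.
Qed.

Lemma ambient_formDl x x' y : F (x + x') y = F x y + F x' y.
Proof.
rewrite /ambient_form addrACA -big_split/= !mxE mulrDl mulrDr; congr (_ + _).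
by apply: eq_bigr => i _; rewrite !mxE mulrDl.
Qed.

Lemma ambient_formZl a x y : F (a *: x) y = a * F x y.
Proof.
rewrite /ambient_form mulrDr mulr_sumr !mxE.
congr (_ + _); first by apply: eq_bigr => i _; rewrite !mxE mulrA.
by rewrite -mulrA mulrCA.
Qed.

Lemma ambient_formDr x y y' : F x (y + y') = F x y + F x y'.
Proof. by rewrite ambient_formC ambient_formDl !(ambient_formC x). Qed.

Lemma ambient_formZr a x y : F x (a *: y) = a * F x y.
Proof. by rewrite ambient_formC ambient_formZl (ambient_formC x). Qed.

Lemma ambient_form0l y : F 0 y = 0.
Proof. by rewrite -(scale0r 0) ambient_formZl mul0r. Qed.

Lemma ambient_form_suml I (r : seq I) (P : pred I) (f : I -> 'rV[R]_n.+1) y :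
  F (\sum_(i <- r | P i) f i) y = \sum_(i <- r | P i) F (f i) y.
Proof.
elim/big_rec2: _ => [|i a b _ <-]; first exact: ambient_form0l.
by rewrite ambient_formDl.
Qed.

Lemma ambient_form_mulmxl m (w : 'rV[R]_m) (B : 'M[R]_(m, n.+1)) y :
  F (w *m B) y = \sum_i w 0 i * F (row i B) y.
Proof.
by rewrite mulmx_sum_row ambient_form_suml; apply: eq_bigr => i _; rewrite ambient_formZl.
Qed.

Lemma ambient_form_mulmxr m (w : 'rV[R]_m) (B : 'M[R]_(m, n.+1)) y :
  F y (w *m B) = \sum_i w 0 i * F y (row i B).
Proof.
rewrite ambient_formC ambient_form_mulmxl.
by apply: eq_bigr => i _; rewrite ambient_formC.
Qed.

End ambient_form.

Section polar_frame.
Context {R : realType}.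

(* The conditions involving the curvature are void in the Euclidean case, where the
   coefficient of [b0] in [polar] is constant. *)
Record polar_frame (X : model) m n (h D : R) (b0 : 'rV[R]_n.+1)
    (B : 'M[R]_(m.+1, n.+1)) : Prop := PolarFrame {
  pf_gt0 : 0 < h ;
  pf_hD : 1 - curvature X * D = h ^+ 2 ;
  pf_BB : forall i j, ambient_form X (row i B) (row j B) = (i == j)%:R ;
  pf_b0B : forall i, curvature X * ambient_form X b0 (row i B) = 0 ;
  pf_b0b0 : curvature X ^+ 2 * ambient_form X b0 b0 = curvature X }.

Variables (X : model) (m n : nat) (h D : R) (b0 : 'rV[R]_n.+1).
Variable B : 'M[R]_(m.+1, n.+1).
Hypothesis frame : polar_frame X h D b0 B.
Local Notation c := (curvature X).
Local Notation F := (ambient_form X).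
Local Notation phi := (polar_rV c h D b0 B).
Local Notation q := (polar_quad c D).
Local Notation U := (@polar_dom R m c D).

Lemma frame_dot (w w' : 'rV[R]_m.+1) :
  F (w *m B) (w' *m B) = \sum_i w 0 i * w' 0 i.
Proof.
rewrite ambient_form_mulmxl; apply: eq_bigr => i _.
rewrite ambient_form_mulmxr; congr (_ * _).
rewrite -[RHS](sum_delta (fun l => w' 0 l)); apply: eq_bigr => l _.
by rewrite (pf_BB frame) mulrC eq_sym.
Qed.

Lemma frame_b0_dot (w : 'rV[R]_m.+1) : c * F b0 (w *m B) = 0.
Proof.
rewrite ambient_form_mulmxr mulr_sumr big1// => i _.
by rewrite mulrCA (pf_b0B frame) mulr0.
Qed.

(** The radial derivative combines [b0], with a factor [c], and the radius [stereo v]; the angular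
    ones are tangent to the sphere. They are orthogonal since [dstereo] is orthogonal to [stereo]
    and [c] times the form vanishes between [b0] and the rows of [B]. *)
Lemma metric_tensor_polar u : U u ->
  metric_tensor X phi u = diag_mx (\row_i
    if unlift ord0 i is Some _
    then (Num.sqrt (q (u 0 0)) / h * (2 / norm1 (rV_uncons u).2)) ^+ 2
    else (q (u 0 0))^-1).
Proof.
move=> Uu; have [z0 q0 _] := Uu; apply/matrixP => i j; rewrite !mxE.
have h0 := pf_gt0 frame.
have hn0 : h != 0 by rewrite gt_eqF.
have [_ ->] := has_diff_polar h b0 B i Uu.
have [_ ->] := has_diff_polar h b0 B j Uu.
rewrite /dpolar; have [i' ->|->] := unliftP ord0 i; have [j' ->|->] := unliftP ord0 j.
- rewrite ambient_formZl ambient_formZr frame_dot dstereo_dot (inj_eq lift_inj).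
  by case: eqP => _; rewrite ?mulr1n ?mulr0n ?mul0r ?mulr0//; ring.
- rewrite ambient_formZl ambient_formDr !ambient_formZr frame_dot.
  rewrite eq_sym (negPf (neq_lift _ _)) mulr0n.
  under eq_bigr do rewrite mulrC.
  rewrite stereo_dstereo mulr0 addr0 ambient_formC.
  have := frame_b0_dot (dstereo (rV_uncons u).2 i'); set f := F b0 _ => cf0.
  set r := Num.sqrt _; transitivity (- r / h / h * (c * f)); first by ring.
  by rewrite cf0 mulr0.
- rewrite ambient_formZr ambient_formDl !ambient_formZl frame_dot.
  rewrite (negPf (neq_lift _ _)) mulr0n.
  rewrite stereo_dstereo mulr0 addr0.
  have := frame_b0_dot (dstereo (rV_uncons u).2 j'); set f := F b0 _ => cf0.
  set r := Num.sqrt _; transitivity (- r / h / h * (c * f)); first by ring.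
  by rewrite cf0 mulr0.
- rewrite eqxx mulr1n ambient_formDl !ambient_formDr !ambient_formZl !ambient_formZr.
  rewrite frame_dot (ambient_formC _ _ b0).
  have -> : \sum_i stereo (rV_uncons u).2 0 i * stereo (rV_uncons u).2 0 i = 1.
    by rewrite -(stereo_norm (rV_uncons u).2); apply: eq_bigr => l _; rewrite expr2.
  have := frame_b0_dot (stereo (rV_uncons u).2).
  set f := F b0 (_ *m _) => cf0.
  have := pf_b0b0 frame; set g := F b0 b0 => cg.
  set s := Num.sqrt _; have sq : q (u 0 0) = s ^+ 2 by rewrite sqr_sqrtr// ltW.
  have s0 : s != 0 by rewrite gt_eqF// sqrtr_gt0.
  rewrite sq.
  transitivity ((c ^+ 2 * g - 2 * (1 - c * u 0 0) / s * (c * f)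
     + (1 - c * u 0 0) ^+ 2 / s ^+ 2) / h ^+ 2); first by field; rewrite hn0.
  rewrite cf0 cg mulr0 subr0.
  (* Multiplied by [s ^+ 2], which is [q z], this is the identity
     [c q(z) + (1 - c z)^2 = 1 - c D = h^2]. *)
  suff -> : c + (1 - c * u 0 0) ^+ 2 / s ^+ 2 = h ^+ 2 / s ^+ 2.
    by field; rewrite ?hn0 ?s0.
  apply: (@mulIf _ (s ^+ 2)); first by rewrite expf_neq0.
  rewrite mulrDl !divfK ?expf_neq0// -(pf_hD frame) -sq /polar_quad.
  by ring.
Qed.

(** Since [Num.sqrt (q z) / h] is [s_c(rho)], this is [s_c(rho)^(m - 1) / h] for positive [m]: the
    inverse root comes from the radial direction, the power from the [m] angular ones. *)
Definition polar_density (z : R) : R :=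
  (Num.sqrt (q z))^-1 * (Num.sqrt (q z) / h) ^+ m.

Definition stereo_density (v : 'rV[R]_m) : R := (2 / norm1 v) ^+ m.

Lemma sqrt_det_metric u : U u ->
  Num.sqrt (\det (metric_tensor X phi u)) =
  polar_density (u 0 0) * stereo_density (rV_uncons u).2.
Proof.
move=> Uu; rewrite metric_tensor_polar// det_diag big_ord_recl.
rewrite mxE unlift_none; under eq_bigr do rewrite mxE liftK.
rewrite prodr_const card_ord.
have [z0 q0 _] := Uu; have h0 := pf_gt0 frame.
rewrite /polar_density /stereo_density -[RHS]mulrA -[X in _ = _ * X]exprMn.
set s := Num.sqrt (q (u 0 0)); have sq : q (u 0 0) = s ^+ 2 by rewrite sqr_sqrtr// ltW.
have s0 : 0 < s by rewrite sqrtr_gt0.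
rewrite sq -exprVn -exprM mulnC exprM -exprMn sqrtr_sqr ger0_norm//.
rewrite mulr_ge0 ?invr_ge0 ?(ltW s0)// exprn_ge0// mulr_ge0//.
  by rewrite divr_ge0// ltW.
by rewrite divr_ge0// ltW// norm1_gt0.
Qed.

Lemma stereo_inj : injective (@stereo R m).
Proof.
move=> v w vw; have N : norm1 v = norm1 w.
  move/rowP : (vw) => /(_ 0); rewrite !stereo0 => /addIr.
  have n2 : (2 : R) != 0 by rewrite pnatr_eq0.
  by move=> /(mulfI n2)/invr_inj.
apply/rowP => j; move/rowP : vw => /(_ (lift ord0 j)); rewrite !stereoS N.
move=> /(mulIf _); rewrite invr_eq0 norm1_neq0 => /(_ isT).
have n2 : (2 : R) != 0 by rewrite pnatr_eq0.
by move=> /(mulfI n2).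
Qed.

(** The form with [b0], multiplied by [c], isolates [c z]. The forms with the rows of [B] then give
    [s_c(rho)] times a unit vector; its norm and its direction determine the rest. *)
Lemma polar_rV_inj : {in U &, injective phi}.
Proof.
move=> u w; rewrite !inE => -[u0 qu _] [w0 qw _] /eqP.
rewrite /polar_rV /polar -subr_eq0.
set zu := u 0 0; set zw := w 0 0.
set su := Num.sqrt _; set sw := Num.sqrt (q zw).
set tu := stereo _; set tw := stereo (rV_uncons w).2 => /eqP eq0.
have h0 := pf_gt0 frame; have hn0 : h != 0 by rewrite gt_eqF.
have {}eq0 : (c * (zw - zu) / h) *: b0 + ((su / h) *: tu - (sw / h) *: tw) *m B = 0.
  rewrite -[RHS]eq0 mulmxBl -!scalemxAl opprD addrACA -scalerBl.
  by congr (_ *: _ + _); field.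
have cz : c * (zw - zu) = 0.
  have := congr1 (fun x => c * (h * F b0 x)) eq0.
  rewrite ambient_formDr ambient_formZr [F b0 0]ambient_formC ambient_form0l !mulr0.
  set y := _ *m B; have -> : c * (h * (c * (zw - zu) / h * F b0 b0 + F b0 y)) =
     (zw - zu) * (c ^+ 2 * F b0 b0) + h * (c * F b0 y) by field.
  by rewrite (pf_b0b0 frame) frame_b0_dot mulr0 addr0 mulrC.
move: eq0; rewrite cz mul0r scale0r add0r => eq0.
have tE : (su / h) *: tu = (sw / h) *: tw.
  apply/eqP; rewrite -subr_eq0; apply/eqP; set y := _ - _ in eq0 *.
  apply/rowP => i; have := congr1 (fun x => F x (row i B)) eq0.
  rewrite ambient_form0l ambient_form_mulmxl.
  under eq_bigr do rewrite (pf_BB frame) mulrC.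
  by rewrite (sum_delta (fun j => y 0 j)) => ->; rewrite mxE.
have tE2 : (su / h) ^+ 2 = (sw / h) ^+ 2.
  have := congr1 (fun x : 'rV[R]_m.+1 => \sum_i x 0 i ^+ 2) tE => /=.
  under eq_bigr do rewrite mxE exprMn.
  under [X in _ = X -> _]eq_bigr do rewrite mxE exprMn.
  by rewrite -!mulr_sumr !stereo_norm !mulr1.
have sE : su = sw.
  move: tE2 => /eqP; rewrite eqrXn2 ?divr_ge0 ?sqrtr_ge0 ?(ltW h0)// => /eqP.
  by move=> /(mulIf _) -> //; rewrite invr_neq0.
have tE' : tu = tw.
  move: tE; rewrite sE; apply: scalerI.
  by rewrite mulf_neq0 ?invr_neq0// gt_eqF// sqrtr_gt0.
(* For [c = 0], [q] is affine in [z] and its value determines [z]; otherwise [c z] does. *)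
have zE : zu = zw.
  have : q zu = q zw by rewrite -[LHS]sqr_sqrtr ?ltW// -/su sE sqr_sqrtr// ltW.
  move: cz; rewrite /polar_quad; case: X => /=; lra.
apply/rowP => i; have [j ->|->] := unliftP ord0 i; last exact: zE.
by rewrite -!rV_unconsE (stereo_inj tE').
Qed.

Lemma open_polar_dom : open U.
Proof.
suff nU (u : 'rV[R]_m.+1) : U u -> \forall w \near u, U w.
  by rewrite openE => u /nU.
move=> [u0 qu uj].
have cu l : {for u, continuous (fun w : 'rV[R]_m.+1 => w 0 l)}.
  by apply: differentiable_continuous; exact: differentiable_coord.
have cq : {for u, continuous (fun w : 'rV[R]_m.+1 => q (w 0 0))}.
  apply: differentiable_continuous.
  exact: (has_diff_differentiable (has_diff_quad c D u 0)).
have FF : Filter (nbhs u) by exact: nbhs_filter.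
have nq := cvgr_gt (FF := FF) (q (u 0 0)) cq _ qu.
have n0 := cvgr_gt (FF := FF) (u 0 0) (cu 0) _ u0.
have nj := @filter_forall _ _
  (fun (j : 'I_m) (w : 'rV[R]_m.+1) => `|w 0 (lift ord0 j)| < 2) (nbhs u) FF
  (fun j => cvgr_norm_lt (FF := FF) (u 0 (lift ord0 j)) (cu _) _ (uj j)).
by apply: (@filterS3 _ (nbhs u) FF _ _ _ _ _ n0 nq nj) => w.
Qed.

Lemma parametrization_polar (M : set 'rV[R]_n.+1) (V : set 'rV[R]_m.+1) :
  open V -> V `<=` U -> phi @` V `<=` M -> parametrization M V phi.
Proof.
move=> oV VU phiM; split => //.
- by move=> u w; rewrite !inE => /VU Uu /VU Uw; apply: polar_rV_inj; rewrite inE.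
- move=> u /VU Uu; have dphi i := has_diff_polar h b0 B i Uu.
  have du : differentiable phi u by case: (dphi ord0).
  split => //.
  (* The Gram matrix factors through the Jacobian on the left. Being diagonal with nonzero entries
     it is invertible, and this yields a right inverse of the Jacobian. *)
  have metricE : metric_tensor X phi u = jacobian phi u *m
     (\matrix_(i, j) F (delta_mx 0 i) (row j (jacobian phi u))).
    apply/matrixP => i j; rewrite !mxE.
    rewrite !deriveEjacobian// -!rowE {1}[row i _]matrix_sum_delta big_ord1.
    rewrite ambient_form_suml; apply: eq_bigr => l _.
    by rewrite ambient_formZl !mxE.
  apply/row_freeP.
  have mU : metric_tensor X phi u \in unitmx.
    rewrite unitmxE unitfE metric_tensor_polar// det_diag; apply/prodf_neq0 => i _.
    have [z0 q0 _] := Uu; have h0 := pf_gt0 frame.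
    rewrite mxE; case: unliftP => [j _|_]; last by rewrite invr_neq0// gt_eqF.
    rewrite gt_eqF// exprn_gt0// mulr_gt0// divr_gt0 ?sqrtr_gt0//.
    exact: norm1_gt0.
  exists ((\matrix_(i, j) F (delta_mx 0 i) (row j (jacobian phi u)))
    *m invmx (metric_tensor X phi u)).
  by rewrite mulmxA -metricE mulmxV.
- move=> i u; rewrite inE => Vu.
  have Uu := VU _ Vu.
  have dc := differentiable_continuous (differentiable_dpolar h b0 B i Uu).
  have FF : Filter (nbhs (u : 'rV[R]_m.+1)) by exact: nbhs_filter.
  rewrite /continuous_at; have [_ ->] := has_diff_polar h b0 B i Uu.
  apply: cvg_trans dc; apply: near_eq_cvg.
  apply: (@filterS _ (nbhs u) FF V); last exact: open_nbhs_nbhs.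
  by move=> w /VU Uw; have [_ ->] := has_diff_polar h b0 B i Uw.
Qed.

Lemma riemannian_polar (M : set 'rV[R]_n.+1) lam (V : set 'rV[R]_m.+1) A :
  is_riemannian_measure X m.+1 M lam ->
  open V -> V `<=` U -> phi @` V `<=` M -> measurable A ->
  lam (phi @` V `&` A) = (\int[lebesgue_rV m.+1]_(u in V `&` phi @^-1` A)
    (polar_density (u 0 0) * stereo_density (rV_uncons u).2)%:E)%E.
Proof.
move=> [_ lamE] oV VU phiM mA.
rewrite (lamE V _ (parametrization_polar oV VU phiM))//.
apply: eq_integral => u; rewrite inE => -[Vu _].
by rewrite sqrt_det_metric//; exact: VU.
Qed.

End polar_frame.

(** * Products of Lebesgue measures *)

Section measurable_tools.
Context {R : realType} d (T : measurableType d).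
Implicit Types f g : T -> R.

Lemma measurable_fun_sqrt f :
  measurable_fun setT f -> measurable_fun setT (fun x => Num.sqrt (f x)).
Proof.
move=> mf; have ms : measurable_fun setT (@Num.sqrt R).
  by apply: continuous_measurable_fun; exact: sqrt_continuous.
exact: measurableT_comp ms mf.
Qed.

Lemma measurable_fun_inv_ge0 f : (forall x, 0 <= f x) ->
  measurable_fun setT f -> measurable_fun setT (fun x => (f x)^-1).
Proof.
move=> f0 mf; rewrite (_ : (fun _ => _) = (fun x => f x `^ (-1))).
  have mp : measurable_fun setT (fun y : R => y `^ (-1)) by exact: measurable_powR.
  exact: measurableT_comp mp mf.
by apply/funext => x; rewrite powR_inv1.
Qed.

End measurable_tools.

Section lebesgue_rV_product.
Context {R : realType}.
Local Open Scope ereal_scope.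

Lemma measurable_rV_head m :
  measurable_fun setT (fun u : 'rV[R]_m.+1 => u 0%R 0%R : measurableTypeR R).
Proof. exact: measurable_coord. Qed.

Lemma measurable_rV_tail m :
  measurable_fun setT (fun u : 'rV[R]_m.+1 => (rV_uncons u).2).
Proof. exact: measurableT_comp measurable_snd (@measurable_rV_uncons R m). Qed.

Definition rV_prod m (P : set R) (Q : set 'rV[R]_m) : set 'rV[R]_m.+1 :=
  [set u : 'rV[R]_m.+1 | P (u 0%R 0%R) /\ Q (rV_uncons u).2].

Lemma measurable_rV_prod m (P : set (measurableTypeR R)) (Q : set 'rV[R]_m) :
  measurable P -> measurable Q -> measurable (rV_prod P Q).
Proof.
move=> mP mQ; rewrite (_ : rV_prod P Q = (@rV_uncons R m) @^-1` (P `*` Q))//.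
rewrite -[X in measurable X]setTI; apply: measurable_rV_uncons => //.
exact: measurableX.
Qed.

Lemma rV_cons_head m (z : measurableTypeR R * 'rV[R]_m) : rV_cons z 0%R 0%R = z.1.
Proof. by case: z => x v; exact: (congr1 fst (rV_consK (x, v))). Qed.

Lemma rV_cons_tail m (z : measurableTypeR R * 'rV[R]_m) : (rV_uncons (rV_cons z)).2 = z.2.
Proof. by case: z => x v; rewrite rV_consK. Qed.

Lemma integral_rV_prod m (P : set (measurableTypeR R)) (Q : set 'rV[R]_m)
    (J : measurableTypeR R -> R) (w : 'rV[R]_m -> R) :
  measurable P -> measurable Q ->
  measurable_fun setT J -> measurable_fun setT w ->
  (forall x, 0 <= J x)%R -> (forall x, 0 <= w x)%R ->
  \int[lebesgue_rV m.+1]_(u in rV_prod P Q) (J (u 0%R 0%R) * w (rV_uncons u).2)%:E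
  = (\int[lebesgue_measure]_(x in P) (J x)%:E) * \int[lebesgue_rV m]_(v in Q) (w v)%:E.
Proof.
move=> mP mQ mJ mw J0 w0.
change (lebesgue_rV m.+1 : set 'rV[R]_m.+1 -> \bar R) with
  (pushforward (lebesgue_measure \x lebesgue_rV m) (@rV_cons R m)).
rewrite ge0_integral_pushforward//; last 4 first.
- exact: measurable_rV_cons.
- exact: measurable_rV_prod.
- apply/measurable_EFinP/measurable_funTS; apply: measurable_funM.
    exact: measurableT_comp mJ (@measurable_rV_head m).
  exact: measurableT_comp mw (@measurable_rV_tail m).
- by move=> u _; rewrite lee_fin mulr_ge0.
rewrite (_ : _ @^-1` _ = P `*` Q); last first.
  by apply/seteqP; split => -[x v];
    rewrite /preimage /rV_prod /mkset rV_cons_head rV_cons_tail.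
rewrite integral_mkcond.
rewrite (_ : _ \_ _ = (fun z => ((EFin \o J) \_ P) z.1 * ((EFin \o w) \_ Q) z.2)); last first.
  apply/funext => -[x v]; rewrite !patchE /comp rV_cons_head rV_cons_tail /=.
  have -> : ((x, v) \in P `*` Q) = (x \in P) && (v \in Q).
    by apply/idP/andP => [|[]]; rewrite !inE.
  by case: (x \in P); case: (v \in Q); rewrite ?mule0 ?mul0e.
have mJP : measurable_fun setT ((EFin \o J) \_ P).
  by apply/(measurable_restrictT _ _).1 => //; apply/measurable_EFinP/measurable_funTS.
have mwQ : measurable_fun setT ((EFin \o w) \_ Q).
  by apply/(measurable_restrictT _ _).1 => //; apply/measurable_EFinP/measurable_funTS.
have JP0 x : 0 <= ((EFin \o J) \_ P) x.
  by apply: erestrict_ge0 => y _; rewrite lee_fin.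
have wQ0 x : 0 <= ((EFin \o w) \_ Q) x.
  by apply: erestrict_ge0 => y _; rewrite lee_fin.
rewrite fubini_tonelli1/=; last 2 first.
- apply: emeasurable_funM.
    exact: measurableT_comp mJP measurable_fst.
  exact: measurableT_comp mwQ measurable_snd.
- by move=> z; rewrite mule_ge0.
rewrite /fubini_F /=.
under eq_integral do rewrite ge0_integralZl//.
rewrite ge0_integralZr//; last by apply: integral_ge0.
by rewrite -!integral_mkcond.
Qed.

Definition rV_box m (r : R) : set 'rV[R]_m := [set v : 'rV[R]_m | forall j, `|v 0%R j| < r]%R.

Lemma rV_boxS m r : @rV_box m.+1 r = rV_prod [set x | `|x| < r]%R (@rV_box m r).
Proof.
apply/seteqP; split => [u ur|u [u0 ur] j].
  by split => /=; [exact: ur|move=> j; rewrite rV_unconsE; exact: ur].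
by have [l ->|->//] := unliftP ord0 j; rewrite -rV_unconsE; exact: ur.
Qed.

Lemma normr_lt_itv (r : R) : [set x : R | `|x| < r]%R = `](- r)%R, r[%classic.
Proof. by apply/seteqP; split => x /=; rewrite in_itv/= ltr_norml. Qed.

Lemma measurable_rV_box m (r : R) : measurable (@rV_box m r).
Proof.
elim: m => [|m IH].
  rewrite (_ : rV_box r = setT)//; apply/seteqP; split => // v _ [].
  by [].
by rewrite rV_boxS; apply: measurable_rV_prod => //; rewrite normr_lt_itv.
Qed.

Lemma lebesgue_rV_box m (r : R) : (0 < r)%R ->
  lebesgue_rV m (@rV_box m r) = ((2 * r) ^+ m)%:E.
Proof.
move=> r0; elim: m => [|m IH].
  rewrite /= diracE expr0 mem_set//; move=> [].
  by [].
have mI : measurable ([set x | `|x| < r]%R : set (measurableTypeR R)).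
  by rewrite normr_lt_itv.
have mB l := @measurable_rV_box l r.
rewrite -[LHS]mul1e -integral_cst; last exact: mB.
rewrite rV_boxS.
have := @integral_rV_prod m _ _ (cst 1%R) (cst 1%R) mI (mB m)
  (measurable_cst _) (measurable_cst _) (fun=> ler01) (fun=> ler01).
rewrite /= mulr1 => ->; rewrite !integral_cst; [|exact: mB|exact: mI].
rewrite !mul1e.
transitivity (lebesgue_measure [set x : R | `|x| < r]%R * ((2 * r) ^+ m)%:E).
  by congr (_ * _); exact: IH.
rewrite normr_lt_itv lebesgue_measure_itv/= lte_fin.
rewrite ifT ?gtrN// -EFinD -EFinM exprS; congr (_ * _)%:E.
by rewrite opprK mulr_natl mulr2n.
Qed.

End lebesgue_rV_product.

(** * Planes and their closest points to the origin *)

Section measurable_sets.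
Context {R : realType} d (T : measurableType d).
Implicit Types f g : T -> R.

Lemma measurable_set_eq f g : measurable_fun setT f -> measurable_fun setT g ->
  measurable [set x | f x = g x].
Proof.
move=> mf mg; rewrite (_ : [set _ | _] = (f \- g) @^-1` [set 0]); last first.
  apply/seteqP; split => x /= => [->|/eqP]; first by rewrite subrr.
  by rewrite subr_eq0 => /eqP.
by rewrite -[X in measurable X]setTI; apply: measurable_funB.
Qed.

Lemma measurable_set_ge0 f : measurable_fun setT f -> measurable [set x | 0 <= f x].
Proof.
move=> mf; rewrite (_ : [set _ | _] = f @^-1` `[0, +oo[%classic); last first.
  by apply/seteqP; split => x /=; rewrite in_itv/= andbT.
by rewrite -[X in measurable X]setTI; apply: mf.
Qed.

Lemma measurable_set_gt0 f : measurable_fun setT f -> measurable [set x | 0 < f x].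
Proof.
move=> mf; rewrite (_ : [set _ | _] = f @^-1` `]0, +oo[%classic); last first.
  by apply/seteqP; split => x /=; rewrite in_itv/= andbT.
by rewrite -[X in measurable X]setTI; apply: mf.
Qed.

End measurable_sets.

Section measurable_geometry.
Context {R : realType} (X : model) (n : nat).

Lemma measurable_rVcoord (i : 'I_n.+1) :
  measurable_fun setT (fun x : 'rV[R]_n.+1 => x 0 i : R).
Proof. exact: measurable_coord. Qed.

Lemma measurable_ambient_form d (T : measurableType d) (f g : T -> 'rV[R]_n.+1) :
  (forall i, measurable_fun setT (fun x => f x 0 i : R)) ->
  (forall i, measurable_fun setT (fun x => g x 0 i : R)) ->
  measurable_fun setT (fun x => ambient_form X (f x) (g x)).
Proof.
move=> mf mg; apply: measurable_funD.
  by apply: measurable_sum => i; exact: measurable_funM.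
by apply: measurable_funM => //; exact: measurable_funM.
Qed.

Lemma measurable_eq_rV d (T : measurableType d) (f g : T -> 'rV[R]_n.+1) :
  (forall i, measurable_fun setT (fun x => f x 0 i : R)) ->
  (forall i, measurable_fun setT (fun x => g x 0 i : R)) ->
  measurable [set x | f x = g x].
Proof.
move=> mf mg; rewrite (_ : [set _ | _] =
  \big[setI/setT]_(i <- index_enum 'I_n.+1) [set x | f x 0 i = g x 0 i]).
  by apply: bigsetI_measurable => i _; exact: measurable_set_eq.
apply/seteqP; split => [x fg|x].
  by apply: (big_ind (fun S : set T => S x)) => //= i _; rewrite fg.
rewrite -bigcap_seq => fg; apply/rowP => i; apply: fg.
by rewrite /= mem_index_enum.
Qed.

Lemma measurable_model_space : measurable (model_space X : set 'rV[R]_n.+1).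
Proof.
have mF : measurable_fun setT (fun x : 'rV[R]_n.+1 => ambient_form X x x).
  by apply: measurable_ambient_form; exact: measurable_rVcoord.
case: X mF => mF; rewrite /model_space.
- by apply: measurable_set_eq => //; exact: measurable_rVcoord.
- apply: measurableI; first by apply: measurable_set_eq.
  by apply: measurable_set_gt0; exact: measurable_rVcoord.
- exact: measurable_set_eq.
Qed.

End measurable_geometry.

Section frames.
Context {R : realType}.

Definition spatial n (x : 'rV[R]_n.+1) : R := \sum_(i < n) x 0 (lift ord_max i) ^+ 2.

Lemma spatial_ge0 n (x : 'rV[R]_n.+1) : 0 <= spatial x.
Proof. by apply: sumr_ge0 => i _; exact: sqr_ge0. Qed.

Lemma ambient_form_spatial X n (x : 'rV[R]_n.+1) : ambient_form X x x =
  spatial x + (if X is Hyperbolic then -1 else 1) * x 0 ord_max ^+ 2.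
Proof. by rewrite /ambient_form expr2; congr (_ + _); apply: eq_bigr => i _; rewrite expr2. Qed.

(* [b0] is the point closest to the origin of the plane spanned by [b0] and [B]
   and [h] is s_c' at its distance from the origin. *)
Record adapted_frame (X : model) m n (h : R) (b0 : 'rV[R]_n.+1)
    (B : 'M[R]_(m.+1, n.+1)) : Prop := AdaptedFrame {
  af_gt0 : 0 < h ;
  af_last : b0 0 ord_max = h ;
  af_b0 : model_space X b0 ;
  af_Blast : forall i, B i ord_max = 0 ;
  af_BB : forall i j, ambient_form X (row i B) (row j B) = (i == j)%:R ;
  af_b0B : forall i, ambient_form X b0 (row i B) = 0 }.

Definition frame_span m n (b0 : 'rV[R]_n.+1) (B : 'M[R]_(m.+1, n.+1)) :
    set 'rV[R]_n.+1 :=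
  [set x | exists a w, x = a *: b0 + w *m B].

(** Changing the sign of the first row keeps the plane and the adapted frame but exchanges the two
    closed halves separated by the sign of the form with [row 0 B]. Each half gets its own chart. *)
Definition flip_row m n (B : 'M[R]_(m.+1, n.+1)) : 'M[R]_(m.+1, n.+1) :=
  \matrix_(i, j) if i == 0 then - B i j else B i j.

Variables (X : model) (m n : nat) (h : R) (b0 : 'rV[R]_n.+1).
Variable B : 'M[R]_(m.+1, n.+1).
Hypothesis frame : adapted_frame X h b0 B.
Local Notation c := (curvature X).
Local Notation F := (ambient_form X).
Local Notation D := (spatial b0).
Local Notation phi := (polar_rV c h D b0 B).
Local Notation q := (polar_quad c D).
Local Notation U := (@polar_dom R m c D).

Lemma adapted_polar_frame : polar_frame X h D b0 B.
Proof.
case: frame => h0 lb Xb0 Bl BB b0B; split => //.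
- move: Xb0; case: X => /=.
  + by rewrite lb => ->; ring.
  + rewrite ambient_form_spatial lb => -[e _]; lra.
  + rewrite ambient_form_spatial lb => e; lra.
- by move=> i; rewrite b0B mulr0.
- move: Xb0; case: X => /=.
  + by rewrite expr0n/= mul0r.
  + by move=> -[-> _]; ring.
  + by move=> ->; ring.
Qed.

Let pframe := adapted_polar_frame.

Lemma flip_row_frame : adapted_frame X h b0 (flip_row B).
Proof.
have rowE i : row i (flip_row B) = (-1) ^+ (i == 0) *: row i B.
  apply/rowP => j; rewrite !mxE; case: eqP => _; rewrite ?expr1 ?expr0 ?mulN1r ?mul1r//.
case: frame => h0 lb Xb0 Bl BB b0B; split => //.
- by move=> i; rewrite mxE Bl oppr0 if_same.
- move=> i j; rewrite !rowE ambient_formZl ambient_formZr BB.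
  have [<-|_] := eqVneq i j; last by rewrite !mulr0.
  by rewrite mulr1 -expr2 sqrr_sign.
- by move=> i; rewrite rowE ambient_formZr b0B mulr0.
Qed.

Lemma flip_row0 x : F x (row 0 (flip_row B)) = - F x (row 0 B).
Proof.
rewrite (_ : row 0 (flip_row B) = (-1) *: row 0 B) ?ambient_formZr ?mulN1r//.
by apply/rowP => j; rewrite !mxE eqxx mulN1r.
Qed.

Lemma frame_span_flip : frame_span b0 (flip_row B) = frame_span b0 B.
Proof.
have H (B' : 'M[R]_(m.+1, n.+1)) : frame_span b0 (flip_row B') `<=` frame_span b0 B'.
  move=> x [a [w ->]]; exists a, (\row_i if i == 0 then - w 0 i else w 0 i).
  congr (_ + _); apply/rowP => j; rewrite !mxE; apply: eq_bigr => i _.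
  by rewrite !mxE; case: ifP => _//; rewrite mulrN mulNr.
apply/seteqP; split => //; rewrite -{1}(_ : flip_row (flip_row B) = B)//.
by apply/matrixP => i j; rewrite !mxE; case: (i == 0); rewrite ?opprK.
Qed.

Lemma frame_last a w : (a *: b0 + w *m B) 0 ord_max = a * h.
Proof.
rewrite !mxE (af_last frame) big1 ?addr0// => i _.
by rewrite (af_Blast frame) mulr0.
Qed.

Lemma frame_b0_form w : F b0 (w *m B) = 0.
Proof.
by rewrite ambient_form_mulmxr big1// => i _; rewrite (af_b0B frame) mulr0.
Qed.

Lemma frame_form_row a w i : F (a *: b0 + w *m B) (row i B) = w 0 i.
Proof.
rewrite ambient_formDl ambient_formZl (af_b0B frame) mulr0 add0r.
rewrite ambient_form_mulmxl.
under eq_bigr do rewrite (af_BB frame) mulrC.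
by rewrite (sum_delta (fun j => w 0 j)).
Qed.

Lemma frame_form a w : F (a *: b0 + w *m B) (a *: b0 + w *m B) =
  a ^+ 2 * F b0 b0 + \sum_i w 0 i ^+ 2.
Proof.
rewrite ambient_formDl !ambient_formDr !ambient_formZl !ambient_formZr.
rewrite frame_b0_form (ambient_formC _ _ b0) frame_b0_form (frame_dot pframe).
under eq_bigr do rewrite -expr2.
by ring.
Qed.

Lemma frame_spatial a w : spatial (a *: b0 + w *m B) =
  a ^+ 2 * D + \sum_i w 0 i ^+ 2.
Proof.
have := frame_form a w; rewrite !ambient_form_spatial frame_last (af_last frame).
lra.
Qed.

Lemma polar_last u : phi u 0 ord_max = 1 - c * u 0 0.
Proof.
rewrite /polar_rV /polar scalemxAl frame_last divfK// gt_eqF//.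
exact: af_gt0 frame.
Qed.

Lemma sum_polar_coord u : U u ->
  \sum_i ((Num.sqrt (q (u 0 0)) / h) *: stereo (rV_uncons u).2) 0 i ^+ 2 =
  q (u 0 0) / h ^+ 2.
Proof.
move=> [_ q0 _]; under eq_bigr do rewrite mxE exprMn.
by rewrite -mulr_sumr stereo_norm mulr1 exprMn exprVn sqr_sqrtr// ltW.
Qed.

(** By [D (1 - c z)^2 + q(z) = h^2 (2 z - c z^2)] the data of the plane cancel, and [s_c(r)^2]
    depends on [z] alone; this is why a radial set has the same radial coordinates in all planes. *)
Lemma polar_spatial u : U u -> spatial (phi u) = polar_quad c 0 (u 0 0).
Proof.
move=> Uu; rewrite /polar_rV /polar scalemxAl frame_spatial sum_polar_coord//.
have h0 : h != 0 by rewrite gt_eqF// (af_gt0 frame).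
have h2 : h ^+ 2 != 0 by rewrite expf_neq0.
apply: (mulIf h2); rewrite mulrDl exprMn exprVn divfK// mulrAC divfK//.
by rewrite -(pf_hD pframe) /polar_quad; ring.
Qed.

Lemma polar_model u : U u -> model_space X (phi u).
Proof.
move=> Uu; have [z0 q0 _] := Uu.
have := polar_last u; have := polar_spatial Uu.
case: X z0 => /= z0 sE lE; rewrite ?ambient_form_spatial ?sE ?lE /polar_quad/=.
- by rewrite mul0r subr0.
- split; first by ring.
  by rewrite mulN1r opprK ltr_wpDl.
- by ring.
Qed.

Lemma polar_span u : frame_span b0 B (phi u).
Proof. by rewrite /polar_rV /polar scalemxAl; eexists; eexists. Qed.

Lemma polar_form_row0 u : F (phi u) (row 0 B) =
  Num.sqrt (q (u 0 0)) / h * (2 / norm1 (rV_uncons u).2 - 1).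
Proof. by rewrite /polar_rV /polar scalemxAl frame_form_row mxE stereo0. Qed.

(** The coefficients in the frame are linear in the point, which turns the span into an equation
    between measurable maps. *)
Lemma frame_spanP x : frame_span b0 B x <->
  x = (x 0 ord_max / h) *: b0 + (\row_i F x (row i B)) *m B.
Proof.
split=> [[a [w ->]]|->]; last by eexists; eexists.
rewrite frame_last mulfK ?gt_eqF ?(af_gt0 frame)//; congr (_ + _ *m _).
by apply/rowP => i; rewrite mxE frame_form_row.
Qed.

Definition half_plane : set 'rV[R]_n.+1 :=
  [set x | [/\ model_space X x, frame_span b0 B x, x <> b0, x <> - b0 &
               0 <= F x (row 0 B)]].

(** The chart is inverted explicitly. In [x = a *: b0 + w *m B], [a] is [s_c'(rho)] and [w] has norm
    [s_c(rho)]; [v] is the stereographic projection of the direction of [w]. Leaving out [b0] and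
    [- b0] makes [w] nonzero, and the sign condition gives [|v| <= 1], inside the box. *)
Lemma half_plane_sub : half_plane `<=` phi @` U.
Proof.
move=> x [Xx [a [w xE]] xb xNb w0].
have h0 := af_gt0 frame; have hn0 : h != 0 by rewrite gt_eqF.
have hD := pf_hD pframe; have D0 := spatial_ge0 b0.
move: w0; rewrite xE frame_form_row => w0.
have lx : x 0 ord_max = a * h by rewrite xE frame_last.
have Fx : F x x = a ^+ 2 * F b0 b0 + \sum_i w 0 i ^+ 2 by rewrite xE frame_form.
set r2 := \sum_i w 0 i ^+ 2 in Fx.
have r20 : 0 <= r2 by apply: sumr_ge0 => i _; exact: sqr_ge0.
have [a1 aX] : (c = 0 :> R -> a = 1) /\ (c * a ^+ 2 + c ^+ 2 * r2 = c).
  have b0X := af_b0 frame.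
  move: Xx b0X hD; rewrite /= -/c; move: Fx lx; case: X => /= Fx lx.
  - rewrite lx => ah; rewrite (af_last frame) => h1 _; split; last by ring.
    by move=> _; move: ah; rewrite h1 mulr1.
  - rewrite Fx => -[e _] [b e'] _; split; first by move=> ?; lra.
    by move: e; rewrite b; lra.
  - rewrite Fx => e b _; split; first by move=> ?; lra.
    by move: e; rewrite b; lra.
have r2gt : 0 < r2.
  rewrite lt_neqAle r20 andbT; apply/negP => /eqP r2E.
  have wE : w = 0.
    apply/rowP => i; rewrite mxE; apply/eqP; rewrite -sqrf_eq0; apply/eqP.
    move/esym : r2E => /eqP; rewrite psumr_eq0; last by move=> j _; exact: sqr_ge0.
    by move=> /allP /(_ i); rewrite mem_index_enum => /(_ isT)/eqP.
  move: xE aX; rewrite wE mul0mx addr0 -r2E mulr0 addr0 => xE aX.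
  have a2 : a ^+ 2 = 1.
    by move: a1 aX; case: X => /= a1 ?; [rewrite a1//; ring|lra|lra].
  have /orP[/eqP aE|/eqP aE] : (a == 1) || (a == -1) by rewrite -sqrf_eq1 a2.
  - by apply: xb; rewrite xE aE scale1r.
  - by apply: xNb; rewrite xE aE scaleN1r.
clear xb xNb xE.
(* The value [2 s_c(r / 2)^2] at [x]: half of the squared norm in the Euclidean case, otherwise
   [c (1 - s_c'(r))], the last coordinate [a * h] being [s_c'(r)]. *)
pose z := if X is Euclidean then (h ^+ 2 * r2 + D) / 2 else c * (1 - a * h).
have qz : q z = h ^+ 2 * r2.
  rewrite /polar_quad /z; move: a1 aX hD; case: X => /= a1 aX hD.
  - by field.
  - have e1 : D = h ^+ 2 - 1 by lra.
    have e2 : r2 = a ^+ 2 - 1 by lra.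
    by rewrite e1 e2; ring.
  - have e1 : D = 1 - h ^+ 2 by lra.
    have e2 : r2 = 1 - a ^+ 2 by lra.
    by rewrite e1 e2; ring.
have qz0 : 0 < q z by rewrite qz mulr_gt0// exprn_gt0.
have z0 : 0 < z.
  move: Xx; rewrite /z /model_space; move: a1 aX hD lx; case: X => /= a1 aX hD lx.
  - by move=> _; rewrite divr_gt0// ltr_wpDr// mulr_gt0// exprn_gt0.
  - rewrite lx => -[_ ah]; rewrite mulN1r opprB subr_gt0.
    have a0 : 0 < a by move: ah; rewrite pmulr_lgt0.
    have h1 : 1 <= h by have [//|h1] := leP 1 h; nra.
    have ag1 : 1 < a by have [a1'|//] := leP a 1; nra.
    by rewrite (lt_le_trans ag1)// ler_peMr// ltW.
  - move=> _; rewrite mul1r subr_gt0.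
    have h1 : h <= 1 by have [//|h1] := leP h 1; nra.
    have ag1 : a < 1 by have [a1'|//] := leP 1 a; nra.
    have [a0|a0] := leP a 0; first by rewrite (le_lt_trans _ ltr01)// mulr_le0_ge0// ltW.
    by rewrite (le_lt_trans _ ag1)// ger_pMr.
have az : (1 - c * z) / h = a.
  rewrite /z; move: a1; case: X hD => /= hD a1.
  - rewrite mul0r subr0 a1//; move: hD; rewrite mul0r subr0 => /esym/eqP.
    rewrite sqrf_eq1 => /orP[|] /eqP hE; first by rewrite hE invr1 mulr1.
    by move: h0; rewrite hE => ?; exfalso; lra.
  - by field.
  - by field.
pose r := Num.sqrt r2.
have r0 : 0 < r by rewrite sqrtr_gt0.
have rr : r ^+ 2 = r2 by rewrite sqr_sqrtr.
have sz : Num.sqrt (q z) / h = r.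
  by rewrite qz sqrtrM ?sqr_ge0// sqrtr_sqr gtr0_norm// mulrC mulKf.
pose s0 := w 0 0 / r; have s00 : 0 <= s0 by rewrite divr_ge0// ltW.
have n0 : 1 + s0 != 0 by rewrite gt_eqF// ltr_pwDl.
(* The inverse of [stereo] at the unit vector [w / r], whose first coordinate is [s0]. *)
pose v : 'rV[R]_m := \row_j (w 0 (lift ord0 j) / r / (1 + s0)).
have sumw : \sum_(j < m) w 0 (lift ord0 j) ^+ 2 = r2 - w 0 0 ^+ 2.
  by rewrite /r2 big_ord_recl addrAC subrr add0r.
have Nv : norm1 v = 2 / (1 + s0).
  rewrite /norm1; under eq_bigr do rewrite mxE !exprMn -mulrA.
  rewrite -mulr_suml sumw -rr.
  have -> : w 0 0 = s0 * r by rewrite divfK// gt_eqF.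
  by field; rewrite n0 gt_eqF.
have vj j : `|v 0 j| < 2.
  rewrite -(@ltr_pXn2r _ 2) ?nnegrE// real_normK ?num_real//.
  have : v 0 j ^+ 2 <= \sum_l v 0 l ^+ 2.
    by rewrite (bigD1 j)//= lerDl sumr_ge0// => l _; exact: sqr_ge0.
  rewrite sum_sqr_norm1 Nv => /le_lt_trans; apply.
  have : 2 / (1 + s0) <= 2 by rewrite ler_pdivrMr ?ltr_pwDl// mulrDr mulr1 lerDl mulr_ge0.
  by move=> ?; lra.
exists (rV_cons (z, v)).
  by split; rewrite ?rV_cons_head// => j; rewrite -rV_unconsE rV_cons_tail.
rewrite /polar_rV /polar rV_cons_head rV_cons_tail /= az sz; congr (_ + _).
rewrite scalemxAl; congr (_ *m _); apply/rowP => i; rewrite mxE.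
have rn0 : r != 0 by rewrite gt_eqF.
have [j ->|->] := unliftP ord0 i.
  rewrite stereoS Nv mxE; by field; rewrite rn0 n0.
rewrite stereo0 Nv; transitivity (r * s0); first by field; rewrite n0.
by rewrite mulrC divfK.
Qed.

Lemma frame_span_half_plane x : model_space X x -> frame_span b0 B x ->
  [\/ x = b0, x = - b0, half_plane x |
      [/\ model_space X x, frame_span b0 (flip_row B) x, x <> b0, x <> - b0 &
               0 <= F x (row 0 (flip_row B))]].
Proof.
move=> Xx Sx; have [->|/eqP xb] := eqVneq x b0; first by constructor 1.
have [->|/eqP xNb] := eqVneq x (- b0); first by constructor 2.
have [x0|x0] := leP 0 (F x (row 0 B)); first by constructor 3.
by constructor 4; split; rewrite ?frame_span_flip// flip_row0 oppr_ge0 ltW.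
Qed.

Lemma measurable_frame_span : measurable (frame_span b0 B).
Proof.
rewrite (_ : frame_span b0 B = [set x : 'rV[R]_n.+1 |
  x = (x 0 ord_max / h) *: b0 + (\row_i F x (row i B)) *m B]); last first.
  by apply/seteqP; split => x /frame_spanP.
apply: measurable_eq_rV => i; first exact: measurable_rVcoord.
rewrite (_ : (fun _ => _) = (fun x : 'rV[R]_n.+1 => x 0 ord_max * (h^-1 * b0 0 i) +
   \sum_j F x (row j B) * B j i)); last first.
  apply/funext => x; rewrite !mxE mulrA; congr (_ + _).
  by apply: eq_bigr => j _; rewrite mxE.
apply: measurable_funD.
  by apply: measurable_funM => //; exact: measurable_rVcoord.
apply: measurable_sum => j; apply: measurable_funM => //.
by apply: measurable_ambient_form => // l; exact: measurable_rVcoord.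
Qed.

Lemma measurable_rV1 (x : 'rV[R]_n.+1) : measurable [set x].
Proof.
rewrite (_ : [set x] = [set y | y = x])//.
by apply: measurable_eq_rV => // i; exact: measurable_rVcoord.
Qed.

Lemma measurable_half_plane : measurable half_plane.
Proof.
rewrite (_ : half_plane = model_space X `&` frame_span b0 B `&` ~` [set b0]
  `&` ~` [set - b0] `&` [set x | 0 <= F x (row 0 B)]); last first.
  by apply/seteqP; split => x; [case=> *; split|case=> -[[[]]]].
apply: measurableI.
  apply: measurableI; last by apply: measurableC; exact: measurable_rV1.
  apply: measurableI; last by apply: measurableC; exact: measurable_rV1.
  by apply: measurableI; [exact: measurable_model_space|exact: measurable_frame_span].
apply: measurable_set_ge0; apply: measurable_ambient_form => // i.
exact: measurable_rVcoord.
Qed.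

End frames.

(** * Measures of radial sets *)

Section polar_measurable.
Context {R : realType}.

Lemma measurable_polar_quad (c D : R) : measurable_fun setT (polar_quad c D).
Proof.
apply: measurable_funB => //; apply: measurable_funB.
  exact: measurable_funM.
by apply: measurable_funM => //; exact: measurable_funX.
Qed.

Lemma measurable_polar_density (X : model) m (h D : R) :
  measurable_fun setT (polar_density X m h D).
Proof.
have ms : measurable_fun setT (fun z => Num.sqrt (polar_quad (curvature X) D z)).
  by apply: measurable_fun_sqrt; exact: measurable_polar_quad.
apply: measurable_funM.
  by apply: measurable_fun_inv_ge0 => // z; exact: sqrtr_ge0.
by apply: measurable_funX; exact: measurable_funM.
Qed.

Lemma polar_density_ge0 (X : model) m (h D : R) z : 0 < h ->
  0 <= polar_density X m h D z.
Proof.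
move=> h0; rewrite mulr_ge0 ?invr_ge0 ?sqrtr_ge0// exprn_ge0// divr_ge0 ?sqrtr_ge0//.
exact: ltW.
Qed.

Lemma measurable_norm1 m : measurable_fun setT (@norm1 R m).
Proof.
apply: measurable_funD => //; apply: measurable_sum => i.
by apply: measurable_funX; exact: measurable_coord.
Qed.

Lemma measurable_inv_norm1 m : measurable_fun setT (fun v : 'rV[R]_m => (norm1 v)^-1).
Proof.
apply: measurable_fun_inv_ge0; last exact: measurable_norm1.
by move=> v; exact/ltW/norm1_gt0.
Qed.

Lemma measurable_stereo_density m : measurable_fun setT (@stereo_density R m).
Proof.
by apply: measurable_funX; apply: measurable_funM => //; exact: measurable_inv_norm1.
Qed.

Lemma stereo_density_ge0 m (v : 'rV[R]_m) : 0 <= stereo_density v.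
Proof. by rewrite exprn_ge0// divr_ge0// ltW// norm1_gt0. Qed.

Lemma stereo_density_le m (v : 'rV[R]_m) : stereo_density v <= 2 ^+ m.
Proof.
rewrite lerXn2r ?nnegrE// ?divr_ge0 ?(ltW (norm1_gt0 _))//.
rewrite ler_pdivrMr ?norm1_gt0// ler_peMr// lerDl.
by apply: sumr_ge0 => i _; exact: sqr_ge0.
Qed.

Lemma measurable_polar_rV m n (c h D : R) (b0 : 'rV[R]_n.+1) (B : 'M[R]_(m.+1, n.+1)) :
  measurable_fun setT (polar_rV c h D b0 B).
Proof.
apply: measurable_fun_rV => i.
rewrite (_ : (fun _ => _) = (fun u : 'rV[R]_m.+1 =>
  (1 - c * u 0 0) * (h^-1 * b0 0 i) + Num.sqrt (polar_quad c D (u 0 0)) * h^-1 *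
   \sum_j stereo (rV_uncons u).2 0 j * B j i)); last first.
  by apply/funext => u; rewrite !mxE mulrA.
have mz := @measurable_rV_head R m; have mt := @measurable_rV_tail R m.
apply: measurable_funD.
  by apply: measurable_funM => //; apply: measurable_funB => //; exact: measurable_funM.
apply: measurable_funM.
  apply: measurable_funM => //; apply: measurable_fun_sqrt.
  exact: measurableT_comp (@measurable_polar_quad c D) mz.
apply: measurable_sum => j; apply: measurable_funM => //.
have mi := measurableT_comp (@measurable_inv_norm1 m) mt.
have [l ->|->] := unliftP ord0 j.
  rewrite (_ : (fun _ => _) = (fun u : 'rV[R]_m.+1 =>
     2 * u 0 (lift ord0 l) * (norm1 (rV_uncons u).2)^-1)); last first.
    by apply/funext => u; rewrite stereoS rV_unconsE.
  apply: measurable_funM => //; apply: measurable_funM => //.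
  exact: measurable_coord.
rewrite (_ : (fun _ => _) = (fun u : 'rV[R]_m.+1 =>
     2 * (norm1 (rV_uncons u).2)^-1 - 1)); last first.
  by apply/funext => u; rewrite stereo0.
by apply: measurable_funB => //; exact: measurable_funM.
Qed.

Definition radial_dom (c D : R) : set R := [set z | 0 < z /\ 0 < polar_quad c D z].

Lemma measurable_radial_dom c D : measurable (radial_dom c D : set (measurableTypeR R)).
Proof.
by apply: measurableI; apply: measurable_set_gt0 => //; exact: measurable_polar_quad.
Qed.

Lemma polar_domE m c D :
  @polar_dom R m c D = rV_prod (radial_dom c D) (@rV_box R m 2).
Proof.
apply/seteqP; split => u.
  by move=> [u0 qu uj]; split => // j; rewrite rV_unconsE.
by move=> [[u0 qu] uj]; split => // j; rewrite -rV_unconsE.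
Qed.

Lemma measurable_polar_dom m c D : measurable (@polar_dom R m c D).
Proof.
rewrite polar_domE; apply: measurable_rV_prod; first exact: measurable_radial_dom.
exact: measurable_rV_box.
Qed.

Lemma measurable_density m X (h D : R) (V : set 'rV[R]_m.+1) :
  measurable_fun V (fun u : 'rV[R]_m.+1 =>
     (polar_density X m h D (u 0 0) * stereo_density (rV_uncons u).2)%:E).
Proof.
apply/measurable_EFinP/measurable_funTS; apply: measurable_funM.
  exact: measurableT_comp (@measurable_polar_density X m h D) (@measurable_rV_head R m).
exact: measurableT_comp (@measurable_stereo_density m) (@measurable_rV_tail R m).
Qed.

End polar_measurable.

Section polar_bounds.
Context {R : realType}.
Local Open Scope ereal_scope.

(** By injectivity the chart pulls the point back to [u0] alone, which lies in the slab where the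
    radial coordinate is fixed; Tonelli shows that the slab does not contribute. *)
Lemma riemannian_null_point X m n (D : R) (c0 : 'rV[R]_n.+1) (C : 'M[R]_(m.+1, n.+1))
    M (lam : {measure set 'rV[R]_n.+1 -> \bar R}) u0 :
  polar_frame X 1 D c0 C -> is_riemannian_measure X m.+1 M lam ->
  polar_rV (curvature X) 1 D c0 C @` polar_dom (curvature X) D `<=` M ->
  polar_dom (curvature X) D u0 ->
  lam [set polar_rV (curvature X) 1 D c0 C u0] = 0.
Proof.
move=> frame lamM phiM Uu0; pose phi := polar_rV (curvature X) 1 D c0 C.
pose U : set 'rV[R]_m.+1 := polar_dom (curvature X) D; rewrite -/phi.
have -> : [set phi u0] = phi @` U `&` [set phi u0].
  by apply/seteqP; split => [x ->|x []//]; split => //; exists u0.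
rewrite (riemannian_polar frame lamM)//; last 2 first.
- exact: open_polar_dom.
- exact: measurable_rV1.
rewrite -/phi -/U (_ : U `&` phi @^-1` _ = [set u0]); last first.
  apply/seteqP; split => [u [Uu phiu]|u ->//].
  by apply: (polar_rV_inj frame) => //; rewrite inE.
apply/eqP; rewrite eq_le integral_ge0 ?andbT; last first.
  by move=> u _; rewrite lee_fin mulr_ge0 ?polar_density_ge0 ?stereo_density_ge0.
have mP : measurable ([set u0 0%R 0%R] : set (measurableTypeR R)).
  exact: measurable_set1.
have le0 : \int[lebesgue_rV m.+1]_(u in rV_prod [set u0 0%R 0%R] [set: 'rV[R]_m])
  (polar_density X m 1 D (u 0%R 0%R) * stereo_density (rV_uncons u).2)%:E <= 0.
  rewrite (integral_rV_prod mP measurableT); last 4 first.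
  - exact: measurable_polar_density.
  - exact: measurable_stereo_density.
  - by move=> x; exact: polar_density_ge0.
  - exact: stereo_density_ge0.
  by rewrite integral_set1 mul0e.
apply: le_trans le0; apply: ge0_subset_integral.
- exact: measurable_rV1.
- exact: measurable_rV_prod.
- exact: measurable_density.
- by move=> u _; rewrite lee_fin mulr_ge0 ?polar_density_ge0 ?stereo_density_ge0.
- by move=> u ->.
Qed.

(* s_c(r) as a function of [2 s_c(r / 2)^2]. *)
Definition radial_profile (c : R) (z : R) : R := Num.sqrt (polar_quad c 0 z).

(** This is [s_c(rho) <= s_c(r)], which follows from [h^2 s_c(r)^2 = q(z) + D (1 - c z)^2]. The
    factor [1 / h] is then the only trace of the plane in the bound. *)
Lemma polar_density_le X m n (h : R) (b0 : 'rV[R]_n.+1) (B : 'M[R]_(m.+2, n.+1)) z :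
  adapted_frame X h b0 B -> radial_dom (curvature X) (spatial b0) z ->
  (polar_density X m.+1 h (spatial b0) z <=
     h^-1 * radial_profile (curvature X) z ^+ m)%R.
Proof.
move=> frame [z0 qz]; have h0 := af_gt0 frame.
have s0 : (0 < Num.sqrt (polar_quad (curvature X) (spatial b0) z))%R by rewrite sqrtr_gt0.
rewrite /polar_density exprS mulrA mulrA mulVf ?gt_eqF// mul1r.
rewrite ler_wpM2l ?invr_ge0 ?(ltW h0)//.
rewrite lerXn2r ?nnegrE ?sqrtr_ge0 ?divr_ge0 ?(ltW s0) ?(ltW h0)//.
have hD := pf_hD (adapted_polar_frame frame).
have D0 := spatial_ge0 b0.
have qE : (polar_quad (curvature X) 0 z * h ^+ 2 =
    polar_quad (curvature X) (spatial b0) z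
    + spatial b0 * (1 - curvature X * z) ^+ 2)%R.
  by rewrite -hD /polar_quad; ring.
have q0 : (0 <= polar_quad (curvature X) 0 z)%R.
  have : (0 <= polar_quad (curvature X) 0 z * h ^+ 2)%R.
    by rewrite qE addr_ge0 ?(ltW qz)// mulr_ge0// sqr_ge0.
  by rewrite pmulr_lge0// exprn_gt0.
rewrite ler_pdivrMr// /radial_profile.
rewrite -(@ler_pXn2r _ 2) ?nnegrE ?mulr_ge0 ?sqrtr_ge0 ?(ltW h0)//.
by rewrite exprMn !sqr_sqrtr ?(ltW qz)// qE lerDl mulr_ge0// sqr_ge0.
Qed.

End polar_bounds.

(** * Upper and lower bounds of measures by radial masses *)

Section frame_bounds.
Context {R : realType}.
Local Open Scope ereal_scope.

(* Up to a factor, the volume in dimension [m.+2] of the radial set with radial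
   coordinates in [A]. *)
Definition radial_mass (X : model) m (A : set R) : \bar R :=
  \int[lebesgue_measure]_(z in A `&` radial_dom (curvature X) 0)
    (radial_profile (curvature X) z ^+ m)%:E.

Lemma measurable_radial_profile c m :
  measurable_fun setT (fun z : R => radial_profile c z ^+ m)%R.
Proof.
apply: measurable_funX; apply: measurable_fun_sqrt; exact: measurable_polar_quad.
Qed.

Lemma radial_profile_ge0 c (z : R) : (0 <= radial_profile c z)%R.
Proof. exact: sqrtr_ge0. Qed.

Lemma radial_dom_sub X (D z : R) : (0 <= D)%R ->
  radial_dom (curvature X) D z -> radial_dom (curvature X) 0 z.
Proof. by move=> D0 [z0 qz]; split => //; move: qz; rewrite /polar_quad; lra. Qed.

(** [E] has to be controlled off [z = 1] only: on the sphere this value is the equator, where level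
    sets of a radial function need not be unions of spheres around the origin. *)
Lemma half_plane_measure_le X m n (h : R) (b0 : 'rV[R]_n.+1) (B : 'M[R]_(m.+2, n.+1))
    M (lam : {measure set 'rV[R]_n.+1 -> \bar R}) (A : set (measurableTypeR R))
    (E : set 'rV[R]_n.+1) :
  adapted_frame X h b0 B -> is_riemannian_measure X m.+2 M lam ->
  model_space X `&` frame_span b0 B `<=` M ->
  measurable A -> measurable E ->
  (forall u, polar_dom (curvature X) (spatial b0) u -> u 0%R 0%R <> 1%R ->
     E (polar_rV (curvature X) h (spatial b0) b0 B u) -> A (u 0%R 0%R)) ->
  lam (half_plane X b0 B `&` E) <=
    (h^-1)%:E * radial_mass X m A * (8 ^+ m.+1)%:E.
Proof.
move=> frame lamM spanM mA mE EA; have pframe := adapted_polar_frame frame.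
have h0 := af_gt0 frame; have D0 := spatial_ge0 b0.
pose phi := polar_rV (curvature X) h (spatial b0) b0 B.
pose U : set 'rV[R]_m.+2 := polar_dom (curvature X) (spatial b0).
rewrite -/phi -/U in EA.
have mH := measurable_half_plane frame.
have -> : half_plane X b0 B `&` E = phi @` U `&` (half_plane X b0 B `&` E).
  by rewrite setIA (setIidr (half_plane_sub frame)).
rewrite (riemannian_polar pframe lamM); last 4 first.
- exact: open_polar_dom.
- by [].
- move=> _ [u Uu <-]; apply: spanM; split; first exact: polar_model.
  exact: polar_span.
- exact: measurableI.
rewrite -/phi -/U.
(* The value [1] is adjoined so that the preimage of [E] fits into a product set; [integral_setD1]
   discards it afterwards. *)
pose A1 := (A `|` [set 1%R]) `&` radial_dom (curvature X) (spatial b0).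
have mA1 : measurable (A1 : set (measurableTypeR R)).
  apply: measurableI; last exact: measurable_radial_dom.
  by apply: measurableU => //; exact: measurable_set1.
have mbox : measurable (@rV_box R m.+1 2) by exact: measurable_rV_box.
have g0 (u : 'rV[R]_m.+2) : 0 <=
    (polar_density X m.+1 h (spatial b0) (u 0%R 0%R) * stereo_density (rV_uncons u).2)%:E.
  by rewrite lee_fin mulr_ge0 ?polar_density_ge0 ?stereo_density_ge0.
apply: (@le_trans _ _ (\int[lebesgue_rV m.+2]_(u in rV_prod A1 (@rV_box R m.+1 2))
    (polar_density X m.+1 h (spatial b0) (u 0%R 0%R) * stereo_density (rV_uncons u).2)%:E)).
  apply: ge0_subset_integral => //.
  - apply: measurableI; first exact: measurable_polar_dom.
    rewrite -[X in measurable X]setTI; apply: measurable_polar_rV => //.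
    exact: measurableI.
  - exact: measurable_rV_prod.
  - exact: measurable_density.
  - move=> u [Uu [_ Eu]]; have := Uu; rewrite /U polar_domE => -[u0 ub].
    split => //; split => //; have [u1|/eqP u1] := eqVneq (u 0%R 0%R) 1%R.
      by right.
    by left; exact: EA.
rewrite integral_rV_prod//; last 4 first.
- exact: measurable_polar_density.
- exact: measurable_stereo_density.
- by move=> x; exact: polar_density_ge0.
- exact: stereo_density_ge0.
have dens z : A1 z -> (polar_density X m.+1 h (spatial b0) z <=
    h^-1 * radial_profile (curvature X) z ^+ m)%R.
  by move=> [_ zD]; exact: (polar_density_le frame zD).
have mprof : measurable_fun setT (fun z : R =>
    (h^-1)%:E * (radial_profile (curvature X) z ^+ m)%:E).
  by apply/measurable_EFinP; apply: measurable_funM => //; exact: measurable_radial_profile.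
have prof0 z : 0 <= (h^-1)%:E * (radial_profile (curvature X) z ^+ m)%:E.
  by rewrite lee_fin mulr_ge0 ?invr_ge0 ?(ltW h0)// exprn_ge0// radial_profile_ge0.
apply: lee_pmul.
- by apply: integral_ge0 => z _; rewrite lee_fin polar_density_ge0.
- by apply: integral_ge0 => z _; rewrite lee_fin stereo_density_ge0.
- apply: (@le_trans _ _ (\int[lebesgue_measure]_(z in A1)
     ((h^-1)%:E * (radial_profile (curvature X) z ^+ m)%:E))).
    apply: ge0_le_integral => //.
    + by move=> z _; rewrite lee_fin polar_density_ge0.
    + by apply/measurable_EFinP/measurable_funTS; exact: measurable_polar_density.
    + exact: measurable_funTS.
  rewrite -(@integral_setD1 _ _ 1%R); last 2 first.
  + by apply: measurableD => //; exact: measurable_set1.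
  + exact: measurable_funTS.
  rewrite /radial_mass -ge0_integralZl_EFin ?invr_ge0 ?(ltW h0)//; last 3 first.
  + by apply: measurableI => //; exact: measurable_radial_dom.
  + by move=> z _; rewrite lee_fin exprn_ge0// radial_profile_ge0.
  + by apply/measurable_EFinP/measurable_funTS; exact: measurable_radial_profile.
  apply: ge0_subset_integral => //.
  + by apply: measurableD => //; exact: measurable_set1.
  + by apply: measurableI => //; exact: measurable_radial_dom.
  + exact: measurable_funTS.
  + by move=> z [[[Az|//] zD] _]; split => //; exact: radial_dom_sub zD.
(* Here [8 = 2 * 4]: the stereographic density is at most [2 ^+ m.+1], and the box has side [4] in
   each of its [m.+1] directions. *)
- apply: (@le_trans _ _ (\int[lebesgue_rV m.+1]_(v in @rV_box R m.+1 2) (2 ^+ m.+1)%:E)).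
    apply: ge0_le_integral => //.
    + by move=> v _; rewrite lee_fin stereo_density_ge0.
    + by apply/measurable_EFinP/measurable_funTS; exact: measurable_stereo_density.
    + by move=> v _; rewrite lee_fin stereo_density_le.
  rewrite integral_cst// [X in _ * X]lebesgue_rV_box// -EFinM lee_fin -exprMn.
  by rewrite lerXn2r ?nnegrE//; lra.
Qed.

(** Only the angular box [|v_j| < 1 / m.+2] is kept. There [|v| <= 1], so the stereographic density
    is at least [1] and the points stay in the half plane; the constant is the volume of this
    box. *)
Lemma riemannian_ge_radial_mass X m n (h : R) (b0 : 'rV[R]_n.+1) (B : 'M[R]_(m.+2, n.+1))
    M (lam : {measure set 'rV[R]_n.+1 -> \bar R}) (A : set (measurableTypeR R))
    (E : set 'rV[R]_n.+1) :
  adapted_frame X h b0 B -> h = 1%R -> spatial b0 = 0%R ->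
  is_riemannian_measure X m.+2 M lam ->
  model_space X `&` frame_span b0 B `<=` M ->
  measurable A -> measurable E ->
  (forall u, polar_dom (curvature X) (spatial b0) u -> A (u 0%R 0%R) ->
     E (polar_rV (curvature X) h (spatial b0) b0 B u)) ->
  radial_mass X m A * ((2 / m.+2%:R) ^+ m.+1)%:E <= lam E.
Proof.
move=> frame h1 D0 lamM spanM mA mE EA; have pframe := adapted_polar_frame frame.
have h0 := af_gt0 frame.
pose phi := polar_rV (curvature X) h (spatial b0) b0 B.
pose U : set 'rV[R]_m.+2 := polar_dom (curvature X) (spatial b0).
rewrite -/phi -/U in EA.
have mH := measurable_half_plane frame.
apply: (@le_trans _ _ (lam (half_plane X b0 B `&` E))); last first.
  by apply: le_measure; rewrite ?inE//; exact: measurableI.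
have -> : half_plane X b0 B `&` E = phi @` U `&` (half_plane X b0 B `&` E).
  by rewrite setIA (setIidr (half_plane_sub frame)).
rewrite (riemannian_polar pframe lamM); last 4 first.
- exact: open_polar_dom.
- by [].
- move=> _ [u Uu <-]; apply: spanM; split; first exact: polar_model.
  exact: polar_span.
- exact: measurableI.
rewrite -/phi -/U.
pose r : R := (m.+2%:R^-1)%R.
have r0 : (0 < r)%R by rewrite invr_gt0.
have r1 : (r <= 1)%R by rewrite invf_le1// ler1n.
pose A1 := A `&` radial_dom (curvature X) 0.
have mA1 : measurable (A1 : set (measurableTypeR R)).
  by apply: measurableI => //; exact: measurable_radial_dom.
have mbox : measurable (@rV_box R m.+1 r) by exact: measurable_rV_box.
have g0 (u : 'rV[R]_m.+2) : 0 <=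
    (polar_density X m.+1 h (spatial b0) (u 0%R 0%R) * stereo_density (rV_uncons u).2)%:E.
  by rewrite lee_fin mulr_ge0 ?polar_density_ge0 ?stereo_density_ge0.
have box_norm1 v : @rV_box R m.+1 r v -> (norm1 v <= 2)%R.
  move=> vr; rewrite /norm1 -[leRHS]/(1 + 1)%R lerD2l.
  apply: (@le_trans _ _ (\sum_(j < m.+1) r)%R).
    apply: ler_sum => j _; rewrite -real_normK ?num_real// expr2.
    rewrite -[leRHS]mulr1 ler_pM//; first exact/ltW/vr.
    by rewrite (le_trans (ltW (vr j))).
  rewrite sumr_const card_ord -mulr_natl ler_pdivrMr// mul1r ler_nat//.
apply: (@le_trans _ _ (\int[lebesgue_rV m.+2]_(u in rV_prod A1 (@rV_box R m.+1 r))
    (polar_density X m.+1 h (spatial b0) (u 0%R 0%R)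
      * stereo_density (rV_uncons u).2)%:E)); last first.
  apply: ge0_subset_integral => //.
  - exact: measurable_rV_prod.
  - apply: measurableI; first exact: measurable_polar_dom.
    rewrite -[X in measurable X]setTI; apply: measurable_polar_rV => //.
    exact: measurableI.
  - exact: measurable_density.
  - move=> u [[Au uD] ub].
    have Uu : U u.
      rewrite /U polar_domE; split; first by rewrite D0.
      by move=> j; apply: lt_trans (ub j) _; rewrite (le_lt_trans r1)// ltr1n.
    split => //; split; last exact: EA.
    have s0 : (0 < Num.sqrt (polar_quad (curvature X) (spatial b0) (u 0%R 0%R)) / h)%R.
      by have [_ ? _] := Uu; rewrite divr_gt0// sqrtr_gt0.
    have row_neq0 (a : R) : phi u <> (a *: b0)%R.
      move=> phiE; have := sum_polar_coord h Uu.
      rewrite big1; last first.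
        move=> i _; rewrite -(frame_form_row frame ((1 - curvature X * u 0%R 0%R) / h)%R).
        rewrite (_ : _ + _ = phi u)%R; last by rewrite /phi /polar_rV /polar scalemxAl.
        by rewrite phiE ambient_formZl (af_b0B frame) mulr0 expr0n.
      have [_ q0 _] := Uu => /esym/eqP; rewrite mulf_eq0 (gt_eqF q0)/=.
      by rewrite invr_eq0 expf_eq0/= (gt_eqF h0).
    split.
    + exact: polar_model.
    + exact: polar_span.
    + by rewrite -[b0 in X in _ <> X]scale1r.
    + by rewrite -scaleN1r.
    + rewrite (polar_form_row0 frame) mulr_ge0 ?(ltW s0)//.
      rewrite subr_ge0 ler_pdivlMr ?norm1_gt0// mul1r.
      exact: box_norm1.
rewrite integral_rV_prod//; last 4 first.
- exact: measurable_polar_density.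
- exact: measurable_stereo_density.
- by move=> x; exact: polar_density_ge0.
- exact: stereo_density_ge0.
apply: lee_pmul.
- by apply: integral_ge0 => z _; rewrite lee_fin exprn_ge0// radial_profile_ge0.
- by rewrite lee_fin exprn_ge0// divr_ge0.
- apply: ge0_le_integral => //.
  + by move=> z _; rewrite lee_fin exprn_ge0// radial_profile_ge0.
  + by apply/measurable_EFinP/measurable_funTS; exact: measurable_radial_profile.
  + by apply/measurable_EFinP/measurable_funTS; exact: measurable_polar_density.
  + move=> z [_ [z0 qz]]; rewrite lee_fin /polar_density D0 h1 divr1 exprS mulrA.
    by rewrite mulVf ?mul1r// gt_eqF// sqrtr_gt0.
- apply: (@le_trans _ _ (\int[lebesgue_rV m.+1]_(v in @rV_box R m.+1 r) 1)).
    rewrite integral_cst// mul1e [leRHS]lebesgue_rV_box//.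
  apply: ge0_le_integral => //.
  + by apply/measurable_EFinP/measurable_funTS; exact: measurable_stereo_density.
  + move=> v vr; rewrite lee_fin exprn_ege1// ler_pdivlMr ?norm1_gt0// mul1r.
    exact: box_norm1.
Qed.

End frame_bounds.

Section frame_measure.
Context {R : realType}.

Lemma curvature_sqr_le2 (X : model) : 0 < 2 - curvature X :> R.
Proof. by case: X => /=; lra. Qed.

Lemma curvature_cube (X : model) : curvature X ^+ 3 = curvature X :> R.
Proof. by case: X => /=; ring. Qed.

Lemma curvature_model_form X n (b0 : 'rV[R]_n.+1) : model_space X b0 ->
  curvature X ^+ 2 * ambient_form X b0 b0 = curvature X.
Proof.
case: X => /= [_|[-> _]|->]; first by rewrite expr0n mul0r.
  by ring.
by ring.
Qed.

(** Only the hyperbolic case needs an estimate, to stay on the upper sheet: the last coordinate of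
    [x] is that of [b0] times [2 (1 + z) - sqrt 3 sqrt (2 z + z^2) t], which is positive because
    [3 (2 z + z^2) < 4 (1 + z)^2]. *)
Lemma center_model X n (x b0 : 'rV[R]_n.+1) z t :
  0 < z -> 0 < polar_quad (curvature X) 0 z -> t <= 1 ->
  curvature X ^+ 2 * ambient_form X x x = curvature X ->
  x 0 ord_max = ((1 - curvature X * z) * (1 - curvature X) + curvature X *
    Num.sqrt (2 - curvature X) * (Num.sqrt (polar_quad (curvature X) 0 z) * t))
    * b0 0 ord_max ->
  model_space X b0 -> model_space X x.
Proof.
case: X => /= z0 q0 t1 Fx xl.
- by rewrite xl => ->; rewrite !mul0r !subr0 addr0 !mulr1.
- move=> [_ h0]; split; first by lra.
  rewrite xl mulr_gt0//; set r := Num.sqrt (2 - -1); set g := Num.sqrt _.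
  have r2 : r ^+ 2 = 3 by rewrite sqr_sqrtr; lra.
  have g2 : g ^+ 2 = 2 * z + z ^+ 2.
    by rewrite sqr_sqrtr; [rewrite /polar_quad; ring|exact: ltW].
  have r0 : 0 <= r by exact: sqrtr_ge0.
  have g0 : 0 <= g by exact: sqrtr_ge0.
  have rg : r * g < 2 * (1 + z).
    rewrite -(@ltr_pXn2r _ 2) ?nnegrE//; last 2 first.
    + exact: mulr_ge0.
    + by rewrite mulr_ge0// addr_ge0// ltW.
    by rewrite exprMn r2 g2 exprMn; nra.
  have rgt : r * (g * t) <= r * g.
    by rewrite mulrA ler_piMr// mulr_ge0.
  by lra.
- by move=> _; lra.
Qed.

(* The point [b0] lies outside of the polar coordinates centered at [b0]; it is
   seen in those centered at a point of the geodesic through [b0] and [row 0 B]. *)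
Lemma riemannian_center_null X m n (b0 : 'rV[R]_n.+1) (B : 'M[R]_(m.+1, n.+1)) M
    (lam : {measure set 'rV[R]_n.+1 -> \bar R}) :
  model_space X b0 -> (forall i, B i ord_max = 0) ->
  (forall i j, ambient_form X (row i B) (row j B) = (i == j)%:R) ->
  (forall i, ambient_form X b0 (row i B) = 0) ->
  model_space X `&` frame_span b0 B `<=` M ->
  is_riemannian_measure X m.+1 M lam ->
  lam [set b0] = 0%E.
Proof.
move=> Xb0 Bl BB b0B spanM lamM.
pose c : R := curvature X; pose s := Num.sqrt (2 - c).
have c2 : 0 < 2 - c := curvature_sqr_le2 X.
have s2 : s ^+ 2 = 2 - c by rewrite sqr_sqrtr// ltW.
have s0 : 0 < s by rewrite sqrtr_gt0.
have c3 : c ^+ 3 = c by exact: curvature_cube.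
have cb0 : c ^+ 2 * ambient_form X b0 b0 = c by exact: curvature_model_form.
pose b1 := row 0 B.
(* The point of the geodesic in direction [- b1] whose radial coordinate with respect to [b0] is
   [1], where [s_c' = 1 - c] and [s_c = s]. The vector [c1] below is the unit tangent there,
   pointing towards [b0]. *)
pose c0 := (1 - c) *: b0 + (- s) *: b1.
pose c1 := (c * s) *: b0 + (1 - c) *: b1.
pose C : 'M[R]_(m.+1, n.+1) := \matrix_(i, j) if i == 0 then c1 0 j else B i j.
have rowC0 : row 0 C = c1 by apply/rowP => j; rewrite mxE [LHS]mxE eqxx.
have rowCS i : i != 0 -> row i C = row i B.
  by move=> i0; apply/rowP => j; rewrite !mxE (negPf i0).
have F11 : ambient_form X b1 b1 = 1 by rewrite /b1 BB.
have F01 : ambient_form X b0 b1 = 0 by rewrite /b1 b0B.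
have F10 : ambient_form X b1 b0 = 0 by rewrite ambient_formC.
have Fc1 : ambient_form X c1 c1 = 1.
  rewrite /c1 !(ambient_formDl, ambient_formDr, ambient_formZl, ambient_formZr).
  rewrite F11 F01 F10; transitivity (s ^+ 2 * (c ^+ 2 * ambient_form X b0 b0) + (1 - c) ^+ 2).
    by ring.
  by rewrite cb0 s2; ring.
have Fc1B i : i != 0 -> ambient_form X c1 (row i B) = 0.
  move=> i0; rewrite /c1 ambient_formDl !ambient_formZl b0B /b1 BB eq_sym (negPf i0).
  by rewrite !mulr0 addr0.
have Fc0B i : i != 0 -> ambient_form X c0 (row i B) = 0.
  move=> i0; rewrite /c0 ambient_formDl !ambient_formZl b0B /b1 BB eq_sym (negPf i0).
  by rewrite !mulr0 addr0.
have Fc0c1 : c * ambient_form X c0 c1 = 0.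
  rewrite /c0 /c1 !(ambient_formDl, ambient_formDr, ambient_formZl, ambient_formZr).
  rewrite F11 F01 F10.
  transitivity ((1 - c) * s * (c ^+ 2 * ambient_form X b0 b0 - c)); first by ring.
  by rewrite cb0 subrr mulr0.
have Fc0 : c ^+ 2 * ambient_form X c0 c0 = c.
  rewrite /c0 !(ambient_formDl, ambient_formDr, ambient_formZl, ambient_formZr).
  rewrite F11 F01 F10.
  transitivity ((1 - c) ^+ 2 * (c ^+ 2 * ambient_form X b0 b0) + c ^+ 2 * s ^+ 2).
    by ring.
  by rewrite cb0 s2; ring: c3.
(* With [h = 1] and [D = 0] the frame is centered at [c0] in place of the origin: [z] measures the
   distance to [c0], and [b0] has coordinates [z = 1], [v = 0]. *)
have frame : polar_frame X 1 0 c0 C.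
  split => //.
  - by rewrite mulr0 subr0 expr1n.
  - move=> i j; have [->|i0] := eqVneq i 0; have [->|j0] := eqVneq j 0.
    + by rewrite rowC0 Fc1.
    + by rewrite rowC0 rowCS// Fc1B// eq_sym (negPf j0).
    + by rewrite rowC0 rowCS// ambient_formC Fc1B// (negPf i0).
    + by rewrite !rowCS// BB.
  - move=> i; have [->|i0] := eqVneq i 0; first by rewrite rowC0.
    by rewrite rowCS// Fc0B// mulr0.
have stC v : stereo v *m C = stereo v 0 0 *: c1 +
    \sum_(i < m) stereo v 0 (lift ord0 i) *: row (lift ord0 i) B.
  rewrite mulmx_sum_row big_ord_recl rowC0; congr (_ + _).
  by apply: eq_bigr => i _; rewrite rowCS// eq_sym neq_lift.
pose u0 : 'rV[R]_m.+1 := rV_cons (1, 0).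
have norm10 : norm1 (0 : 'rV[R]_m) = 1.
  by rewrite /norm1 big1 ?addr0// => i _; rewrite mxE expr0n.
have stereo_0 : stereo (0 : 'rV[R]_m) = delta_mx 0 0.
  apply/rowP => i; have [j ->|->] := unliftP ord0 i.
    by rewrite stereoS !mxE !mulr0 mul0r eqxx.
  by rewrite stereo0 mxE !eqxx norm10 divr1 /=; lra.
have phiu0 : polar_rV c 1 0 c0 C u0 = b0.
  rewrite /polar_rV /polar rV_cons_head rV_cons_tail /= stereo_0 -rowE rowC0.
  rewrite /polar_quad expr1n !mulr1 subr0 !divr1 -/s /c0 /c1.
  rewrite !scalerDr !scalerA addrACA -!scalerDl.
  have -> : (1 - c) * (1 - c) + s * (c * s) = 1.
    by transitivity ((1 - c) ^+ 2 + c * s ^+ 2); [ring|rewrite s2; ring].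
  have -> : (1 - c) * - s + s * (1 - c) = 0 by ring.
  by rewrite scale0r addr0 scale1r.
have Uu0 : polar_dom c 0 u0.
  split; rewrite ?rV_cons_head//=; first by rewrite /polar_quad; lra.
  by move=> j; rewrite -rV_unconsE rV_cons_tail mxE normr0.
rewrite -phiu0; apply: (riemannian_null_point frame lamM _ Uu0).
move=> _ [u Uu <-]; apply: spanM; split; last first.
  exists ((1 - c * u 0 0) * (1 - c) + Num.sqrt (polar_quad c 0 (u 0 0)) *
     (stereo (rV_uncons u).2 0 0) * (c * s)).
  pose w : 'rV[R]_m.+1 := \row_i if i == 0 then (1 - c * u 0 0) * (- s) +
      Num.sqrt (polar_quad c 0 (u 0 0)) * stereo (rV_uncons u).2 0 0 * (1 - c)
     else Num.sqrt (polar_quad c 0 (u 0 0)) * stereo (rV_uncons u).2 0 i.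
  exists w; rewrite /polar_rV /polar !divr1 stC mulmx_sum_row big_ord_recl.
  have -> : w 0 ord0 = (1 - c * u 0 0) * (- s) +
      Num.sqrt (polar_quad c 0 (u 0 0)) * stereo (rV_uncons u).2 0 0 * (1 - c).
    by rewrite mxE eqxx.
  rewrite [X in _ + X]scalerDr scaler_sumr !addrA; congr (_ + _).
    rewrite /c0 /c1 !scalerDr !scalerA -/c addrACA -!scalerDl.
    by rewrite -!mulrA.
  have wS i : w 0 (lift ord0 i) = Num.sqrt (polar_quad c 0 (u 0 0)) *
      stereo (rV_uncons u).2 0 (lift ord0 i).
    by rewrite /w mxE -[_ == 0]/(lift ord0 i == ord0) eq_sym (negPf (neq_lift _ _)).
  by apply: eq_bigr => i _; rewrite scalerA wS.
have [z0 q0 _] := Uu.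
have FphiE : c ^+ 2 * ambient_form X (polar_rV c 1 0 c0 C u) (polar_rV c 1 0 c0 C u) = c.
  rewrite /polar_rV /polar scalemxAl ambient_formDl !ambient_formDr.
  rewrite !ambient_formZl !ambient_formZr (frame_dot frame).
  have -> : \sum_i (Num.sqrt (polar_quad c 0 (u 0 0)) / 1 *: stereo (rV_uncons u).2) 0 i *
     (Num.sqrt (polar_quad c 0 (u 0 0)) / 1 *: stereo (rV_uncons u).2) 0 i = polar_quad c 0 (u 0 0).
    under eq_bigr do rewrite -expr2 mxE exprMn.
    by rewrite -mulr_sumr stereo_norm mulr1 divr1 sqr_sqrtr// ltW.
  rewrite [ambient_form X (_ *m _) c0]ambient_formC.
  have := frame_b0_dot frame ((Num.sqrt (polar_quad c 0 (u 0 0)) / 1) *: stereo (rV_uncons u).2).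
  rewrite -/c; set f := ambient_form X c0 (_ *m _) => cf.
  set a := (1 - c * u 0 0).
  transitivity (a ^+ 2 * (c ^+ 2 * ambient_form X c0 c0) + 2 * a * c * (c * f)
    + c ^+ 2 * polar_quad c 0 (u 0 0)); first by field.
  by rewrite Fc0 cf /a /polar_quad; ring: c3.
have lastE : (polar_rV c 1 0 c0 C u) 0 ord_max =
   ((1 - c * u 0 0) * (1 - c) + c * s * (Num.sqrt (polar_quad c 0 (u 0 0)) *
    stereo (rV_uncons u).2 0 0)) * b0 0 ord_max.
  rewrite /polar_rV /polar !divr1 stC.
  set t := stereo _ 0 0; set r := Num.sqrt _.
  set S := \sum_(i < m) _.
  have S0 : S 0 ord_max = 0.
    by rewrite summxE big1// => i _; rewrite !mxE Bl mulr0.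
  by rewrite /c0 /c1 /b1 !mxE !Bl S0; ring.
apply: (center_model z0 q0 _ FphiE lastE Xb0).
rewrite stereo0 lerBlDr ler_pdivrMr ?norm1_gt0// ler_peMr//.
by rewrite lerDl sumr_ge0// => i _; exact: sqr_ge0.
Qed.

End frame_measure.

(** * Radial functions and the radial coordinate *)

Section radial.
Context {R : realType}.

(* This is 2 s_c(d(o, x)/2)^2. *)
Definition radial_coord (X : model) n (x : 'rV[R]_n.+1) : R :=
  if X is Euclidean then spatial x / 2 else curvature X * (1 - x 0 ord_max).

Lemma radial_coord_polar X m n h (b0 : 'rV[R]_n.+1) (B : 'M[R]_(m.+1, n.+1)) u :
  adapted_frame X h b0 B -> polar_dom (curvature X) (spatial b0) u ->
  radial_coord X (polar_rV (curvature X) h (spatial b0) b0 B u) = u 0 0.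
Proof.
move=> frame Uu; rewrite /radial_coord (polar_last frame) (polar_spatial frame)//.
by case: X frame Uu => /= _ _; rewrite /polar_quad; field.
Qed.

Lemma ambient_form_originl X n (x : 'rV[R]_n.+1) : ambient_form X (origin n) x =
  (if X is Hyperbolic then -1 else 1) * x 0 ord_max.
Proof.
rewrite /ambient_form /origin big1 ?add0r; last first.
  by move=> i _; rewrite mxE eqxx/= eq_sym (negPf (neq_lift _ _)) mul0r.
by rewrite mxE !eqxx mul1r.
Qed.

Lemma model_dist_origin X n (x y : 'rV[R]_n.+1) : model_space X x -> model_space X y ->
  radial_coord X x = radial_coord X y ->
  model_dist X (origin n) x = model_dist X (origin n) y.
Proof.
case: X => /= x1 y1 xy.
- congr Num.sqrt; rewrite !ambient_form_spatial.
  have sE (z : 'rV[R]_n.+1) : spatial (origin n - z) = spatial z.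
    apply: eq_bigr => i _; rewrite !mxE.
    by rewrite eqxx/= eq_sym (negPf (neq_lift _ _)) sub0r sqrrN.
  rewrite !sE !mxE x1 y1; congr (_ + _).
  by move: xy; rewrite /radial_coord; lra.
- congr arcosh; rewrite !ambient_form_originl.
  by move: xy; rewrite /radial_coord/=; lra.
- congr acos; rewrite !ambient_form_originl.
  by move: xy; rewrite /radial_coord/=; lra.
Qed.

Lemma sphere_last_le1 n (x : 'rV[R]_n.+1) : model_space Spherical x ->
  -1 <= x 0 ord_max <= 1.
Proof.
rewrite /= ambient_form_spatial => x1; have := spatial_ge0 x => s0.
rewrite -ler_norml -(@ler_pXn2r _ 2) ?nnegrE// real_normK ?num_real//; lra.
Qed.

(** On the sphere the profile only reaches the open upper hemisphere. Two points of the lower one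
    are replaced by their antipodes, by evenness; on the equator, where the coordinate is [1],
    neither argument applies. *)
Lemma radial_coord_eq X n (f : 'rV[R]_n.+1 -> R[i]) x y : radial X f ->
  model_space X x -> model_space X y ->
  radial_coord X x = radial_coord X y -> radial_coord X x != 1 -> f x = f y.
Proof.
move=> [feven [g fg]].
have H x' y' : model_space X x' -> model_space X y' ->
    radial_coord X x' = radial_coord X y' ->
    (X = Spherical -> 0 < x' 0 ord_max) -> f x' = f y'.
  move=> Xx Xy xy x0; have dE := model_dist_origin Xx Xy xy.
  have dx : ((model_dist X (origin n) x' / 2)%:E < quarter_diameter X)%E.
    case: X Xx x0 {feven fg Xy xy dE} => Xx /= x0; rewrite ?ltry// lte_fin.
    rewrite ambient_form_originl mul1r.
    suff : acos (x' 0 ord_max) < pi / 2 by lra.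
    have x1 := sphere_last_le1 Xx; have := x0 erefl.
    rewrite -ltr_cos ?in_itv/= ?acos_ge0 ?acos_lepi ?divr_ge0 ?pi_ge0//; last first.
      by rewrite ler_pdivrMr// ler_peMr ?pi_ge0// ler1n.
    by rewrite cos_pihalf acosK ?in_itv.
  by rewrite fg// fg -?dE// dE.
move=> Xx Xy xy x1; have [XE|XE] := eqVneq (curvature X : R) 1; last first.
  by apply: H => // XS; move: XE; rewrite XS eqxx.
have {}XE : X = Spherical by case: X XE {feven fg H Xx Xy xy x1} => //= e; exfalso; lra.
subst X; move: x1 xy; rewrite /radial_coord/= !mul1r => x1 xy.
have [x0|x0] := ltP 0 (x 0 ord_max); first by apply: H; rewrite ?/radial_coord/= ?mul1r.
have Xn z : model_space Spherical z -> model_space Spherical (- z) :> Prop.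
  by rewrite /= -scaleN1r ambient_formZl ambient_formZr; lra.
rewrite -feven// -[RHS]feven//; apply: H; rewrite /radial_coord/= ?mxE; [exact: Xn|exact: Xn|lra|].
move=> _; rewrite oppr_gt0 lt_neqAle x0 andbT.
by apply: contra x1 => /eqP ->; rewrite subr0.
Qed.

End radial.

Section plane_measure.
Context {R : realType}.
Local Open Scope ereal_scope.

(** The plane consists of two half planes, each bounded through its own chart, and of [b0] and
    possibly [- b0], which are null; hence the factor [2]. *)
Lemma plane_measure_le X m n (h : R) (b0 : 'rV[R]_n.+1) (B : 'M[R]_(m.+2, n.+1))
    M (lam : {measure set 'rV[R]_n.+1 -> \bar R}) (A : set (measurableTypeR R))
    (E : set 'rV[R]_n.+1) :
  adapted_frame X h b0 B -> is_riemannian_measure X m.+2 M lam ->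
  M = model_space X `&` frame_span b0 B ->
  measurable A -> measurable E ->
  (forall x, model_space X x -> E x -> radial_coord X x <> 1%R ->
     radial_dom (curvature X) 0 (radial_coord X x) -> A (radial_coord X x)) ->
  lam (M `&` E) <= 2%:E * ((h^-1)%:E * radial_mass X m A * (8 ^+ m.+1)%:E).
Proof.
move=> frame lamM ME mA mE EA; set bound := (h^-1)%:E * _ * _.
have spanM : model_space X `&` frame_span b0 B `<=` M by rewrite ME.
have fframe := flip_row_frame frame.
have EA' (B' : 'M[R]_(m.+2, n.+1)) : adapted_frame X h b0 B' -> forall u,
    polar_dom (curvature X) (spatial b0) u -> u 0%R 0%R <> 1%R ->
    E (polar_rV (curvature X) h (spatial b0) b0 B' u) -> A (u 0%R 0%R).
  move=> fr u Uu u1 Eu; have rcE := radial_coord_polar fr Uu.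
  rewrite -rcE; apply: EA => //; rewrite ?rcE//.
    exact: (polar_model fr).
  by have [? ? _] := Uu; apply: (radial_dom_sub (spatial_ge0 b0)); split.
have le1 := half_plane_measure_le frame lamM spanM mA mE (EA' _ frame).
have le2 : lam (half_plane X b0 (flip_row B) `&` E) <= bound.
  apply: half_plane_measure_le fframe lamM _ mA mE (EA' _ fframe).
  by rewrite (frame_span_flip b0 B).
have mM : measurable M.
  rewrite ME; apply: measurableI; first exact: measurable_model_space.
  exact: (measurable_frame_span frame).
have lb0 : lam [set b0] = 0.
  apply: (riemannian_center_null (af_b0 frame) (af_Blast frame) (af_BB frame)
    (af_b0B frame) spanM lamM).
have lNb0 : lam [set (- b0)%R] = 0.
  (* If [- b0] is on the plane, it is itself a center, with the same rows [B]; otherwise it is null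
     because [lam] is carried by [M]. *)
  have [Mb|Mb] := pselect (M (- b0)%R); last first.
    apply/eqP; rewrite eq_le measure_ge0 andbT -(lamM.1).
    apply: le_measure; rewrite ?inE; [exact: measurable_rV1|exact: measurableC|].
    by move=> x ->.
  apply: (riemannian_center_null _ (af_Blast frame) (af_BB frame) _ _ lamM).
  - by move: Mb; rewrite ME => -[].
  - by move=> i; rewrite -scaleN1r ambient_formZl (af_b0B frame) mulr0.
  - rewrite ME; apply: setIS => x [a [w ->]]; exists (- a)%R, w.
    by rewrite scalerN scaleNr.
have mH1 := measurableI _ _ (measurable_half_plane frame) mE.
have mH2 := measurableI _ _ (measurable_half_plane fframe) mE.
have ms1 := measurable_rV1 b0; have ms2 := measurable_rV1 (- b0)%R.
apply: (@le_trans _ _ (lam (([set b0] `|` [set (- b0)%R]) `|`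
    ((half_plane X b0 B `&` E) `|` (half_plane X b0 (flip_row B) `&` E))))).
  apply: le_measure; rewrite ?inE.
  - exact: measurableI.
  - by apply: measurableU; apply: measurableU.
  - move=> x []; rewrite {1}ME => -[Xx Sx] Ex.
    have [->|->|Hx|[? ? ? ? ?]] := frame_span_half_plane Xx Sx.
    + by left; left.
    + by left; right.
    + by right; left.
    + by right; right; split.
apply: (le_trans (measureU2 _ _ _)); [exact: measurableU|exact: measurableU|].
rewrite [X in X + _](_ : _ = 0); last first.
  apply/eqP; rewrite eq_le measure_ge0 andbT.
  by apply: (le_trans (measureU2 _ _ _)); rewrite // [X in X + _]lb0 [X in _ + X]lNb0 adde0.
rewrite add0e; apply: (le_trans (measureU2 _ _ _)) => //.
apply: (@le_trans _ _ (bound + bound)); first exact: leeD.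
by rewrite mule_natl mule2n.
Qed.

Definition std_rows n : 'M[R]_(n, n.+1) := \matrix_(i, j) (j == lift ord_max i)%:R%R.

Lemma mul_std_rows n (w : 'rV[R]_n) i : (w *m std_rows n)%R 0%R (lift ord_max i) = w 0%R i.
Proof.
rewrite mxE -[RHS](sum_delta (fun i => w 0%R i)); apply: eq_bigr => j _.
by rewrite mxE (inj_eq lift_inj) eq_sym mulrC.
Qed.

Lemma mul_std_rows_last n (w : 'rV[R]_n) : (w *m std_rows n)%R 0%R ord_max = 0%R.
Proof.
rewrite mxE big1// => j _; rewrite mxE (negPf (neq_lift _ _)).
exact: mulr0.
Qed.

Lemma origin_lift n (i : 'I_n) : (origin n : 'rV[R]_n.+1) 0%R (lift ord_max i) = 0%R.
Proof. by rewrite mxE eqxx/= eq_sym (negPf (neq_lift _ _)). Qed.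

Lemma origin_last n : (origin n : 'rV[R]_n.+1) 0%R ord_max = 1%R.
Proof. by rewrite mxE !eqxx. Qed.

Lemma spatial_origin n : spatial (origin n : 'rV[R]_n.+1) = 0%R.
Proof. by rewrite /spatial big1// => i _; rewrite origin_lift expr0n. Qed.

Lemma std_adapted_frame X m : adapted_frame X 1%R (origin m.+1 : 'rV[R]_m.+2) (std_rows m.+1).
Proof.
have rowE i : row i (std_rows m.+1) = (delta_mx 0 i *m std_rows m.+1)%R by rewrite rowE.
split => //.
- exact: origin_last.
- case: X => /=; rewrite ?origin_last// ambient_form_spatial spatial_origin origin_last.
    by split => //; ring.
  by ring.
- by move=> i; rewrite mxE (negPf (neq_lift _ _)).
- move=> i j; rewrite /ambient_form !rowE !mul_std_rows_last mulr0 mulr0 addr0.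
  under eq_bigr do rewrite !mul_std_rows.
  under eq_bigr do rewrite !mxE !eqxx/=.
  by rewrite (sum_delta (fun l => (l == j)%:R)%R).
- move=> i; rewrite ambient_form_originl !rowE mul_std_rows_last.
  exact: mulr0.
Qed.

(** The set [A] is read off [E] along a single ray from the origin, the points with [v = 0] in the
    standard chart, so that it is measurable as a preimage. The invariance of [E] transports it to
    all other directions, in the space and in the plane. *)
Lemma radial_set_comparison X m m' (h : R) (b0 : 'rV[R]_m'.+3)
    (B : 'M[R]_(m.+2, m'.+3)) M (lam mu : {measure set 'rV[R]_m'.+3 -> \bar R})
    (E : set 'rV[R]_m'.+3) :
  adapted_frame X h b0 B -> is_riemannian_measure X m.+2 M lam ->
  M = model_space X `&` frame_span b0 B ->
  is_riemannian_measure X m'.+2 (model_space X) mu -> measurable E ->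
  (forall x y, model_space X x -> model_space X y -> E x ->
     radial_coord X x = radial_coord X y -> radial_coord X x <> 1%R -> E y) ->
  exists A : set (measurableTypeR R), [/\ measurable A,
    lam (M `&` E) <= 2%:E * ((h^-1)%:E * radial_mass X m A * (8 ^+ m.+1)%:E) &
    radial_mass X m' A * ((2 / m'.+2%:R) ^+ m'.+1)%:E <= mu E].
Proof.
move=> frame lamM ME muM mE ErE.
have sframe := @std_adapted_frame X m'.+1; have s0 := spatial_origin m'.+2.
pose phi := polar_rV (curvature X) 1 0 (origin m'.+2) (std_rows m'.+2).
pose sec (z : measurableTypeR R) : 'rV[R]_m'.+2 := rV_cons (z, 0%R).
have sec_dom z : radial_dom (curvature X) 0 z -> polar_dom (curvature X) 0 (sec z).
  move=> [z0 qz]; split; rewrite ?rV_cons_head// => j.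
  by rewrite -rV_unconsE rV_cons_tail mxE normr0.
have phi_model u : polar_dom (curvature X) 0 u -> model_space X (phi u).
  by have := @polar_model _ _ _ _ _ _ _ sframe u; rewrite s0.
have phi_rc u : polar_dom (curvature X) 0 u -> radial_coord X (phi u) = u 0%R 0%R.
  by have := @radial_coord_polar _ X _ _ _ _ _ u sframe; rewrite s0.
pose A : set (measurableTypeR R) := [set z | z <> 1%R] `&` (phi \o sec) @^-1` E.
have mA : measurable A.
  apply: measurableI.
    rewrite (_ : [set z | _] = ~` [set 1%R])//.
    by apply: measurableC; exact: measurable_set1.
  have msec : measurable_fun setT sec.
    apply: measurable_fun_rV => j; have [l ->|->] := unliftP ord0 j.
      rewrite (_ : (fun _ => _) = cst 0%R); first exact: measurable_cst.
      by apply/funext => z; rewrite -rV_unconsE rV_cons_tail mxE.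
    rewrite (_ : (fun _ => _) = id); first exact: measurable_id.
    by apply/funext => z; rewrite rV_cons_head.
  have mphis : measurable_fun setT (phi \o sec).
    apply: measurableT_comp msec; exact: measurable_polar_rV.
  by rewrite -[X in measurable X]setTI; exact: mphis.
exists A; split => //.
- apply: (plane_measure_le frame lamM ME mA mE).
  move=> x Xx Ex x1 xD; split => //=; have Ux := sec_dom _ xD.
  apply: ErE Xx _ Ex _ x1; first exact: phi_model.
  by rewrite phi_rc// /sec rV_cons_head.
- have EA u : polar_dom (curvature X) (spatial (origin m'.+2)) u -> A (u 0%R 0%R) ->
      E (polar_rV (curvature X) 1 (spatial (origin m'.+2)) (origin m'.+2) (std_rows m'.+2) u).
    rewrite s0 => Uu [u1 Eu]; have Us : polar_dom (curvature X) 0 (sec (u 0%R 0%R)).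
      by apply: sec_dom; have [] := Uu.
    apply: ErE Eu _ _; [exact: phi_model|exact: phi_model| |].
      by rewrite !phi_rc// /sec rV_cons_head.
    by rewrite phi_rc// /sec rV_cons_head.
  by apply: (riemannian_ge_radial_mass sframe erefl s0 muM _ mA mE EA) => x [].
Qed.

(* The length of [{z | radial_profile c z < a}] is [O(a ^+ radial_dim X)]. *)
Definition radial_dim (X : model) : nat := if X is Hyperbolic then 1%N else 2%N.

(** From [2 z - c z^2 < a^2]: for [c = 0] this bounds [z] by [a^2]; for [c = -1] the term [z^2]
    bounds [z] by [a]; for [c = 1] the profile is symmetric about [z = 1], whence the second
    interval, near the antipode [z = 2]. *)
Lemma radial_profile_lt X (a z : R) : (0 < a)%R -> radial_dom (curvature X) 0 z ->
  (radial_profile (curvature X) z < a)%R ->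
  (z < a ^+ radial_dim X)%R \/ (2 - a ^+ radial_dim X < z < 2)%R.
Proof.
move=> a0 [z0 qz] Ta; have : (polar_quad (curvature X) 0 z < a ^+ 2)%R.
  rewrite -[ltLHS]sqr_sqrtr ?(ltW qz)// ltr_pXn2r ?nnegrE ?sqrtr_ge0//.
  exact: ltW.
move: qz; rewrite /polar_quad; case: X Ta => /= Ta qz qa.
- by left; lra.
- left; have [//|za] := ltP z a; nra.
- have [z1|z1] := leP z 1%R; first by left; nra.
  by right; apply/andP; split; nra.
Qed.

(** Where the profile [T] is at least [a], [T^m <= a^(m - m') T^m'], and the hypothesis gives
    [a^(m + e)]. Where [T < a], [T^m <= a^m] on a set of length at most [2 a^e]. The total is
    [3 a^(m + e)]. *)
Lemma radial_mass_bathtub X m m' (A : set (measurableTypeR R)) (a : R) :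
  measurable A -> (m <= m')%N -> (0 < a)%R ->
  radial_mass X m' A <= (a ^+ (m' + radial_dim X))%:E ->
  radial_mass X m A <= (3 * a ^+ (m + radial_dim X))%:E.
Proof.
move=> mA mm' a0 massA; pose T := radial_profile (curvature X : R).
pose S := A `&` radial_dom (curvature X) 0.
have mS : measurable (S : set (measurableTypeR R)).
  by apply: measurableI => //; exact: measurable_radial_dom.
have mT : measurable_fun setT T.
  by apply: measurable_fun_sqrt; exact: measurable_polar_quad.
pose L : set (measurableTypeR R) := [set z | 0 <= T z - a]%R.
have mL : measurable L by apply: measurable_set_ge0; apply: measurable_funB.
have T0 z k : 0 <= (T z ^+ k)%:E by rewrite lee_fin exprn_ge0// radial_profile_ge0.
have mTk k (D : set (measurableTypeR R)) : measurable_fun D (fun z => (T z ^+ k)%:E).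
  by apply/measurable_EFinP/measurable_funTS; exact: measurable_funX.
have mSL : measurable (S `&` L) by exact: measurableI.
have mSDL : measurable (S `\` L) by exact: measurableD.
set e := radial_dim X in massA *.
have ae0 k : (0 < a ^+ k)%R by exact: exprn_gt0.
rewrite /radial_mass -/S -/T -[S](setUIDK S L) ge0_integral_setU//; last first.
  by rewrite disj_set2E; apply/eqP/seteqP; split => // z [[_ ?] []].
have -> : (3 * a ^+ (m + e))%:E = (a ^+ (m + e))%:E + (2 * a ^+ (m + e))%:E.
  by rewrite -EFinD; congr (_%:E); ring.
apply: leeD.
- have aE : (a ^+ (m + e) = (a ^+ (m' - m))^-1 * a ^+ (m' + e))%R.
    have -> : (m' + e = (m' - m) + (m + e))%N by rewrite addnA subnK.
    by rewrite [in RHS]exprD mulKf// gt_eqF.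
  rewrite aE EFinM.
  apply: (@le_trans _ _ (((a ^+ (m' - m))^-1)%R%:E *
      \int[lebesgue_measure]_(z in S) (T z ^+ m')%:E)); last first.
    by apply: lee_wpmul2l => //; rewrite lee_fin invr_ge0 ltW.
  rewrite -ge0_integralZl_EFin ?invr_ge0 ?(ltW (ae0 _))//.
  apply: (@le_trans _ _ (\int[lebesgue_measure]_(z in S `&` L)
      (((a ^+ (m' - m))^-1)%R%:E * (T z ^+ m')%:E))); last first.
    apply: ge0_subset_integral => //; first exact: measurable_funeM.
    by move=> z _; rewrite mule_ge0// lee_fin invr_ge0 ltW.
  apply: ge0_le_integral => //; first exact: measurable_funeM.
  move=> z [_ Lz]; have aT : (a <= T z)%R by rewrite -subr_ge0.
  rewrite -EFinM lee_fin ler_pdivlMl// -[in leRHS](subnK mm') exprD.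
  rewrite ler_wpM2r ?exprn_ge0 ?radial_profile_ge0//.
  by rewrite lerXn2r ?nnegrE ?radial_profile_ge0// ltW.
- apply: (@le_trans _ _ (\int[lebesgue_measure]_(z in S `\` L) (a ^+ m)%:E)).
    apply: ge0_le_integral => // z [_ /negP]; rewrite -ltNge subr_lt0 => Ta.
    by rewrite lee_fin lerXn2r ?nnegrE ?radial_profile_ge0// ltW.
  rewrite integral_cst//.
  have -> : (2 * a ^+ (m + e))%:E = (a ^+ m)%:E * (2 * a ^+ e)%:E.
    by rewrite -EFinM; congr (_%:E); rewrite exprD; ring.
  apply: lee_wpmul2l; first by rewrite lee_fin ltW.
  pose I1 : set (measurableTypeR R) := `]0%R, (a ^+ e)%R[%classic.
  pose I2 : set (measurableTypeR R) := `](2 - a ^+ e)%R, 2%R[%classic.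
  have mI1 : measurable I1 by exact: measurable_itv.
  have mI2 : measurable I2 by exact: measurable_itv.
  apply: (@le_trans _ _ (lebesgue_measure (I1 `|` I2))).
    apply: le_measure; rewrite ?inE//; first exact: measurableU.
    move=> z [[_ zD] /negP]; rewrite -ltNge subr_lt0 => Ta.
    have [za|za] := radial_profile_lt a0 zD Ta.
      by left; rewrite /I1 /= in_itv/= za andbT; case: zD.
    by right; rewrite /I2 /= in_itv.
  apply: (le_trans (measureU2 _ _ _)) => //.
  have -> : (2 * a ^+ e)%:E = (a ^+ e)%:E + (a ^+ e)%:E.
    by rewrite -EFinD; congr (_%:E); ring.
  apply: leeD; rewrite /I1 /I2.
    by rewrite [leLHS]lebesgue_measure_itv/= lte_fin ae0 -EFinD subr0.
  rewrite [leLHS]lebesgue_measure_itv/= lte_fin.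
  rewrite ifT; last by rewrite ltrBlDr ltrDl.
  by rewrite -EFinD lee_fin opprB addrC subrK.
Qed.

End plane_measure.

(** * Dyadic layer cake and the Lorentz norm *)

Section ge0_le_integral_nomeas.
Local Open Scope ereal_scope.

(** The integral of a nonnegative function is a supremum over the simple functions below it, hence
    monotone also on functions not known to be measurable, such as the integrand of
    [lorentz_norm]. *)
Lemma ge0_le_integral_nomeas d (T : measurableType d) (R : realType)
    (mu : {measure set T -> \bar R}) (D : set T) (f g : T -> \bar R) :
  (forall x, D x -> 0 <= f x) -> (forall x, D x -> f x <= g x) ->
  \int[mu]_(x in D) f x <= \int[mu]_(x in D) g x.
Proof.
move=> f0 fg; rewrite !ge0_integralE//; last first.
  by move=> x Dx; exact: le_trans (f0 _ Dx) (fg _ Dx).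
apply: le_ereal_sup => _ [h hf <-]; exists h => // x; apply: le_trans (hf x) _.
by rewrite /patch; case: ifPn => //; rewrite inE; exact: fg.
Qed.

End ge0_le_integral_nomeas.

Section dyadic.
Context {R : realType}.
Implicit Types x : R.

Lemma exists_pow2_gt x : exists n : nat, x <= 2 ^+ n.
Proof.
exists (Num.bound `|x|); apply: le_trans (ler_norm _) _.
apply: le_trans (ltW (archi_boundP (normr_ge0 x))) _.
by rewrite -natrX ler_nat ltnW// ltn_expl.
Qed.

Lemma dyadic_up x : 1 < x -> exists n : nat, 2 ^+ n < x /\ x <= 2 ^+ n.+1.
Proof.
move=> x1; have ex := exists_pow2_gt x.
have exb : exists n : nat, (x <= 2 ^+ n) by [].
case: (ex_minnP exb) => -[|n] xn nmin; first by move: xn; rewrite expr0 leNgt x1.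
exists n; split => //; rewrite ltNge; apply/negP => /nmin.
by rewrite ltnn.
Qed.

Lemma dyadic_down x : 0 < x <= 1 -> exists n : nat, (2 ^+ n.+1)^-1 < x /\ x <= (2 ^+ n)^-1.
Proof.
move=> /andP[x0 x1]; have [N xN] := exists_pow2_gt (2 / x).
have exb : exists n : nat, ((2 ^+ n)^-1 < x).
  exists N; rewrite invf_plt ?posrE ?exprn_gt0//; apply: lt_le_trans xN.
  by rewrite ltr_pdivlMr// mulVf ?gt_eqF// ltr1n.
case: (ex_minnP exb) => -[|n] xn nmin; first by move: xn; rewrite expr0 invr1 ltNge x1.
exists n; split => //; rewrite leNgt; apply/negP => /nmin.
by rewrite ltnn.
Qed.

(** The induction carries along the bound [2 ^+ N.+1] of the whole sum: when the new term is
    present, [2 ^+ N <= x] turns it into the bound [4 * x]. *)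
Lemma dyadic_up_sum x N : 0 <= x ->
  \sum_(0 <= n < N) 2 ^+ n.+1 * (2 ^+ n <= x)%R%:R <= 4 * x.
Proof.
move=> x0; suff : \sum_(0 <= n < N) 2 ^+ n.+1 * (2 ^+ n <= x)%R%:R <= (2 ^+ N.+1 : R) /\
  \sum_(0 <= n < N) 2 ^+ n.+1 * (2 ^+ n <= x)%R%:R <= 4 * x by case.
elim: N => [|N [IH1 IH2]]; first by rewrite !big_geq//; split; rewrite ?exprn_ge0 ?mulr_ge0.
rewrite big_nat_recr//=; set S := \sum_(0 <= i < N) _ in IH1 IH2 *.
have [Nx|Nx] := leP (2 ^+ N) x; rewrite ?mulr1 ?mulr0 ?addr0.
  have e : S + 2 ^+ N.+1 <= 4 * 2 ^+ N by rewrite !exprS in IH1 *; lra.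
  by split; [rewrite !exprS in e *; lra|lra].
by split => //; rewrite !exprS in IH1 *; lra.
Qed.

(** Without its first term the sum is half of the sum for [2 * x], so the induction runs over all
    arguments at once; the bound [2] serves when the first term is present. *)
Lemma dyadic_down_sum x N : 0 <= x ->
  \sum_(0 <= n < N) (2 ^+ n)^-1 * ((2 ^+ n.+1)^-1 <= x)%R%:R <= 4 * x.
Proof.
suff : forall y : R, 0 <= y ->
  \sum_(0 <= n < N) (2 ^+ n)^-1 * ((2 ^+ n.+1)^-1 <= y)%R%:R <= (2 : R) /\
  \sum_(0 <= n < N) (2 ^+ n)^-1 * ((2 ^+ n.+1)^-1 <= y)%R%:R <= 4 * y.
  by move=> H /H[].
elim: N => [y y0|N IH y y0]; first by rewrite !big_geq//; split; rewrite ?mulr_ge0.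
have [] := IH (2 * y); first by rewrite mulr_ge0.
rewrite big_nat_recl//=.
have -> : \sum_(0 <= i < N) (2 ^+ i.+1 : R)^-1 * ((2 ^+ i.+2)^-1 <= y)%R%:R =
  2^-1 * \sum_(0 <= n < N) (2 ^+ n)^-1 * ((2 ^+ n.+1)^-1 <= 2 * y)%R%:R.
  rewrite mulr_sumr; apply: eq_bigr => i _; rewrite mulrA [in LHS]exprS invfM.
  by congr (_ * (nat_of_bool _)%:R); rewrite [in LHS]exprS invfM ler_pdivrMl.
set S := \sum_(0 <= n < N) _ => S1 S2.
rewrite expr0 expr1 invr1 mul1r.
have [y2|y2] := leP 2^-1 y; rewrite ?mulr1n ?mulr0n; split; lra.
Qed.

End dyadic.

Lemma modulusE (R : realType) (z : R[i]) :
  modulus z = Num.sqrt (complex.Re z ^+ 2 + complex.Im z ^+ 2).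
Proof. by case: z. Qed.

Section lorentz_layer_cake.
Context {R : realType} (n : nat).
Local Open Scope ereal_scope.

Definition lorentz_weight (p t : R) : R := (t `^ p^-1 * t^-1)%R.

(* [p m^(1/p)] for finite [m]. *)
Definition lorentz_mass (p : R) (m : \bar R) : \bar R :=
  \int[lebesgue_measure]_(t in `]0%R, +oo[%classic)
    ((lorentz_weight p t)%:E * (t%:E < m)%E%:R%:E).

Lemma lorentz_weight_ge0 p (t : R) : (0 < t)%R -> (0 <= lorentz_weight p t)%R.
Proof. by move=> t0; rewrite mulr_ge0 ?powR_ge0// invr_ge0 ltW. Qed.

Lemma lorentz_weight_ge p (t b : R) : (1 <= p)%R -> (0 < t)%R -> (t <= b)%R ->
  (lorentz_weight p b <= lorentz_weight p t)%R.
Proof.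
move=> p1 t0 tb; have b0 := lt_le_trans t0 tb.
have wE (s : R) : (0 < s)%R -> lorentz_weight p s = ((s `^ (1 - p^-1))^-1)%R.
  move=> s0; rewrite /lorentz_weight powRB; last by rewrite [s == 0%R]gt_eqF ?implybT.
  rewrite powRr1 ?ltW//.
  by rewrite invf_div.
rewrite !wE// lef_pV2 ?posrE ?powR_gt0//.
apply: ge0_ler_powR; rewrite ?nnegrE ?(ltW t0) ?(ltW b0)//.
by rewrite subr_ge0 invf_le1// (lt_le_trans ltr01).
Qed.

Lemma lorentz_mass_mono p (m1 m2 : \bar R) : m1 <= m2 ->
  lorentz_mass p m1 <= lorentz_mass p m2.
Proof.
move=> m12; apply: ge0_le_integral_nomeas => t; rewrite /= in_itv/= andbT => t0.
  by rewrite -EFinM lee_fin mulr_ge0// lorentz_weight_ge0.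
rewrite -!EFinM lee_fin ler_wpM2l ?lorentz_weight_ge0//.
case: (ltP t%:E m1) => [tm1|_]; last exact: ler0n.
by rewrite (lt_le_trans tm1 m12).
Qed.

(** A rectangle under a nonincreasing curve: the left side is [b] times the weight at [b]. *)
Lemma lorentz_mass_ge p (b : R) : (1 <= p)%R -> (0 < b)%R ->
  (b `^ p^-1)%:E <= lorentz_mass p b%:E.
Proof.
move=> p1 b0; have -> : (b `^ p^-1)%:E =
    \int[lebesgue_measure]_(t in `]0%R, b[%classic) (lorentz_weight p b)%:E.
  rewrite integral_cst//= lebesgue_measure_itv/= lte_fin b0 -EFinD subr0 -EFinM.
  by rewrite /lorentz_weight mulfVK// gt_eqF.
rewrite /lorentz_mass integral_mkcond [leRHS]integral_mkcond.
apply: ge0_le_integral_nomeas => t _.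
  apply: erestrict_ge0 => s; rewrite /= in_itv/= => /andP[s0 sb].
  by rewrite lee_fin lorentz_weight_ge0.
rewrite /patch !mem_setE !in_itv/= andbT; case: (ltP 0%R t) => //= t0.
case: ifPn => [tb|_].
  by rewrite lte_fin tb mule1 lee_fin lorentz_weight_ge// ltW.
by rewrite -EFinM lee_fin mulr_ge0// lorentz_weight_ge0.
Qed.

(** For positive finite [m] take [b = m]. For [m = 0] every positive [b] is allowed and the bound
    tends to [0]; for infinite [m] the right side is infinite. *)
Lemma level_bound (C p : R) (x m : \bar R) : (0 < C)%R -> (1 <= p)%R -> 0 <= m ->
  (forall b : R, (0 < b)%R -> m <= b%:E -> x <= (C * b `^ p^-1)%:E) ->
  x <= C%:E * lorentz_mass p m.
Proof.
move=> C0 p1 m0 H; have p0 : (0 < p)%R := lt_le_trans ltr01 p1.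
case: m m0 H => [b|_ H|//]; rewrite ?lee_fin.
- rewrite le_eqVlt => /predU1P[<- H|b0 H]; last first.
    apply: le_trans (H b b0 (lexx _)) _; rewrite EFinM.
    by apply: lee_wpmul2l; [rewrite lee_fin ltW|exact: lorentz_mass_ge].
  apply: (@le_trans _ _ 0); last first.
    apply: mule_ge0; [by rewrite lee_fin ltW|apply: integral_ge0 => t].
    by rewrite /= in_itv/= andbT => t0; rewrite mule_ge0 ?lee_fin ?lorentz_weight_ge0.
  apply/lee_addgt0Pr => e e0; rewrite add0e.
  (* The power [p] of [e / C] is the value of [b] for which the bound in the hypothesis is [e]. *)
  have eC : (0 < e / C)%R by rewrite divr_gt0.
  have := H ((e / C) `^ p)%R (powR_gt0 _ eC).
  rewrite lee_fin powR_ge0 => /(_ isT).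
  by rewrite -powRrM divff ?gt_eqF// powRr1 ?(ltW eC)// mulrC divfK// gt_eqF.
- suff -> : lorentz_mass p +oo = +oo by rewrite gt0_muley ?leey// lte_fin.
  apply/eqyP => A A0; have AE : A = ((A `^ p) `^ p^-1)%R.
    by rewrite -powRrM divff ?gt_eqF// powRr1// ltW.
  rewrite AE; apply: le_trans (lorentz_mass_ge p1 (powR_gt0 _ A0)) _.
  by apply: lorentz_mass_mono; exact: leey.
Qed.

Variables (mu lam : {measure set 'rV[R]_n.+1 -> \bar R}).
Variables (D M : set 'rV[R]_n.+1) (f : 'rV[R]_n.+1 -> R[i]) (p C : R).
Hypotheses (mD : measurable D) (mM : measurable M) (MD : M `<=` D).
Hypothesis mf : measurable_fun D (fun x => modulus (f x) : measurableTypeR R).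
Hypotheses (p1 : (1 <= p)%R) (C0 : (0 < C)%R).

Let level (s : R) : set 'rV[R]_n.+1 := D `&` [set x | (s < modulus (f x))%R].

Hypothesis lam_mu : forall s b : R, (0 < s)%R -> (0 < b)%R ->
  mu (level s) <= b%:E -> lam (M `&` level s) <= (C * b `^ p^-1)%:E.

Lemma measurable_level s : measurable (level s).
Proof.
rewrite /level (_ : [set x | _] = (fun x => modulus (f x)) @^-1` `]s, +oo[%classic).
  exact: mf.
by apply/seteqP; split => x /=; rewrite in_itv/= andbT.
Qed.

Lemma le_decreasing_rearrangement (l t : R) : t%:E < mu (level l) ->
  l%:E <= decreasing_rearrangement mu D f t.
Proof.
move=> tl; apply: le_ereal_inf_tmp => _ [s [s0 mus] <-]; rewrite lee_fin leNgt.
apply/negP => sl; move: tl; rewrite ltNge => /negP; apply; apply: le_trans mus.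
apply: le_measure; rewrite ?inE; [exact: measurable_level|exact: measurable_level|].
by move=> x [Dx /= lx]; split => //=; exact: lt_trans lx.
Qed.

Lemma decreasing_rearrangement_ge0 t : 0 <= decreasing_rearrangement mu D f t.
Proof. by apply: le_ereal_inf_tmp => _ [s [s0 _] <-]; rewrite lee_fin. Qed.

(** The sum and the integrals over [t] are exchanged. For fixed [t], [t < mu (level l)] forces [l]
    to be at most the rearrangement at [t], so the hypothesis on [c] and [l] bounds the inner sum by
    this rearrangement. The factor [p] cancels the one in [lorentz_norm]. *)
Lemma layer_sum_le (c l : R^nat) : (forall k, 0 <= c k)%R -> (forall k, 0 < l k)%R ->
  (forall (x : R) N, (0 <= x)%R -> (\sum_(0 <= k < N) c k * (l k <= x)%R%:R <= x)%R) ->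
  \sum_(0 <= k <oo) (c k)%:E * lam (M `&` level (l k)) <=
  (C * p)%:E * lorentz_norm mu D p f.
Proof.
move=> c0 l0 cl; have p0 : (0 < p)%R := lt_le_trans ltr01 p1.
pose W t := (lorentz_weight p t)%:E.
pose I0 : set (measurableTypeR R) := `]0%R, +oo[%classic.
have W0 t : I0 t -> 0 <= W t.
  by rewrite /I0 /= in_itv/= andbT => t0; rewrite lee_fin lorentz_weight_ge0.
apply: (@le_trans _ _ (\sum_(0 <= k <oo)
    C%:E * ((c k)%:E * lorentz_mass p (mu (level (l k)))))).
  apply: lee_nneseries => [k _ _|k _]; first by rewrite mule_ge0 ?lee_fin.
  rewrite muleCA lee_wpmul2l ?lee_fin//.
  by apply: level_bound => // b b0; exact: lam_mu.
have J0 k : 0 <= lorentz_mass p (mu (level (l k))).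
  by apply: integral_ge0 => t /W0 wt; rewrite mule_ge0.
rewrite nneseriesZl; last by move=> k _; rewrite mule_ge0 ?lee_fin.
have mlt (m : \bar R) : measurable_fun I0 (fun t : R => (t%:E < m)%E%:R%:E : \bar R).
  apply/measurable_EFinP/measurable_funTS.
  rewrite (_ : (fun _ => _) = \1_[set t : R | t%:E < m]); last first.
    by apply/funext => t; rewrite indicE mem_setE.
  apply: measurable_indic; case: m => [r| |].
  - rewrite (_ : [set t | _] = `]-oo, r[%classic); first exact: measurable_itv.
    by apply/seteqP; split => t /=; rewrite in_itv/= lte_fin.
  - rewrite (_ : [set t | _] = setT); first exact: measurableT.
    by apply/seteqP; split => t //= _; exact: ltry.
  - rewrite (_ : [set t | _] = set0); first exact: measurable0.
    by apply/seteqP; split => t //=; rewrite ltNge leNye.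
have mW : measurable_fun I0 W.
  apply: (@eq_measurable_fun _ _ _ _ _ (fun t : R => (t `^ p^-1 * t `^ (-1))%:E)).
    move=> t; rewrite inE /I0 /= in_itv/= andbT => t0.
    by rewrite /W /lorentz_weight powR_inv1// ltW.
  apply/measurable_EFinP/measurable_funTS; apply: measurable_funM.
    exact: measurable_powR.
  exact: measurable_powR.
have mWlt k : measurable_fun I0 (fun t => W t * (t%:E < mu (level (l k)))%E%:R%:E).
  by apply: emeasurable_funM.
have mI0 : measurable I0 by exact: measurable_itv.
have Wlt0 k t : I0 t -> 0 <= W t * (t%:E < mu (level (l k)))%E%:R%:E.
  by move=> It; rewrite mule_ge0 ?W0// lee_fin.
have sumE : \sum_(0 <= k <oo) (c k)%:E * lorentz_mass p (mu (level (l k))) =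
   \int[lebesgue_measure]_(t in I0)
     \sum_(0 <= k <oo) (c k)%:E * (W t * (t%:E < mu (level (l k)))%E%:R%:E).
  rewrite integral_nneseries.
  - apply: eq_eseriesr => k _.
    by rewrite (ge0_integralZl_EFin _ mI0 (@Wlt0 k) (mWlt k) (c0 k)).
  - exact: mI0.
  - by move=> k; exact: measurable_funeM.
  - by move=> k t It; apply: mule_ge0; [rewrite lee_fin|exact: Wlt0].
rewrite sumE.
have -> : (C * p)%:E * lorentz_norm mu D p f = C%:E *
   \int[lebesgue_measure]_(t in I0) (W t * decreasing_rearrangement mu D f t).
  rewrite /lorentz_norm muleA -EFinM -mulrA divff ?gt_eqF// mulr1; congr (_ * _).
  by apply: eq_integral => t _; rewrite muleAC -EFinM.
apply: lee_wpmul2l; first by rewrite lee_fin ltW.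
apply: ge0_le_integral_nomeas => t It.
  by apply: nneseries_ge0 => k _ _; apply: mule_ge0; [rewrite lee_fin|exact: Wlt0].
have t0 : (0 < t)%R by move: It; rewrite /I0 /= in_itv/= andbT.
have Wt0 : 0 < W t by rewrite lte_fin mulr_gt0 ?powR_gt0// invr_gt0.
apply: lime_le.
  by apply: is_cvg_nneseries => k _ _; apply: mule_ge0; [rewrite lee_fin|exact: Wlt0].
apply: nearW => N.
have := decreasing_rearrangement_ge0 t.
have := @le_decreasing_rearrangement ^~ t.
case: (decreasing_rearrangement mu D f t) => [x|_ _|]; last 2 first.
- by rewrite gt0_muley// leey.
- by [].
move=> lx; rewrite lee_fin => x0.
apply: (@le_trans _ _ (W t * (\sum_(0 <= k < N) c k * (l k <= x)%R%:R)%:E)); last first.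
  by apply: lee_wpmul2l; [exact: ltW|rewrite lee_fin; exact: cl].
rewrite -sumEFin ge0_sume_distrr; last by move=> k _; rewrite lee_fin mulr_ge0.
apply: lee_sum => k _; rewrite muleCA EFinM.
apply: lee_wpmul2l; first exact: ltW.
apply: lee_wpmul2l; rewrite lee_fin//.
case: (ltP t%:E _) => [/lx|_]; last exact: ler0n.
by rewrite lee_fin => ->.
Qed.

Let layers (c l : R^nat) x := \sum_(0 <= k <oo) (c k)%:E * (\1_(level (l k)) x)%:E.

Let measurable_layers c l : (forall k, 0 <= c k)%R -> measurable_fun M (layers c l).
Proof.
move=> c0; apply: ge0_emeasurable_sum => [k x _ _|k _].
  by rewrite mule_ge0 ?lee_fin.
apply: measurable_funeM; apply/measurable_EFinP/measurable_indic.
exact: measurable_level.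
Qed.

Let layers_ge0 c l x : (forall k, 0 <= c k)%R -> 0 <= layers c l x.
Proof.
by move=> c0; apply: nneseries_ge0 => k _ _; rewrite mule_ge0 ?lee_fin.
Qed.

Let layers_ge c l x k : (forall k, 0 <= c k)%R -> D x -> (l k < modulus (f x))%R ->
  (c k)%:E <= layers c l x.
Proof.
move=> c0 Dx lk; apply: le_trans (nneseries_lim_ge k.+1 _); last first.
  by move=> i _ _; rewrite mule_ge0 ?lee_fin.
rewrite big_nat_recr//= indicE mem_set// mule1 leeDr// sume_ge0// => i _.
by rewrite mule_ge0 ?lee_fin.
Qed.

Let integral_layers c l : (forall k, 0 <= c k)%R ->
  \int[lam]_(x in M) layers c l x = \sum_(0 <= k <oo) (c k)%:E * lam (M `&` level (l k)).
Proof.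
move=> c0; have mi k : measurable_fun M (fun x => (\1_(level (l k)) x)%:E : \bar R).
  by apply/measurable_EFinP/measurable_indic; exact: measurable_level.
rewrite integral_nneseries.
- apply: eq_eseriesr => k _; rewrite (ge0_integralZl_EFin _ mM _ (mi k) (c0 k)).
    by rewrite integral_indic//; [rewrite setIC|exact: measurable_level].
  by move=> x _; rewrite lee_fin.
- exact: mM.
- by move=> k; exact: measurable_funeM.
- by move=> k x _; rewrite mule_ge0 ?lee_fin.
Qed.

Lemma integral_modulus_le : \int[lam]_(x in M) (modulus (f x))%:E <=
  (8 * C * p)%:E * lorentz_norm mu D p f.
Proof.
(* A positive modulus lies in an interval []l k, c k]] with [c k = 2 * l k], of family [A] above [1]
   and of family [B] up to [1]: two families because [k] is a natural number. Each contributes a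
   factor [4], hence the [8]. *)
pose cA k := (2 ^+ k.+1 : R)%R; pose lA k := (2 ^+ k : R)%R.
pose cB k := ((2 ^+ k)^-1 : R)%R; pose lB k := ((2 ^+ k.+1)^-1 : R)%R.
have cA0 k : (0 <= cA k)%R by rewrite exprn_ge0.
have cB0 k : (0 <= cB k)%R by rewrite invr_ge0 exprn_ge0.
apply: (@le_trans _ _ (\int[lam]_(x in M) (layers cA lA x + layers cB lB x))).
  apply: ge0_le_integral_nomeas => x Mx; first by rewrite lee_fin modulusE sqrtr_ge0.
  have Dx := MD Mx; have : (0 <= modulus (f x))%R by rewrite modulusE sqrtr_ge0.
  rewrite le_eqVlt => /predU1P[<-|g0]; first by rewrite adde_ge0// layers_ge0.
  have [g1|g1] := leP (modulus (f x)) 1%R.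
    have [|k [lk ck]] := @dyadic_down _ (modulus (f x)); first by rewrite g0.
    apply: (@le_trans _ _ (layers cB lB x)); last by rewrite leeDr// layers_ge0.
    by apply: le_trans (layers_ge (k := k) cB0 Dx lk); rewrite lee_fin.
  have [k [lk ck]] := dyadic_up g1.
  apply: (@le_trans _ _ (layers cA lA x)); last by rewrite leeDl// layers_ge0.
  by apply: le_trans (layers_ge (k := k) cA0 Dx lk); rewrite lee_fin.
rewrite ge0_integralD//; last 4 first.
- by move=> x _; exact: layers_ge0.
- exact: measurable_layers.
- by move=> x _; exact: layers_ge0.
- exact: measurable_layers.
have normalize c l : (forall k, 0 <= c k)%R -> (forall k, 0 < l k)%R ->
  (forall (x : R) N, (0 <= x)%R -> (\sum_(0 <= k < N) c k * (l k <= x)%R%:R <= 4 * x)%R) ->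
  \int[lam]_(x in M) layers c l x <= 4%:E * ((C * p)%:E * lorentz_norm mu D p f).
  move=> c0 l0 cl; rewrite integral_layers//.
  have -> : \sum_(0 <= k <oo) (c k)%:E * lam (M `&` level (l k)) =
     4%:E * \sum_(0 <= k <oo) (c k / 4)%:E * lam (M `&` level (l k)).
    rewrite -nneseriesZl; last by move=> k _; rewrite mule_ge0// lee_fin divr_ge0.
    apply: eq_eseriesr => k _; rewrite muleA -EFinM; congr (_%:E * _).
    by rewrite mulrC divfK.
  apply: lee_wpmul2l => //; apply: layer_sum_le => //.
    by move=> k; rewrite divr_ge0.
  move=> x N x0; have := cl x N x0.
  rewrite (eq_bigr (fun k => 4 * (c k / 4 * (l k <= x)%R%:R))%R); last first.
    by move=> k _; field.
  by rewrite -mulr_sumr ler_pM2l.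
have -> : (8 * C * p)%:E * lorentz_norm mu D p f =
    4%:E * ((C * p)%:E * lorentz_norm mu D p f) + 4%:E * ((C * p)%:E * lorentz_norm mu D p f).
  rewrite -mule2n -mule_natl !muleA -!EFinM; congr (_%:E * _); ring.
apply: leeD; apply: normalize => //.
- by move=> k; rewrite exprn_gt0.
- by move=> x N; exact: dyadic_up_sum.
- by move=> k; rewrite invr_gt0 exprn_gt0.
- by move=> x N; exact: dyadic_down_sum.
Qed.

End lorentz_layer_cake.

(** * Existence of adapted frames *)

Section orthonormal_basis.
Context {R : realType}.

Lemma mulmx_trmx_ge0 N (x : 'rV[R]_N) : 0 <= (x *m x^T) 0 0.
Proof. by rewrite mxE sumr_ge0// => i _; rewrite mxE -expr2 sqr_ge0. Qed.

Lemma mulmx_trmx_gt0 N (x : 'rV[R]_N) : x != 0 -> 0 < (x *m x^T) 0 0.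
Proof.
move=> x0; rewrite lt_neqAle mulmx_trmx_ge0 andbT eq_sym.
apply: contra x0; rewrite mxE psumr_eq0; last by move=> i _; rewrite mxE -expr2 sqr_ge0.
move=> /allP xi; apply/eqP/rowP => i; have := xi i; rewrite mem_index_enum => /(_ isT).
by rewrite !mxE -expr2 sqrf_eq0 => /eqP.
Qed.

(** Used twice: to take an orthogonal complement inside [W], and to cut [V] by the hyperplane of
    vanishing last coordinate. *)
Lemma dim_functional_ker N (W : {vspace 'rV[R]_N}) (e : 'cV[R]_N) d :
  \dim W = d.+1 -> (exists2 x, x \in W & x *m e != 0) ->
  \dim (W :&: lker (linfun (mulmxr e : 'rV[R]_N -> 'M[R]_1)))%VS = d.
Proof.
move=> dimW [x xW xe]; set f := linfun _.
have := limg_ker_dim f W; rewrite dimW => dE.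
have f1 : \dim (f @: W) = 1%N.
  apply/eqP; rewrite eqn_leq; apply/andP; split.
    by apply: leq_trans (dimvS (subvf _)) _; rewrite dimvf.
  rewrite lt0n dimv_eq0; apply: contra xe => /eqP fW0.
  have : f x \in (f @: W)%VS by exact: memv_img.
  by rewrite fW0 memv0 lfunE.
by move: dE; rewrite f1 addn1 => -[].
Qed.

Lemma memv_functional_ker N (W : {vspace 'rV[R]_N}) (e : 'cV[R]_N) x :
  x \in (W :&: lker (linfun (mulmxr e : 'rV[R]_N -> 'M[R]_1)))%VS =
  (x \in W) && (x *m e == 0).
Proof. by rewrite memv_cap memv_ker lfunE. Qed.

Lemma orthonormal_basis N d (W : {vspace 'rV[R]_N}) : \dim W = d ->
  exists B : 'M[R]_(d, N), B *m B^T = 1%:M /\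
    forall x, x \in W <-> exists w, x = w *m B.
Proof.
elim: d W => [|d IH] W dimW.
  exists 0; split; first by apply/matrixP => -[].
  move: dimW => /eqP; rewrite dimv_eq0 => /eqP -> x; rewrite memv0; split.
    by move=> /eqP ->; exists 0; rewrite mul0mx.
  by move=> [w ->]; rewrite mulmx0.
have W0 : W != 0%VS by rewrite -dimv_eq0 dimW.
have pW := memv_pick W; have p0 : vpick W != 0 by rewrite vpick0.
have pp := mulmx_trmx_gt0 p0.
pose r := Num.sqrt ((vpick W *m (vpick W)^T) 0 0).
have r0 : r != 0 by rewrite gt_eqF// sqrtr_gt0.
pose e := r^-1 *: vpick W.
have eW : e \in W by exact: memvZ.
have ee : e *m e^T = 1%:M.
  apply/rowP => i; rewrite ord1 linearZ/= -scalemxAr -scalemxAl !mxE eqxx.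
  have -> : \sum_j vpick W 0 j * (vpick W)^T j 0 = r ^+ 2.
    by rewrite sqr_sqrtr ?(ltW pp)// mxE.
  by rewrite /=; field.
have [|B' [BB BW]] := IH _ (dim_functional_ker (e := e^T) dimW _).
  by exists e => //; rewrite ee oner_neq0.
have Be i : row i B' *m e^T = 0.
  apply/eqP; suff : row i B' \in (W :&: lker (linfun (mulmxr e^T : 'rV[R]_N -> 'M[R]_1)))%VS.
    by rewrite memv_functional_ker => /andP[].
  by apply/BW; exists (delta_mx 0 i); rewrite rowE.
have Be0 : B' *m e^T = 0 by apply/row_matrixP => i; rewrite row_mul Be row0.
pose C : 'M[R]_(1 + d, N) := col_mx e B'.
have CC : C *m C^T = 1%:M.
  rewrite /C tr_col_mx mul_col_row ee BB Be0.
  rewrite (_ : e *m B'^T = 0); last by rewrite -[LHS]trmxK trmx_mul trmxK Be0 trmx0.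
  by rewrite -scalar_mx_block.
exists C; split; first exact: CC.
move=> x; split=> [xW|[w ->]].
  have [|w' wE] := (BW (x - (x *m e^T) *m e)).1.
    rewrite memv_functional_ker; apply/andP; split.
      by rewrite memvB// [x *m e^T]mx11_scalar mul_scalar_mx memvZ.
    by rewrite mulmxBl -[X in _ - X]mulmxA ee mulmx1 subrr.
  have xE : x = row_mx (x *m e^T) w' *m C by rewrite mul_row_col -wE addrC subrK.
  by exists (row_mx (x *m e^T) w').
pose w1 : 'rV[R]_(1 + d) := w.
suff : w1 *m C \in W by [].
rewrite -[w1]hsubmxK mul_row_col memvD//.
  by rewrite [lsubmx w1]mx11_scalar mul_scalar_mx memvZ.
have : rsubmx w1 *m B' \in (W :&: lker (linfun (mulmxr e^T : 'rV[R]_N -> 'M[R]_1)))%VS.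
  by apply/BW; eexists.
by rewrite memv_functional_ker => /andP[].
Qed.

(** The sign of the Lorentz form concerns the last coordinate only, so a Euclidean orthonormal basis
    of horizontal vectors is orthonormal in all three models. *)
Lemma ambient_form_last0 X n (x y : 'rV[R]_n.+1) : y 0 ord_max = 0 ->
  ambient_form X x y = (x *m y^T) 0 0.
Proof.
move=> y0; rewrite /ambient_form y0 !mulr0 addr0 mxE (bigD1 ord_max)//= mxE y0 mulr0 add0r.
rewrite [RHS](reindex_omap (lift ord_max) (unlift ord_max))/=.
  apply: eq_big => [i|i _]; last by rewrite mxE.
  by rewrite liftK eqxx eq_sym neq_lift.
by move=> i; case: unliftP => [j ->|->] //; rewrite ?eqxx.
Qed.

Lemma ambient_form_sqrD X n (x y : 'rV[R]_n.+1) : ambient_form X (x + y) (x + y) =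
  ambient_form X x x + 2 * ambient_form X x y + ambient_form X y y.
Proof.
by rewrite ambient_formDl !ambient_formDr (ambient_formC X y x); ring.
Qed.

Lemma mul_delta_last n (x : 'rV[R]_n.+1) :
  (x *m (delta_mx ord_max 0 : 'cV[R]_n.+1) == 0) = (x 0 ord_max == 0).
Proof.
rewrite -colE; apply/eqP/eqP => [/matrixP/(_ 0 0)|x0]; first by rewrite !mxE.
by apply/matrixP => i j; rewrite !mxE !ord1.
Qed.

(** The rows of [B] are an orthonormal basis of the horizontal part of [V], and [b0] is the
    component [y] of [x0] orthogonal to it, rescaled into the model space. On the sphere any [x0]
    with nonzero last coordinate can be rescaled; elsewhere it has to come from the model. *)
Lemma adapted_frame_exists X n m (V : {vspace 'rV[R]_n.+1}) x0 :
  \dim V = m.+2 -> x0 \in V -> x0 0 ord_max != 0 ->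
  (X = Spherical \/ model_space X x0) ->
  exists h b0 (B : 'M[R]_(m.+1, n.+1)), adapted_frame X h b0 B /\
    forall x, x \in V <-> frame_span b0 B x.
Proof.
move=> dimV xV lx0 Xx0.
pose el : 'cV[R]_n.+1 := delta_mx ord_max 0.
have dV0 := dim_functional_ker (e := el) dimV.
have [|B [BB BV]] := orthonormal_basis (dV0 _).
  by exists x0 => //; rewrite mul_delta_last.
have BVV i : row i B \in V /\ row i B 0 ord_max = 0.
  have : row i B \in (V :&: lker (linfun (mulmxr el : 'rV[R]_n.+1 -> 'M[R]_1)))%VS.
    by apply/BV; exists (delta_mx 0 i); rewrite rowE.
  by rewrite memv_functional_ker mul_delta_last => /andP[? /eqP].
have Bl i : B i ord_max = 0 by have [_] := BVV i; rewrite mxE.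
pose p := x0 *m B^T; pose y := x0 - p *m B.
have pBl : (p *m B) 0 ord_max = 0.
  by rewrite mxE big1// => i _; rewrite Bl mulr0.
have ly : y 0 ord_max = x0 0 ord_max by rewrite mxE [X in _ + X]mxE pBl subr0.
have yB : y *m B^T = 0 by rewrite mulmxBl -mulmxA BB mulmx1 subrr.
have wV w : w *m B \in V.
  have : w *m B \in (V :&: lker (linfun (mulmxr el : 'rV[R]_n.+1 -> 'M[R]_1)))%VS.
    by apply/BV; eexists.
  by rewrite memv_functional_ker => /andP[].
have yV : y \in V by rewrite memvB.
have Frow (x : 'rV[R]_n.+1) i : ambient_form X x (row i B) = (x *m B^T) 0 i.
  rewrite ambient_form_last0; last by have [] := BVV i.
  by rewrite !mxE; apply: eq_bigr => j _; rewrite !mxE.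
have FyB i : ambient_form X y (row i B) = 0 by rewrite Frow yB mxE.
have FBB i j : ambient_form X (row i B) (row j B) = (i == j)%:R.
  by rewrite Frow -row_mul BB !mxE.
have Fy : ambient_form X x0 x0 = ambient_form X y y + \sum_i p 0 i ^+ 2.
  have {1 2}-> : x0 = y + p *m B by rewrite subrK.
  rewrite ambient_form_sqrD.
  have -> : ambient_form X y (p *m B) = 0.
    by rewrite ambient_form_mulmxr big1// => i _; rewrite FyB mulr0.
  rewrite mulr0 addr0; congr (_ + _); rewrite ambient_form_mulmxl.
  apply: eq_bigr => i _; rewrite ambient_formC Frow -mulmxA BB mulmx1.
  by rewrite expr2.
(* In the hyperbolic case removing the horizontal part lowers the form, so [y] remains timelike. On
   the sphere the sign of the last coordinate enters [t] so that [b0] lies in the upper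
   hemisphere. *)
have [t [Xty lty]] : exists t, model_space X (t *: y) /\ 0 < (t *: y) 0 ord_max.
  case: X Xx0 {Frow FyB FBB} Fy => Xx0 Fy.
  - exists 1; rewrite scale1r /model_space/= ly.
    by case: Xx0 => //= ->; split => //; exact: ltr01.
  - case: Xx0 => //= -[Fx lx]; rewrite Fx in Fy.
    have s0 : 0 <= \sum_i p 0 i ^+ 2 by apply: sumr_ge0 => i _; exact: sqr_ge0.
    have Fy0 : 0 < - ambient_form Hyperbolic y y by lra.
    have r0 : 0 < Num.sqrt (- ambient_form Hyperbolic y y) by rewrite sqrtr_gt0.
    exists (Num.sqrt (- ambient_form Hyperbolic y y))^-1.
    have lt0 : 0 < ((Num.sqrt (- ambient_form Hyperbolic y y))^-1 *: y) 0 ord_max.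
      by rewrite mxE ly mulr_gt0// invr_gt0.
    split => //; split => //; rewrite ambient_formZl ambient_formZr mulrA -invfM -expr2.
    by rewrite sqr_sqrtr ?(ltW Fy0)// invrN mulNr mulVf// -oppr_eq0 gt_eqF.
  - have Fy0 : 0 < ambient_form Spherical y y.
      rewrite ambient_form_spatial mul1r ltr_wpDl ?spatial_ge0// ly exprn_even_gt0//=.
    have r0 : 0 < Num.sqrt (ambient_form Spherical y y) by rewrite sqrtr_gt0.
    exists (Num.sg (x0 0 ord_max) * (Num.sqrt (ambient_form Spherical y y))^-1).
    split; last first.
      by rewrite mxE ly mulrAC -normrEsg mulr_gt0 ?invr_gt0// normr_gt0.
    rewrite /= ambient_formZl ambient_formZr mulrA -expr2 exprMn sqr_sg lx0 mul1r.
    by rewrite exprVn sqr_sqrtr ?(ltW Fy0)// mulVf// gt_eqF.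
exists ((t *: y) 0 ord_max), (t *: y), B; split.
  split => //.
  by move=> i; rewrite ambient_formZl FyB mulr0.
move=> x; split=> [xV'|[a [w ->]]]; last by rewrite memvD// !memvZ.
have tn0 : (t *: y) 0 ord_max != 0 by rewrite gt_eqF.
pose a := x 0 ord_max / (t *: y) 0 ord_max.
exists a; have [|w wE] := (BV (x - a *: (t *: y))).1.
  rewrite memv_functional_ker mul_delta_last memvB ?memvZ//=.
  by rewrite mxE [X in _ + X]mxE [X in - X]mxE /a divfK// subrr.
by exists w; rewrite -wE addrC subrK.
Qed.

End orthonormal_basis.

(** * The k-plane transform of a radial function *)

Section distance.
Context {R : realType}.

Lemma derive1_s_ X (t : R) : (s_ X)^`()%classic t =
  match X with
  | Euclidean => 1
  | Hyperbolic => (expR t + expR (- t)) / 2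
  | Spherical => cos t
  end.
Proof.
case: X; rewrite derive1E.
- exact: derive_id.
- have eN : is_derive t 1 (expR \o -%R) (expR (- t) * -1).
    exact: is_derive1_comp.
  rewrite (_ : s_ Hyperbolic = 2^-1 \*: (expR - (expR \o -%R))); last first.
    by apply/funext => x /=; rewrite /sinh mulrC.
  by rewrite derive_val mulrN1 opprK /= [RHS]mulrC.
- exact: derive_val.
Qed.

Lemma cosh_arcosh (h : R) : 1 <= h ->
  (expR (arcosh h) + expR (- arcosh h)) / 2 = h.
Proof.
move=> h1; pose r := Num.sqrt (h ^+ 2 - 1).
have r2 : r ^+ 2 = h ^+ 2 - 1 by rewrite sqr_sqrtr// subr_ge0 exprn_ege1.
have r0 : 0 <= r by exact: sqrtr_ge0.
have u0 : 0 < h + r by lra.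
rewrite expRN /arcosh -/r lnK ?posrE//.
have -> : (h + r)^-1 = h - r.
  apply: (mulfI (lt0r_neq0 u0)); rewrite divff ?gt_eqF//.
  by transitivity (h ^+ 2 - r ^+ 2); [rewrite r2; ring|ring].
by field.
Qed.

Lemma arcosh_ge0 (h : R) : 1 <= h -> 0 <= arcosh h.
Proof.
move=> h1; apply: ln_ge0; have := sqrtr_ge0 (h ^+ 2 - 1); lra.
Qed.

Lemma cosh_le (s t : R) : 0 <= s -> s <= t ->
  (expR s + expR (- s)) / 2 <= (expR t + expR (- t)) / 2.
Proof.
move=> s0 st; rewrite ler_pM2r// !expRN.
have a1 : 1 <= expR s by rewrite -expR0 ler_expR.
have ab : expR s <= expR t by rewrite ler_expR.
set a := expR s in a1 ab *; set b := expR t in ab *.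
have a0 : 0 < a by lra.
have b0 : 0 < b by lra.
rewrite -subr_ge0.
have -> : b + b^-1 - (a + a^-1) = (b - a) * (a * b - 1) / (a * b).
  by field; rewrite !gt_eqF.
rewrite divr_ge0 ?mulr_ge0 ?subr_ge0 ?(ltW a0) ?(ltW b0)//; nra.
Qed.

Lemma model_dist_originE X n (x : 'rV[R]_n.+1) : X <> Euclidean ->
  model_dist X (origin n) x = if X is Hyperbolic then arcosh (x 0 ord_max)
                              else acos (x 0 ord_max).
Proof.
case: X => //= _; rewrite ambient_form_originl ?mul1r//.
by rewrite mulN1r opprK.
Qed.

Lemma hyperboloid_last_ge1 n (x : 'rV[R]_n.+1) : model_space Hyperbolic x ->
  1 <= x 0 ord_max.
Proof.
rewrite /= ambient_form_spatial => -[x1 x0]; have := spatial_ge0 x => s0.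
by have [//|x2] := leP 1 (x 0 ord_max); nra.
Qed.

(** In the hyperbolic case the weight increases with the distance, and it is enough that [b0]
    belongs to the plane. The cosine decreases, so on the sphere [b0] must be shown to be closest: a
    point of the plane has last coordinate [a * h] with [a <= 1]. *)
Lemma derive1_s_dist X m n (h : R) (b0 : 'rV[R]_n.+1) (B : 'M[R]_(m.+1, n.+1)) :
  adapted_frame X h b0 B ->
  `|(s_ X)^`()%classic
     (dist_set X (origin n) (model_space X `&` frame_span b0 B))| <= h.
Proof.
move=> frame; have h0 := af_gt0 frame; rewrite derive1_s_ /dist_set.
set S := [set model_dist X (origin n) y | y in _].
have Sb0 : S (model_dist X (origin n) b0).
  exists b0 => //; split; first exact: af_b0 frame.
  by exists 1, 0; rewrite scale1r mul0mx addr0.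
have := af_b0 frame; have := af_last frame.
case: X @S frame Sb0 => S frame Sb0 lb Xb0.
- move: Xb0; rewrite /= lb => ->; by rewrite normr1.
- have S0 : lbound S 0.
    move=> _ [y [Xy _] <-]; rewrite model_dist_originE//.
    exact/arcosh_ge0/hyperboloid_last_ge1.
  have d0 : 0 <= inf S by apply: lb_le_inf => //; exists (model_dist Hyperbolic (origin n) b0).
  have dh : inf S <= arcosh h.
    have <- : model_dist Hyperbolic (origin n) b0 = arcosh h.
      by rewrite model_dist_originE//= lb.
    by apply: ge_inf => //; exists 0.
  have h1 : 1 <= h by rewrite -lb; exact: hyperboloid_last_ge1.
  rewrite ger0_norm ?divr_ge0 ?addr_ge0 ?expR_ge0//.
  by rewrite -[leRHS](cosh_arcosh h1); exact: cosh_le.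
- have /andP[h1' h1] : -1 <= h <= 1 by rewrite -lb; exact: sphere_last_le1.
  have SE y : S y -> acos h <= y.
    move=> [x [Xx [a [w xE]]] <-]; rewrite model_dist_originE//.
    have xh : x 0 ord_max <= h.
      rewrite xE (frame_last frame) ger_pMl//.
      move: Xx; rewrite xE /= (frame_form frame) => e.
      have b1 : ambient_form Spherical b0 b0 = 1 := Xb0.
      have w0 : 0 <= \sum_i w 0 i ^+ 2 by apply: sumr_ge0 => i _; exact: sqr_ge0.
      by rewrite b1 mulr1 in e; have [//|a1] := leP a 1; nra.
    have /andP[x1 x2] := sphere_last_le1 Xx.
    by rewrite leNgt -ltr_cos ?acosK ?in_itv/= ?acos_ge0 ?acos_lepi ?x1 ?x2 ?h1 ?h1'// -leNgt.
  have -> : inf S = acos h.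
    apply/eqP; rewrite eq_le; apply/andP; split.
      have <- : model_dist Spherical (origin n) b0 = acos h.
        by rewrite model_dist_originE//= lb.
      by apply: ge_inf => //; exists (acos h).
    apply: lb_le_inf => //.
    by exists (model_dist Spherical (origin n) b0).
  by rewrite acosK ?in_itv/= ?h1 ?h1'// gtr0_norm.
Qed.

(** Planes inside the equator carry no adapted frame. Since [0 * +oo = 0], the vanishing weight
    settles them even if the transform does not exist there. *)
Lemma derive1_s_dist_equator n (xi : set 'rV[R]_n.+1) : xi !=set0 ->
  (forall x, xi x -> x 0 ord_max = 0) ->
  (s_ Spherical)^`()%classic (dist_set Spherical (origin n) xi) = 0.
Proof.
move=> [x0 xi0] xi_last; rewrite derive1_s_ /dist_set.
rewrite (_ : [set _ | _ in _] = [set pi / 2]); first by rewrite inf1 cos_pihalf.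
apply/seteqP; split => [_ [y xy <-]|_ ->].
  by rewrite model_dist_originE//= xi_last// acos0.
by exists x0 => //; rewrite model_dist_originE//= xi_last// acos0.
Qed.

End distance.

(** * The bound for a single plane *)

Section plane_transform.
Context {R : realType}.
Local Open Scope ereal_scope.

(** The numerator and the denominator are the two exponents of [a] in [radial_mass_bathtub], which
    is where [p] comes from in all three models. *)
Lemma critical_exponentE X m m' :
  critical_exponent X m'.+2 m.+2 =
    ((m' + radial_dim X)%:R / (m + radial_dim X)%:R)%R :> R.
Proof. by case: X; rewrite /= ?addn1 ?addn2. Qed.

Definition mass_constant m' : R := ((2 / m'.+2%:R) ^+ m'.+1)%R.

(** Here [6 = 2 * 3], for the two half planes and the bathtub constant; [8 ^+ m.+1] bounds the
    angular integral on the plane, and [mass_constant] is the angular lower bound on the whole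
    space. *)
Definition level_constant X m m' : R :=
  (6 * 8 ^+ m.+1 * (mass_constant m')^-1 `^ (critical_exponent X m'.+2 m.+2)^-1)%R.

Lemma mass_constant_gt0 m' : (0 < mass_constant m')%R.
Proof. by rewrite exprn_gt0// divr_gt0. Qed.

Lemma level_constant_gt0 X m m' : (0 < level_constant X m m')%R.
Proof.
by rewrite !mulr_gt0 ?exprn_gt0// powR_gt0// invr_gt0 mass_constant_gt0.
Qed.

Lemma level_measure_le X m m' (h : R) (b0 : 'rV[R]_m'.+3)
    (B : 'M[R]_(m.+2, m'.+3)) M (lam mu : {measure set 'rV[R]_m'.+3 -> \bar R})
    (E : set 'rV[R]_m'.+3) (b : R) : (m <= m')%N ->
  adapted_frame X h b0 B -> is_riemannian_measure X m.+2 M lam ->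
  M = model_space X `&` frame_span b0 B ->
  is_riemannian_measure X m'.+2 (model_space X) mu -> measurable E ->
  (forall x y, model_space X x -> model_space X y -> E x ->
     radial_coord X x = radial_coord X y -> radial_coord X x <> 1%R -> E y) ->
  (0 < b)%R -> mu E <= b%:E ->
  lam (M `&` E) <=
    (level_constant X m m' / h * b `^ (critical_exponent X m'.+2 m.+2)^-1)%:E.
Proof.
move=> mm' frame lamM ME muM mE ErE b0' muE.
have h0 := af_gt0 frame; have C0 := mass_constant_gt0 m'.
have [A [mA lamA muA]] := radial_set_comparison frame lamM ME muM mE ErE.
set e := radial_dim X.
have e0 : (0 < e)%N by rewrite /e; case: X {frame lamM ME muM ErE A mA lamA muA e}.
have n0 k : (0 < (k + e)%:R :> R)%R by rewrite ltr0n addn_gt0 e0 orbT.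
(* [y] bounds the radial mass of [A] in the whole space, and [a] is chosen so that [a^(m' + e) = y];
   then [a^(m + e)] is [y] to the power [1/p]. *)
pose y := (b / mass_constant m')%R; have y0 : (0 < y)%R by rewrite divr_gt0.
pose a := (y `^ (m' + e)%:R^-1)%R; have a0 : (0 < a)%R by exact: powR_gt0.
have am' : (a ^+ (m' + e) = y)%R.
  by rewrite -powR_mulrn ?(ltW a0)// -powRrM mulVf ?gt_eqF// powRr1// ltW.
have am : (a ^+ (m + e) = y `^ (critical_exponent X m'.+2 m.+2)^-1)%R.
  by rewrite -powR_mulrn ?(ltW a0)// -powRrM critical_exponentE invf_div mulrC.
have massA : radial_mass X m' A <= (a ^+ (m' + e))%:E.
  rewrite am' EFinM lee_pdivlMr//.
  exact: le_trans muA muE.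
have := radial_mass_bathtub mA mm' a0 massA; rewrite -/e am => massA'.
apply: (le_trans lamA); apply: (@le_trans _ _ (2%:E * ((h^-1)%:E *
  (3 * y `^ (critical_exponent X m'.+2 m.+2)^-1)%:E * (8 ^+ m.+1)%:E))).
  apply: lee_wpmul2l => //; apply: lee_wpmul2r; first by rewrite lee_fin exprn_ge0.
  by apply: lee_wpmul2l => //; rewrite lee_fin invr_ge0 ltW.
rewrite -!EFinM lee_fin /level_constant /y powRM ?(ltW b0') ?invr_ge0 ?(ltW C0)//.
set r1 := powR b _; set r2 := powR _ _.
by rewrite le_eqVlt; apply/orP; left; apply/eqP; field; rewrite gt_eqF.
Qed.

Lemma measurable_modulus n (D : set 'rV[R]_n.+1) (f : 'rV[R]_n.+1 -> R[i]) :
  cmeasurable D f -> measurable_fun D (fun x => modulus (f x) : measurableTypeR R).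
Proof.
move=> [mre mim]; rewrite (_ : (fun _ => _) = Num.sqrt \o
  (fun x => complex.Re (f x) ^+ 2 + complex.Im (f x) ^+ 2)%R); last first.
  by apply/funext => x; rewrite /= modulusE.
have ms : measurable_fun setT (@Num.sqrt R).
  by apply: continuous_measurable_fun; exact: sqrt_continuous.
apply: measurableT_comp ms _; apply: measurable_funD; exact: measurable_funX.
Qed.

Lemma normr_Re_le_modulus (z : R[i]) : (`|complex.Re z| <= modulus z)%R.
Proof.
by rewrite modulusE -sqrtr_sqr ler_wsqrtr// lerDl sqr_ge0.
Qed.

Lemma normr_Im_le_modulus (z : R[i]) : (`|complex.Im z| <= modulus z)%R.
Proof.
by rewrite modulusE -sqrtr_sqr ler_wsqrtr// lerDr sqr_ge0.
Qed.

Lemma modulus_le (z : R[i]) : (modulus z <= `|complex.Re z| + `|complex.Im z|)%R.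
Proof.
rewrite modulusE -(@ler_pXn2r _ 2) ?nnegrE ?sqrtr_ge0 ?addr_ge0//.
rewrite sqr_sqrtr ?addr_ge0 ?sqr_ge0// sqrrD !real_normK ?num_real//.
by rewrite addrAC lerDl mulrn_wge0// mulr_ge0.
Qed.

(** Finiteness of [b] makes the real and imaginary parts integrable, hence the finite branch of
    [kplane_modulus]. The factor [2] comes from bounding the two parts separately. *)
Lemma kplane_modulus_le n (lam : set 'rV[R]_n.+1 -> {measure set 'rV[R]_n.+1 -> \bar R})
    f (xi : set 'rV[R]_n.+1) (b : \bar R) : measurable xi -> cmeasurable xi f ->
  \int[lam xi]_(x in xi) (modulus (f x))%:E <= b -> b < +oo ->
  kplane_modulus lam f xi <= 2%:E * b.
Proof.
move=> mxi [mre mim] intb boo.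
have int_le (g : 'rV[R]_n.+1 -> R) : (forall x, `|g x| <= modulus (f x))%R ->
    \int[lam xi]_(x in xi) `|(g x)%:E| <= b.
  move=> gf; apply: le_trans intb; apply: ge0_le_integral_nomeas => x _.
    exact: abse_ge0.
  by rewrite /= lee_fin.
have fin_le (g : 'rV[R]_n.+1 -> R) : (forall x, `|g x| <= modulus (f x))%R ->
    measurable_fun xi g ->
    ((lam xi).-integrable xi (EFin \o g)) /\ (`|\int[lam xi]_(x in xi) g x|%R)%:E <= b.
  move=> gf mg; have ig : (lam xi).-integrable xi (EFin \o g).
    apply/integrableP; split; first exact/measurable_EFinP.
    exact: le_lt_trans (int_le _ gf) boo.
  split => //; apply: le_trans (int_le _ gf).
  rewrite /Rintegral -abse_EFin fineK; last exact: integrable_fin_num.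
  by apply: le_abse_integral => //; exact/measurable_EFinP.
have [ire re_le] := fin_le _ (fun x => normr_Re_le_modulus (f x)) mre.
have [iim im_le] := fin_le _ (fun x => normr_Im_le_modulus (f x)) mim.
rewrite /kplane_modulus ifT; last by apply/asboolP.
apply: (@le_trans _ _ (b + b)); last by rewrite mule_natl mule2n.
apply: le_trans (leeD re_le im_le); rewrite -EFinD lee_fin.
exact: modulus_le.
Qed.

End plane_transform.

Section plane_transform_bound.
Context {R : realType}.
Local Open Scope ereal_scope.

(** Here [16 = 2 * 8], from [kplane_modulus_le] and [integral_modulus_le]; the latter also
    contributes the exponent. *)
Definition transform_constant X m m' : R :=
  (16 * level_constant X m m' * critical_exponent X m'.+2 m.+2)%R.

Lemma critical_exponent_ge1 X m m' : (m <= m')%N ->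
  (1 <= critical_exponent X m'.+2 m.+2 :> R)%R.
Proof.
move=> mm'; rewrite critical_exponentE ler_pdivlMr ?mul1r ?ler_nat ?leq_add2r//.
by rewrite ltr0n addn_gt0; case: X; rewrite orbT.
Qed.

Lemma transform_constant_gt0 X m m' : (m <= m')%N -> (0 < transform_constant X m m')%R.
Proof.
move=> mm'; apply: mulr_gt0; first by rewrite mulr_gt0// level_constant_gt0.
exact: lt_le_trans ltr01 (critical_exponent_ge1 X mm').
Qed.

Lemma lorentz_norm_ge0 n (mu : {measure set 'rV[R]_n.+1 -> \bar R}) D (p : R) f :
  (0 < p)%R -> 0 <= lorentz_norm mu D p f.
Proof.
move=> p0; rewrite mule_ge0 ?lee_fin ?invr_ge0 ?(ltW p0)//.
apply: integral_ge0 => t; rewrite /= in_itv/= andbT => t0.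
rewrite !mule_ge0 ?lee_fin ?powR_ge0 ?invr_ge0 ?(ltW t0)//.
exact: decreasing_rearrangement_ge0.
Qed.

(** The weight is at most [h] while the level-set constant carries [1 / h], so one constant serves
    all planes. *)
Lemma kplane_transform_le X m m' (mu : {measure set 'rV[R]_m'.+3 -> \bar R})
    (lam : set 'rV[R]_m'.+3 -> {measure set 'rV[R]_m'.+3 -> \bar R}) f xi :
  (m <= m')%N ->
  is_riemannian_measure X m'.+2 (model_space X) mu ->
  Xi X m.+2 xi -> is_riemannian_measure X m.+2 xi (lam xi) ->
  radial X f -> in_lorentz mu (model_space X) (critical_exponent X m'.+2 m.+2) f ->
  `|((s_ X)^`()%classic (dist_set X (origin m'.+2) xi))%:E * kplane_modulus lam f xi|
  <= (transform_constant X m m')%:E *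
     lorentz_norm mu (model_space X) (critical_exponent X m'.+2 m.+2) f.
Proof.
move=> mm' muM [xi0 [V [dimV xiE]]] lamM frad [mf foo].
set p := critical_exponent X m'.+2 m.+2 in foo *.
have p1 : (1 <= p)%R by exact: critical_exponent_ge1.
have p0 : (0 < p)%R by exact: lt_le_trans p1.
have K0 := transform_constant_gt0 X mm'.
have L0 := lorentz_norm_ge0 mu (model_space X) f p0.
(* Without such a vector all points of [xi] have last coordinate [0], which happens on the sphere
   only, for planes inside the equator. *)
have [[x0 [x0V lx0 Xx0]]|nx0] := pselect (exists x0, [/\ x0 \in V,
    x0 0%R ord_max != 0%R & (X = Spherical \/ model_space X x0)]); last first.
  have [x1 xi1] := xi0; have Xx1 : model_space X x1 by move: xi1; rewrite xiE => -[].
  have xl x : xi x -> x 0%R ord_max = 0%R.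
    rewrite xiE => -[Xx Vx]; apply/eqP; apply: contra_notT nx0 => lx.
    by exists x; split => //; right.
  have XS : X = Spherical.
    have := xl _ xi1; case: X Xx1 {muM lamM frad mf foo nx0 p p1 p0 K0 L0 xiE} => //=.
      by move=> xl1 /eqP; rewrite xl1 oner_eq0.
    by move=> [_ xl1] /eqP; rewrite gt_eqF.
  rewrite XS (derive1_s_dist_equator xi0 xl) -XS.
  by rewrite mul0e abse0 mule_ge0// lee_fin ltW.
have [h [b0 [B [frame VB]]]] := adapted_frame_exists dimV x0V lx0 Xx0.
have {}xiE : xi = model_space X `&` frame_span b0 B.
  by rewrite xiE; congr (_ `&` _); apply/seteqP; split => x /= /VB.
have h0 := af_gt0 frame.
have mxi : measurable xi.
  rewrite xiE; apply: measurableI; first exact: measurable_model_space.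
  exact: (measurable_frame_span frame).
have xiX : xi `<=` model_space X by rewrite xiE => x [].
have mX : measurable (model_space X : set 'rV[R]_m'.+3) by exact: measurable_model_space.
have mmod := measurable_modulus mf.
have C0 : (0 < level_constant X m m' / h)%R by rewrite divr_gt0// level_constant_gt0.
have intb := integral_modulus_le (mu := mu) (lam := lam xi) mX mxi xiX mmod p1 C0.
have {}intb : \int[lam xi]_(x in xi) (modulus (f x))%:E <=
    (8 * (level_constant X m m' / h) * p)%:E * lorentz_norm mu (model_space X) p f.
  apply: intb => s b s0 b00 mus; apply: level_measure_le frame lamM xiE muM _ _ b00 mus => //.
    exact: measurable_level.
  move=> x y Xx Xy [_ /= sx] xy x1; split => //=.
  by rewrite -(radial_coord_eq frad Xx Xy xy)//; exact/eqP.
have Loo : lorentz_norm mu (model_space X) p f \is a fin_num by rewrite ge0_fin_numE.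
have cxi : cmeasurable xi f by case: mf => ? ?; split; exact: measurable_funS xiX _.
have boo : (8 * (level_constant X m m' / h) * p)%:E *
    lorentz_norm mu (model_space X) p f < +oo.
  by rewrite -(fineK Loo) -EFinM ltry.
have kle := kplane_modulus_le mxi cxi intb boo.
have k0 : 0 <= kplane_modulus lam f xi.
  by rewrite /kplane_modulus; case: ifP => // _; rewrite lee_fin modulusE sqrtr_ge0.
rewrite abseM (gee0_abs k0).
apply: (@le_trans _ _ (h%:E * (2%:E * ((8 * (level_constant X m m' / h) * p)%:E *
    lorentz_norm mu (model_space X) p f)))).
  apply: lee_pmul => //; rewrite /= lee_fin xiE.
  exact: derive1_s_dist frame.
rewrite !muleA -!EFinM le_eqVlt; apply/orP; left; apply/eqP; congr (_%:E * _).
by rewrite /transform_constant -/p; field; rewrite !gt_eqF.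
Qed.

End plane_transform_bound.

Theorem theorem3p6 (R : realType) (n k : nat) (hk : (2 <= k <= n - 1)%N) :
  exists2 K : R, 0 < K &
  forall (X : model)
    (mu : {measure set 'rV[R]_n.+1 -> \bar R})
    (lam : set 'rV[R]_n.+1 -> {measure set 'rV[R]_n.+1 -> \bar R})
    (nu : {measure set (@plane_type R n X k) -> \bar R}),
    is_riemannian_measure X n (model_space X) mu ->
    (forall xi, Xi X k xi -> is_riemannian_measure X k xi (lam xi)) ->
    is_invariant_measure nu ->
  forall f : 'rV[R]_n.+1 -> R[i],
    radial X f -> in_lorentz mu (model_space X) (critical_exponent X n k) f ->
    ('N[nu]_+oo[(fun xi : @plane_type R n X k =>
        ((s_ X)^`()%classic (dist_set X (origin n) xi))%:E * kplane_modulus lam f xi)]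
     <= K%:E * lorentz_norm mu (model_space X) (critical_exponent X n k) f)%E.
Proof.
case: k hk => [|[|m]]; rewrite ?andbF// => /andP[_].
case: n => [|[|m']] // mm'; have {}mm' : (m <= m')%N.
  by move: mm'; rewrite subSS subn0 ltnS => /ltnW.
have KX X := @transform_constant_gt0 R X m m' mm'.
(* [K] is chosen before the model, so it is the sum of the three positive constants. *)
exists (transform_constant Euclidean m m' + transform_constant Hyperbolic m m' +
        transform_constant Spherical m m'); first by rewrite !addr_gt0.
move=> X mu lam nu muM lamM [nuXi _ _ _] f frad fL.
set K := _ + _ + _; set p := critical_exponent X _ _ in fL *.
have p0 : 0 < p by exact: lt_le_trans ltr01 (critical_exponent_ge1 X mm').
have KXle : transform_constant X m m' <= K.
  rewrite /K; have := KX Euclidean; have := KX Hyperbolic; have := KX Spherical.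
  by case: X {mu lam nu muM lamM nuXi f frad fL p p0} => /=; lra.
have K0 : 0 <= K by exact: le_trans (ltW (KX X)) KXle.
have L0 := lorentz_norm_ge0 mu (model_space X) f p0.
(* The planes that meet the whole space: a generator of the Effros sigma-algebra. *)
have mXi : measurable (Xi X m.+2 : set (@plane_type R m'.+2 X m.+2)).
  apply: sub_sigma_algebra; exists setT; first exact: openT.
  apply/seteqP; split => [xi []//|xi xiXi]; split => //.
  by case: (xiXi) => -[x xix] _; exists x.
(* When the total mass is not positive the norm is [0] by convention. Otherwise it is an essential
   supremum, bounded plane by plane off the null complement of [Xi]. *)
rewrite unlock; case: ifPn => _; last by rewrite mule_ge0.
apply/ess_supP; exists (~` Xi X m.+2); split => //; first exact: measurableC.
move=> xi /=; apply: contra_not => xiXi.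
apply: (le_trans (kplane_transform_le mm' muM xiXi (lamM _ xiXi) frad fL)).
by apply: lee_wpmul2r.
Qed.
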